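(* For $0<|q|<1$ we have \begin{align*} \sum_{i,j\ge 0}\frac{q^{i^2-2ij+2j^2}}{(q;q)_i(q^2;q^2)_j} &=\frac{J_2^6J_{28}^3}{J_1^4J_4^2J_{4,28}J_{6,28}J_{8,28}}-2q\frac{J_4^2J_{4,28}J_{5,14}}{J_1^2J_2J_{28}}\\ &=\frac{J_4^5J_{28}J_{6,56}J_{16,56}J_{22,56}}{J_2^4J_8^2J_{56}^3}+2q\frac{J_4J_8J_{56}^3}{J_{2,4}J_{4,8}J_{4,56}J_{16,56}J_{24,56}},\\ \sum_{i,j\ge 0}\frac{q^{i^2-2ij+2j^2-i+2j}}{(q;q)_i(q^2;q^2)_j} &=2\frac{J_4^2J_{1,14}J_{12,28}}{J_1^2J_2J_{28}}-q\frac{J_2^6J_{28}^3}{J_1^4J_4^2J_{4,28}J_{10,28}J_{12,28}}\\ &=2\frac{J_8J_{56}J_{24,56}}{J_2^2J_{12,56}}+q\frac{J_4^5J_{28}J_{8,56}J_{10,56}J_{18,56}}{J_2^4J_8^2J_{56}^3},\\ \sum_{i,j\ge 0}\frac{q^{i^2-2ij+2j^2+i}}{(q;q)_i(q^2;q^2)_j} &=2\frac{J_4^3J_{14}J_{3,28}J_{11,28}}{J_1^2J_2J_{28}J_{4,28}J_{12,28}}-\frac{J_2^6J_{28}^3}{J_1^4J_4^2J_{2,28}J_{8,28}J_{12,28}}\\ &=\frac{J_4^5J_{28}J_{2,56}J_{24,56}J_{26,56}}{J_2^4J_8^2J_{56}^3}+2q^3\frac{J_8J_{56}J_{16,56}}{J_2^2J_{20,56}}.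 \end{align*}
   Context: Notation: $(a;p)_0=1$, $(a;p)_n=\prod_{k=0}^{n-1}(1-ap^k)$, $(a;p)_\infty=\prod_{k\ge0}(1-ap^k)$ for $|p|<1$, $(a_1,\dots,a_m;p)_\infty=(a_1;p)_\infty\cdots(a_m;p)_\infty$. $J_m:=(q^m;q^m)_\infty$ and $J_{a,m}:=(q^a,q^{m-a},q^m;q^m)_\infty$. *)

(* Defs.v *)
From HB Require Import structures.
From mathcomp Require Import all_boot all_order all_algebra finmap.
From mathcomp Require Import complex.
From mathcomp Require Import all_classical all_reals all_analysis.
From mathcomp Require Import showcase.summability.
Set Implicit Arguments.
Unset Strict Implicit.
Unset Printing Implicit Defensive.
Import Order.TTheory GRing.Theory Num.Theory numFieldNormedType.Exports.
Local Open Scope classical_set_scope.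
Local Open Scope ring_scope.

(* The definitions are over an arbitrary [numFieldType], which carries the
   topology of its norm; they are meant to be used at [R[i]], which has no
   declared topology of its own. *)

(* (a; p)_n *)
Definition qpoch (C : numFieldType) (a p : C) (n : nat) : C :=
  \prod_(k < n) (1 - a * p ^+ k).

(* (a; p)_oo, for |p| < 1 *)
Definition qpochoo (C : numFieldType) (a p : C) : C :=
  lim (qpoch a p @ \oo).

(* J_m = (q^m; q^m)_oo *)
Definition J (C : numFieldType) (q : C) (m : nat) : C :=
  qpochoo (q ^+ m) (q ^+ m).

(* J_{a,m} = (q^a, q^(m-a), q^m; q^m)_oo; the exponent m - a is an integer. *)
Definition Jt (C : numFieldType) (q : C) (a m : nat) : C :=
  qpochoo (q ^+ a) (q ^+ m) * qpochoo (q ^ (m%:Z - a%:Z)) (q ^+ m)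
    * qpochoo (q ^+ m) (q ^+ m).

(* Unconditional convergence of the double series: the finite partial sums
   over subsets of nat * nat converge along inclusion. *)
Definition dsum_to (C : numFieldType) (F : nat -> nat -> C) (l : C) : Prop :=
  partial_sum (fun ij : nat * nat => F ij.1 ij.2) @ totally --> l.

(* Main.v *)
Require Import Defs.
From HB Require Import structures.
From mathcomp Require Import all_boot all_order all_algebra finmap.
From mathcomp Require Import complex.
From mathcomp Require Import all_classical all_reals all_analysis.
From mathcomp Require Import showcase.summability.
From mathcomp Require Import zify ring lra.
Import Order.TTheory GRing.Theory Num.Theory numFieldNormedType.Exports.
Import ComplexField.Normc.
Local Open Scope ring_scope.
Set Implicit Arguments.
Unset Strict Implicit.
Unset Printing Implicit Defensive.

(** Expanding 1/(q;q)_i = 1/(q;q)_oo sum_n (-1)^n q^(n(n+1)/2 + n i) / (q;q)_n by Euler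
    decouples the quadratic form: the sum over i - j becomes one of the theta values
    sum_m q^(m^2), sum_m q^(m^2+m), and the double sum is a combination of two of them
    with coefficients among six single sums
      W(d,l,mu) = sum_m q^(m^2 + l m) (- q^(2m+mu); q^2)_oo / (q;q)_(2m+d).
    Expanding 1/(q^2;q^2)_j instead, and writing
      (z;q)_oo (- q^e z; q^2)_oo = (q^(1-e) z; q^2)_oo (q^(2e) z^2; q^4)_oo  for e = 0, 1,
    gives a second combination, of the same theta values and single sums at q^2; these are
    the two product forms. Each W(d,l,mu) is a modulus-14 quintuple product over (q;q)_oo:
    the finite identities behind it follow from the q-Pascal rules, they are summed
    against a conjugate Bailey pair coming from the 1phi1 summation, and the resulting
    difference of theta series is the quintuple product. *)

(** * Unconditional sums *)

(** The decoupling pays off because of parity: completing the square shows that sum_m q^(m^2 + k m)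
    depends on k only through its parity, up to a power of q, so the even and the odd terms of the
    remaining series each carry one of the two theta values. The same happens in base q^2, where
    sum_t q^(t^2 + (N - t)^2) is centred near N/2. The product identity enters with e = 1 - al - be,
    where al i + be j is the linear part of the exponent; for the three sums this is 1, 0, 0. The
    modulus 14 comes from the Bailey pairs: they are supported on multiples of 3 with weight q^(12
    r^2), the conjugate pair adds q^((3 r)^2), and 12 + 9 = 3 * 7 is the quadratic coefficient of a
    quintuple product in base q^14. The obstacle is rearrangement: the triple sums have quadratic
    forms that are only semidefinite, and absolute summability comes from the sign constraints that
    the convention 1 / (q;q)_n = 0 for n < 0 puts on the indices. *)

Section SumsInNormedGroups.
Context {R : realType} {V : zmodType}.
Implicit Types (n : V -> R) (I : choiceType).

(* [hsum_wrt n F l]: the finite partial sums of [F] tend to [l] along inclusion, for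
   the modulus [n]. *)
Definition hsum_wrt n I (F : I -> V) (l : V) : Prop :=
  forall e : R, 0 < e -> exists A : {fset I}, forall B : {fset I},
    (A `<=` B)%fset -> n (\sum_(i <- B) F i - l) < e.

Definition smb_wrt n I (F : I -> V) : Prop :=
  exists M : R, forall A : {fset I}, \sum_(i <- A) n (F i) <= M.

End SumsInNormedGroups.

(* Working over an abstract field keeps unification from unfolding the arithmetic of
   pairs of reals; the only instance needed is [R[i]]. *)
Record normedC (R : realType) := NormedC {
  nc_car :> numFieldType;
  nm : nc_car -> R;
  nm_ge0 : forall x, 0 <= nm x;
  nmM : forall x y, nm (x * y) = nm x * nm y;
  nmD : forall x y, nm (x + y) <= nm x + nm y;
  nmN : forall x, nm (- x) = nm x;
  nm1 : nm 1 = 1;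
  nm_eq0 : forall x, (nm x == 0) = (x == 0);
  nm_norm : forall e : nc_car, 0 < e ->
    exists2 d : R, 0 < d & forall x, nm x < d -> `|x| < e;
  nc_sqrt : forall x : nc_car, exists y, y ^+ 2 = x;
  nc_complete : forall (I : choiceType) (F : I -> nc_car),
    smb_wrt nm F -> exists l, hsum_wrt nm F l
}.

Section Modulus.
Context {R : realType} {C : normedC R}.
Implicit Types x y : C.

Lemma nmB x y : nm (x - y) <= nm x + nm y.
Proof. by rewrite (le_trans (nmD _ _)) // nmN. Qed.

Lemma nm_distC x y : nm (x - y) = nm (y - x).
Proof. by rewrite -opprB nmN. Qed.

Lemma nm0 : nm (0 : C) = 0.
Proof. by apply/eqP; rewrite nm_eq0. Qed.

Lemma nm_gt0 x : (0 < nm x) = (x != 0).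
Proof. by rewrite lt_def nm_eq0 nm_ge0 andbT. Qed.

Lemma nmV x : nm x^-1 = (nm x)^-1.
Proof.
have [->|x0] := eqVneq x 0; first by rewrite invr0 nm0 invr0.
have n0 : nm x != 0 by rewrite nm_eq0.
by apply: (mulfI n0); rewrite -nmM !divff // nm1.
Qed.

Lemma nmX x n : nm (x ^+ n) = nm x ^+ n.
Proof. by elim: n => [|n IH]; rewrite ?expr0 ?nm1 // !exprS nmM IH. Qed.

Lemma nmXz x (n : int) : nm (x ^ n) = nm x ^ n.
Proof. by case: n => n; rewrite ?NegzE -?exprnN ?nmV nmX. Qed.

Lemma nm_sum (I : Type) (s : seq I) (F : I -> C) :
  nm (\sum_(i <- s) F i) <= \sum_(i <- s) nm (F i).
Proof.
elim/big_rec2: _ => [|i y1 y2 _ h]; first by rewrite nm0.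
by rewrite (le_trans (nmD _ _)) // lerD2l.
Qed.

End Modulus.

(** * Sums of families: uniqueness, linearity, iterated summation *)

Section Summation.
Context {R : realType} {C : normedC R}.

Definition hsum (I : choiceType) (F : I -> C) (l : C) : Prop := hsum_wrt (@nm R C) F l.

(* [smb F] is absolute summability; [rsmb f] is meant for nonnegative [f] only. *)
Definition rsmb (I : choiceType) (f : I -> R) : Prop :=
  exists M : R, forall A : {fset I}, \sum_(i <- A) f i <= M.

Definition smb (I : choiceType) (F : I -> C) : Prop := rsmb (fun i => nm (F i)).

(* [tsum F] is 0 when [F] has no sum. *)
Definition tsum (I : choiceType) (F : I -> C) : C := xget 0 [set l | hsum F l]%classic.

Lemma hsum_uniq (I : choiceType) (F : I -> C) l1 l2 :
  hsum F l1 -> hsum F l2 -> l1 = l2.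
Proof.
move=> h1 h2; apply/eqP; rewrite -subr_eq0 -nm_eq0; apply/negPn/negP => ne0.
have e0 : 0 < nm (l1 - l2) / 2 by rewrite divr_gt0 // lt_def ne0 nm_ge0.
have [A hA] := h1 _ e0; have [B hB] := h2 _ e0.
have := hA _ (fsubsetUl A B); have := hB _ (fsubsetUr A B).
set s := \sum_(i <- _) _ => u v.
have : nm (l1 - l2) <= nm (s - l1) + nm (s - l2).
  by rewrite (nm_distC s l1) (le_trans _ (nmD _ _)) // addrA subrK.
lra.
Qed.

Lemma tsumE (I : choiceType) (F : I -> C) l : hsum F l -> tsum F = l.
Proof.
by move=> h; apply: (hsum_uniq _ h); rewrite /tsum; case: xgetP => // /(_ l) [].
Qed.

Lemma fsum_subset (I : choiceType) (f : I -> R) (A B : {fset I}) :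
  (forall i, 0 <= f i) -> (A `<=` B)%fset ->
  \sum_(i <- A) f i <= \sum_(i <- B) f i.
Proof.
move=> f0 AB; rewrite [leRHS](big_fsetID _ (mem A)) /=.
have -> : [fset x in B | x \in A]%fset = A.
  apply/fsetP => i; rewrite !inE /=; apply/andP/idP => [[]//|iA].
  by rewrite (fsubsetP AB).
by rewrite lerDl sumr_ge0.
Qed.

Lemma big_fsetM (I J : choiceType) (V : nmodType) (A : {fset I}) (B : {fset J})
  (F : I * J -> V) :
  \sum_(x <- (A `*` B)%fset) F x = \sum_(i <- A) \sum_(j <- B) F (i, j).
Proof. by rewrite big_imfset2 //= => -[? ?] [? ?] _ _ /= [-> ->]. Qed.

Lemma smbP (I : choiceType) (F : I -> C) : smb F -> hsum F (tsum F).
Proof. by move=> /nc_complete [l h]; rewrite (tsumE h). Qed.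

Lemma hsumD (I : choiceType) (F G : I -> C) a b :
  hsum F a -> hsum G b -> hsum (fun i => F i + G i) (a + b).
Proof.
move=> hF hG e e0.
have [A1 hA1] := hF _ (divr_gt0 e0 (ltr0Sn _ 1)).
have [A2 hA2] := hG _ (divr_gt0 e0 (ltr0Sn _ 1)).
exists (A1 `|` A2)%fset => B; rewrite fsubUset => /andP[s1 s2].
have := hA1 _ s1; have := hA2 _ s2; rewrite big_split /=.
set u := \sum_(i <- B) F i; set v := \sum_(i <- B) G i => h1 h2.
have -> : u + v - (a + b) = (u - a) + (v - b) by ring.
by apply: (le_lt_trans (nmD _ _)); lra.
Qed.

Lemma hsumZ (I : choiceType) (F : I -> C) a c :
  hsum F a -> hsum (fun i => c * F i) (c * a).
Proof.
move=> hF e e0.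
have c0 : 0 < nm c + 1 by have := nm_ge0 c; lra.
have [A hA] := hF _ (divr_gt0 e0 c0).
exists A => B /hA; rewrite -mulr_sumr -mulrBr nmM ltr_pdivlMr // => h.
apply: le_lt_trans h; rewrite mulrC; apply: ler_wpM2l; rewrite ?nm_ge0 //; lra.
Qed.

(** A rectangle argument: for a finite [B] containing the first coordinates of [A], one finite [D]
    is chosen so that the product of [B] and [D] contains [A] and each row of [B], cut to [D], is
    within [e / 2 / k] of its sum, where [k] exceeds the size of [B]. *)
Lemma hsum_fubini (I J : choiceType) (F : I * J -> C) (g : I -> C) l :
  hsum F l -> (forall i, hsum (fun j => F (i, j)) (g i)) -> hsum g l.
Proof.
move=> hF hg e e0.
have [A hA] := hF _ (divr_gt0 e0 (ltr0Sn _ 1)).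
exists [fset x.1 | x in A]%fset => B AB.
pose k : R := (size B)%:R + 1.
have k0 : 0 < k by rewrite ltr_pwDr ?ler0n.
have dk : 0 < e / 2 / k by rewrite !divr_gt0.
have [D0 hD0] := choice (fun i => hg i _ dk).
pose D := (\bigcup_(i <- B) D0 i `|` [fset x.2 | x in A])%fset.
have sB : forall i, i \in B -> nm (\sum_(j <- D) F (i, j) - g i) < e / 2 / k.
  move=> i iB; apply: hD0; apply: fsubset_trans (fsubsetUl _ _).
  exact: (@bigfcup_sup _ _ B i xpredT).
have AS : (A `<=` B `*` D)%fset.
  apply/fsubsetP => -[i j] ijA; rewrite in_fsetM /=; apply/andP; split.
    by apply: (fsubsetP AB); apply/imfsetP; exists (i, j).
  by rewrite in_fsetU; apply/orP; right; apply/imfsetP; exists (i, j).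
have /= := hA _ AS; rewrite big_fsetM.
set s := \sum_(i <- B) \sum_(j <- D) _ => h1.
have h2 : nm (s - \sum_(i <- B) g i) <= e / 2.
  rewrite -sumrB; apply: (le_trans (nm_sum _ _)).
  apply: (@le_trans _ _ (\sum_(i <- B) e / 2 / k)).
    by rewrite !big_seq; apply: ler_sum => i iB; apply/ltW/sB.
  rewrite big_const_seq count_predT iter_addr_0 -(mulr_natr (e / 2 / k)).
  rewrite [e / 2 / k * _]mulrAC ler_pdivrMr // ler_wpM2l /k //; lra.
have -> : \sum_(i <- B) g i - l = (s - l) - (s - \sum_(i <- B) g i) by ring.
by apply: (le_lt_trans (nmB _ _)); lra.
Qed.

End Summation.

(** * Absolute summability, reindexing, double sums and geometric majorants *)

Section SummationTheory.
Context {R : realType} {C : normedC R}.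

Lemma eq_tsum (I : choiceType) (F G : I -> C) : F =1 G -> tsum F = tsum G.
Proof. by move=> /funext ->. Qed.

Lemma eq_smb (I : choiceType) (F G : I -> C) : F =1 G -> smb F -> smb G.
Proof. by move=> /funext ->. Qed.

(** Comparison along [h], with injectivity and the inequality asked only on [P], outside which [f]
    vanishes; so [absz] can serve as [h] on each half of [int]. *)
Lemma rsmb_le (I J : choiceType) (f : I -> R) (g : J -> R) (P : pred I) (h : I -> J) c :
  (forall i, ~~ P i -> f i = 0) -> {in P &, injective h} -> 0 <= c ->
  (forall i, P i -> f i <= c * g (h i)) -> rsmb g -> rsmb f.
Proof.
move=> f0 hinj c0 le [M hM]; exists (c * M) => A.
rewrite (big_fsetID _ P) /= [X in _ + X]big1_fset ?addr0; last first.
  by move=> i; rewrite !inE /= => /andP[_ /f0 ->].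
set B := [fset x in A | P x]%fset.
have BP i : i \in B -> P i by rewrite !inE /= => /andP[].
apply: (@le_trans _ _ (\sum_(i <- B) c * g (h i))).
  by rewrite !big_seq; apply: ler_sum => i /BP; exact: le.
rewrite -mulr_sumr; apply: ler_wpM2l => //.
apply: le_trans (hM [fset h i | i in B]%fset).
have <- // : \sum_(j <- [fset h i | i in B]%fset) g j = \sum_(i <- B) g (h i).
by rewrite big_imfset //= => i j /BP Pi /BP Pj; exact: hinj.
Qed.

Lemma smb_le (I : choiceType) (F G : I -> C) c : 0 <= c ->
  (forall i, nm (F i) <= c * nm (G i)) -> smb G -> smb F.
Proof.
by move=> c0 h; apply: (@rsmb_le _ _ _ _ xpredT id c) => // i j _ _.
Qed.

Lemma smb_inj (I J : choiceType) (F : I -> C) (g : J -> I) :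
  injective g -> smb F -> smb (fun j => F (g j)).
Proof.
move=> ginj; apply: (@rsmb_le _ _ _ _ xpredT g 1) => // [i j _ _|i _]; first exact: ginj.
by rewrite mul1r.
Qed.

Lemma smbD (I : choiceType) (F G : I -> C) :
  smb F -> smb G -> smb (fun i => F i + G i).
Proof.
move=> [M hM] [N hN]; exists (M + N) => A.
apply: le_trans (lerD (hM A) (hN A)); rewrite -big_split.
by apply: ler_sum => i _; exact: nmD.
Qed.

Lemma smbZ (I : choiceType) (F : I -> C) c : smb F -> smb (fun i => c * F i).
Proof.
by apply: (@smb_le _ _ _ (nm c)) => [|i]; rewrite ?nmM ?nm_ge0.
Qed.

Lemma tsumD (I : choiceType) (F G : I -> C) : smb F -> smb G ->
  tsum (fun i => F i + G i) = tsum F + tsum G.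
Proof. by move=> hF hG; apply/tsumE/hsumD; exact: smbP. Qed.

Lemma tsum0 (I : choiceType) : tsum (fun _ : I => 0 : C) = 0.
Proof.
apply/tsumE => e e0; exists fset0 => B _.
by rewrite big1 // subrr nm0.
Qed.

(** Divergent families are covered as well: when neither side has a sum, both take the default 0.
    This makes [tsumZ] and [tsum_bij] plain rewriting rules. *)
Lemma tsum_transport (I J : choiceType) (F : I -> C) (G : J -> C) c :
  (forall l, hsum F l -> hsum G (c * l)) ->
  (forall l, hsum G l -> exists l', hsum F l') -> tsum G = c * tsum F.
Proof.
move=> h1 h2; have [[l hl]|nF] := pselect (exists l, hsum F l).
  by rewrite (tsumE hl) (tsumE (h1 _ hl)).
have nG : ~ exists l, hsum G l by move=> [l /h2].
rewrite /tsum !xgetPN ?mulr0 // => l hl; first by apply: nF; exists l.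
by apply: nG; exists l.
Qed.

Lemma tsumZ (I : choiceType) (F : I -> C) c : tsum (fun i => c * F i) = c * tsum F.
Proof.
have [->|c0] := eqVneq c 0.
  by under eq_tsum do rewrite mul0r; rewrite mul0r tsum0.
apply: tsum_transport => l; first exact: hsumZ.
move=> h; exists (c^-1 * l); have -> : F = (fun i => c^-1 * (c * F i)).
  by apply/funext => i; rewrite mulKf.
exact: hsumZ.
Qed.

Lemma tsumB (I : choiceType) (F G : I -> C) : smb F -> smb G ->
  tsum (fun i => F i - G i) = tsum F - tsum G.
Proof.
move=> hF hG; rewrite -mulN1r -tsumZ -tsumD //; last exact: smbZ.
by apply: eq_tsum => i; rewrite mulN1r.
Qed.

(** The map [g] may miss indices where [F] vanishes, which allows passing from [int] to one residue
    class, or to [nat]. *)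
Lemma hsum_reindex (I J : choiceType) (F : I -> C) (g : J -> I) (h : I -> J) l :
  cancel g h -> (forall i, F i != 0 -> g (h i) = i) ->
  hsum F l -> hsum (fun j => F (g j)) l.
Proof.
move=> gK Fs hF e /hF [A hA].
exists [fset h i | i in A]%fset => B AB.
have := hA _ (fsubsetUr [fset g j | j in B] A)%fset.
have -> // : \sum_(i <- ([fset g j | j in B] `|` A)%fset) F i = \sum_(j <- B) F (g j).
have <- : \sum_(i <- [fset g j | j in B]%fset) F i = \sum_(j <- B) F (g j).
  by rewrite big_imfset //= => i j _ _; apply: (can_inj gK).
symmetry; apply: big_fset_incl; first exact: fsubsetUl.
move=> i; rewrite in_fsetU => /orP[->//|iA] niB.
apply/eqP; apply: contraNT niB => /Fs <-.
by apply/imfsetP; exists (h i) => //=; apply: (fsubsetP AB); apply/imfsetP; exists i.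
Qed.

Lemma tsum_reindex (I J : choiceType) (F : I -> C) (g : J -> I) (h : I -> J) :
  cancel g h -> (forall i, F i != 0 -> g (h i) = i) -> smb F ->
  tsum F = tsum (fun j => F (g j)).
Proof. by move=> gK Fs /smbP hF; rewrite (tsumE (hsum_reindex gK Fs hF)). Qed.

Lemma tsum_bij (I J : choiceType) (F : I -> C) (g : J -> I) (h : I -> J) :
  cancel g h -> cancel h g -> tsum F = tsum (fun j => F (g j)).
Proof.
move=> gK hK; rewrite -[RHS]mul1r; apply: tsum_transport => l.
  rewrite mul1r => hl.
  rewrite (_ : F = fun i => F (g (h i))); last by apply/funext => i; rewrite hK.
  exact: (hsum_reindex (F := fun j => F (g j)) hK).
by move=> hl; exists l; apply: (hsum_reindex gK).
Qed.

Lemma smb_row (I J : choiceType) (F : I * J -> C) i :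
  smb F -> smb (fun j => F (i, j)).
Proof. by apply: (@smb_inj _ _ F (pair i)) => j j' []. Qed.

Lemma smb_swap (I J : choiceType) (F : I * J -> C) :
  smb F -> smb (fun x : J * I => F (x.2, x.1)).
Proof. by apply: (@smb_inj _ _ F (fun x => (x.2, x.1))) => -[? ?] [? ?] [-> ->]. Qed.

Lemma tsum_pair (I J : choiceType) (F : I * J -> C) : smb F ->
  tsum F = tsum (fun i => tsum (fun j => F (i, j))).
Proof.
move=> sF; symmetry; apply/tsumE.
apply: (hsum_fubini (smbP sF)) => i; exact/smbP/smb_row.
Qed.

Lemma tsum_pair2 (I J : choiceType) (F : I * J -> C) : smb F ->
  tsum F = tsum (fun j => tsum (fun i => F (i, j))).
Proof.
move=> sF; rewrite -(tsum_pair (smb_swap sF)).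
by apply: (@tsum_bij _ _ F (fun x : J * I => (x.2, x.1)) (fun x => (x.2, x.1))) => // -[].
Qed.

Lemma nm_tsum_le (I : choiceType) (F : I -> C) M :
  (forall A : {fset I}, \sum_(i <- A) nm (F i) <= M) -> nm (tsum F) <= M.
Proof.
move=> hM; have /smbP hF : smb F by exists M.
apply/ler_addgt0Pr => e /hF [A /(_ A (fsubset_refl _))].
move=> /ltW h; rewrite -[tsum F](subKr (\sum_(i <- A) F i)) (le_trans (nmB _ _)) //.
by rewrite lerD // (le_trans _ (hM A)) // nm_sum.
Qed.

(** Each row sum is compared with a partial sum over a common finite [D], at a cost of at most
    [1 / k] per row and so less than 1 in total: this is the 1 in [M + 1]. *)
Lemma smb_tsum (I J : choiceType) (F : I * J -> C) :
  smb F -> smb (fun i => tsum (fun j => F (i, j))).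
Proof.
move=> sF; have [M hM] := sF; exists (M + 1) => B.
pose k : R := (size B)%:R + 1.
have k0 : 0 < k by rewrite ltr_pwDr ?ler0n.
have [D0 hD0] := choice (fun i => smbP (smb_row i sF) (divr_gt0 ltr01 k0)).
pose D := (\bigcup_(i <- B) D0 i)%fset.
have le1 i : i \in B -> nm (tsum (fun j => F (i, j))) <= \sum_(j <- D) nm (F (i, j)) + 1 / k.
  move=> iB; have /ltW := hD0 i D (@bigfcup_sup _ _ B i xpredT _ iB isT).
  set s := \sum_(j <- D) _ => h; set t := tsum _.
  rewrite -[t](subKr s) (le_trans (nmB _ _)) // lerD //; exact: nm_sum.
apply: (@le_trans _ _ (\sum_(i <- B) (\sum_(j <- D) nm (F (i, j)) + 1 / k))).
  by rewrite !big_seq; exact: ler_sum.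
rewrite big_split /=; apply: lerD; first by rewrite -(big_fsetM B D (fun x => nm (F x))).
rewrite big_const_seq count_predT iter_addr_0 -(mulr_natr (1 / k)).
rewrite [1 / k * _]mulrAC ler_pdivrMr // mul1r /k; lra.
Qed.

Lemma rsmb_prod (I J : choiceType) (f : I -> R) (g : J -> R) :
  (forall i, 0 <= f i) -> (forall j, 0 <= g j) ->
  rsmb f -> rsmb g -> rsmb (fun x : I * J => f x.1 * g x.2).
Proof.
move=> f0 g0 [M hM] [N hN]; exists (M * N) => A.
pose A1 := [fset x.1 | x in A]%fset; pose A2 := [fset x.2 | x in A]%fset.
apply: (@le_trans _ _ (\sum_(x <- (A1 `*` A2)%fset) f x.1 * g x.2)).
  apply: fsum_subset => [i|]; first exact: mulr_ge0.
  apply/fsubsetP => -[i j] ijA; rewrite in_fsetM /=; apply/andP; split.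
    by apply/imfsetP; exists (i, j).
  by apply/imfsetP; exists (i, j).
rewrite (big_fsetM _ _ (fun x => f x.1 * g x.2)) /=.
under eq_bigr do rewrite -mulr_sumr.
by rewrite -mulr_suml; apply: ler_pM => //; apply: sumr_ge0.
Qed.

Lemma smb_prod (I J : choiceType) (f : I -> C) (g : J -> C) :
  smb f -> smb g -> smb (fun x : I * J => f x.1 * g x.2).
Proof.
move=> sf sg; rewrite /smb; under eq_fun do rewrite nmM.
by apply: (rsmb_prod (f := fun i => nm (f i)) (g := fun j => nm (g j))) => // i; exact: nm_ge0.
Qed.

Lemma tsum_prod (I J : choiceType) (f : I -> C) (g : J -> C) :
  smb f -> smb g -> tsum (fun x : I * J => f x.1 * g x.2) = tsum f * tsum g.
Proof.
move=> sf sg; rewrite (tsum_pair (smb_prod sf sg)) /= mulrC -tsumZ.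
by apply: eq_tsum => i; rewrite tsumZ // mulrC.
Qed.

Lemma tsum_single (I : choiceType) (F : I -> C) i0 :
  (forall i, i != i0 -> F i = 0) -> tsum F = F i0.
Proof.
move=> F0; apply/tsumE => e e0; exists [fset i0]%fset => B sB.
have -> : \sum_(i <- B) F i = F i0; last by rewrite subrr nm0.
rewrite -(big_fset_incl _ sB) ?big_seq_fset1 // => i _.
by rewrite inE => /F0.
Qed.

Lemma smb_fin (I : choiceType) (F : I -> C) (D : {fset I}) :
  (forall i, i \notin D -> F i = 0) -> smb F.
Proof.
move=> F0; exists (\sum_(i <- D) nm (F i)) => A.
apply: le_trans (fsum_subset (fun i => nm_ge0 (F i)) (fsubsetUr D A)) _.
rewrite -(big_fset_incl _ (fsubsetUl D A)) // => i _.
by move=> /F0 ->; rewrite nm0.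
Qed.

Lemma rsmb_geo_nat (r : R) : 0 <= r < 1 -> rsmb (fun n : nat => r ^+ n).
Proof.
move=> /andP[r0 r1]; exists (1 - r)^-1 => A.
pose N := (\sum_(n <- A) n).+1.
have : {subset A <= iota 0 N}.
  by move=> n nA; rewrite mem_iota add0n /N ltnS (big_fsetD1 n) //= leq_addr.
have : \sum_(j <- iota 0 N) r ^+ j = \sum_(0 <= j < N) r ^+ j.
  by rewrite /index_iota subn0.
have := iota_uniq 0 N; move: (iota 0 N) => s us es sA.
have sA' : (A `<=` [fset n | n in s])%fset.
  by apply/fsubsetP => n /sA ns; apply/imfsetP; exists n.
apply: le_trans (fsum_subset (fun n => exprn_ge0 n r0) sA') _.
have -> : \sum_(i <- [fset n | n in s]%fset) r ^+ i = \sum_(i <- s) r ^+ i.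
  by rewrite big_imfset //= undup_id.
rewrite es.
have r1' : 0 < 1 - r by rewrite subr_gt0.
rewrite -div1r ler_pdivlMr // mulrC big_mkord.
set S := \sum_(i < N) _; have -> : (1 - r) * S = 1 - r ^+ N.
  by rewrite -[RHS]opprB subrX1 -mulNr opprB.
by rewrite gerBl exprn_ge0.
Qed.

Lemma rsmbD (I : choiceType) (f g : I -> R) :
  rsmb f -> rsmb g -> rsmb (fun i => f i + g i).
Proof.
move=> [M hM] [N hN]; exists (M + N) => A.
by rewrite big_split; exact: lerD.
Qed.

Lemma rsmb_geo_int (r : R) : 0 <= r < 1 -> rsmb (fun n : int => r ^+ `|n|).
Proof.
move=> r01; have h := rsmb_geo_nat r01.
have h1 : rsmb (fun n : int => if 0 <= n then r ^+ `|n| else 0).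
  apply: (@rsmb_le _ _ _ _ (fun n : int => 0 <= n) absz 1 _ _ _ _ h) => //.
  - by move=> i /negPf ->.
  - by move=> i j; rewrite !unfold_in => i0 j0; lia.
  - by move=> i ->; rewrite mul1r.
have h2 : rsmb (fun n : int => if 0 <= n then 0 else r ^+ `|n|).
  apply: (@rsmb_le _ _ _ _ (fun n : int => ~~ (0 <= n)) absz 1 _ _ _ _ h) => //.
  - by move=> i /negbNE ->.
  - by move=> i j; rewrite !unfold_in => i0 j0; lia.
  - by move=> i /negPf ->; rewrite mul1r.
have [M hM] := rsmbD h1 h2; exists M => A; apply: le_trans (hM A).
by apply: ler_sum => n _; case: ifP; rewrite ?addr0 ?add0r.
Qed.

Lemma exprz_le (r : R) (a b : int) : 0 < r -> r < 1 -> a <= b -> r ^ b <= r ^ a.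
Proof.
move=> r0 r1 ab; have -> : b = a + (b - a) by lia.
rewrite expfzDr ?gt_eqF // ler_piMr //; first by apply: exprz_ge0; exact: ltW.
have : 0 <= b - a by lia.
by case: (b - a) => // n _; rewrite -exprnP exprn_ile1 // ltW.
Qed.

(** The common pattern of the summability proofs: a term of size K r^E has a geometric majorant once
    E dominates a size function up to a constant. The bounds are asked only where [F] is nonzero, so
    vanishing factors [iq] supply sign constraints. *)
Lemma smb_geo_dom (I : choiceType) (r : R) (sz : I -> nat) (F : I -> C)
    (K : R) (d : int) (E : I -> int) :
  0 < r < 1 -> rsmb (fun i => r ^+ sz i) -> 0 <= K ->
  (forall i, F i != 0 -> nm (F i) <= K * r ^ (E i) /\ (sz i)%:Z <= E i + d) ->
  smb F.
Proof.
move=> /andP[r0 r1] h K0 hF.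
apply: (@rsmb_le _ _ _ _ (fun i => F i != 0) id (K * r ^ (- d)) _ _ _ _ h) => //.
- by move=> i /negPn/eqP ->; rewrite nm0.
- by apply: mulr_ge0 => //; apply: exprz_ge0; exact: ltW.
move=> i /hF [le1 le2]; apply: (le_trans le1).
rewrite -mulrA; apply: ler_wpM2l => //.
rewrite -[r ^+ _]/(r ^ (sz i)%:Z) -expfzDr ?gt_eqF //.
by apply: exprz_le => //; lia.
Qed.

End SummationTheory.

Lemma qpochoo_lim (K : numFieldType) (a p l : K) :
  (forall e, 0 < e -> exists N, forall n, (N <= n)%N -> `|l - qpoch a p n| < e) ->
  qpochoo a p = l.
Proof.
move=> h; apply: cvg_lim; first exact: norm_hausdorff.
apply/cvgrPdist_lt => e /h [N hN].
by exists N => // n /= /hN.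
Qed.

(** * Sequential limits in the modulus *)

Section Limits.
Context {R : realType} {C : normedC R}.

Definition slim (u : nat -> C) (l : C) : Prop :=
  forall e : R, 0 < e -> exists N, forall n, (N <= n)%N -> nm (u n - l) < e.

Lemma slim_qpochoo (a p l : C) : slim (qpoch a p) l -> qpochoo a p = l.
Proof.
move=> h; apply: qpochoo_lim => e e0.
have [d d0 hd] := nm_norm e0; have [N hN] := h _ d0.
by exists N => n /hN ?; apply: hd; rewrite nm_distC.
Qed.

Lemma expr_small (r e : R) : 0 <= r < 1 -> 0 < e ->
  exists N, forall n, (N <= n)%N -> r ^+ n < e.
Proof.
move=> /andP[r0 r1] e0.
have r1' : `|r| < 1 by rewrite ger0_norm.
have /cvgrPdist_lt /(_ e e0) [N _ hN] := cvg_expr r1'.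
exists N => n /hN /=; rewrite sub0r normrN ger0_norm //; exact: exprn_ge0.
Qed.

(** Division by [v n] is avoided, as some of its values may vanish: once [nm (v n)] is at least 1/2,
    the relation bounds [nm (u n)] by [2 * nm c], and u n - c = u n (1 - v n). *)
Lemma slim_of_mul (u v : nat -> C) c :
  (forall n, u n * v n = c) -> slim v 1 -> slim u c.
Proof.
move=> uv hv e e0.
have c0 : 0 < 2 * nm c + 1 by have := nm_ge0 c; lra.
have [N hN] := hv _ (divr_gt0 e0 c0).
have h2 : (0 : R) < 2^-1 by rewrite invr_gt0.
have [M hM] := hv _ h2.
exists (maxn N M) => n; rewrite geq_max => /andP[/hN h /hM h'].
have uc : nm (u n) <= 2 * nm c.
  rewrite -(uv n) nmM.
  have := nmB (v n) (v n - 1); rewrite subKr nm1.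
  have := nm_ge0 (u n); nra.
rewrite -(uv n) -[X in X - _]mulr1 -mulrBr nmM nm_distC.
apply: (@le_lt_trans _ _ (2 * nm c * nm (v n - 1))).
  by apply: ler_wpM2r => //; exact: nm_ge0.
move: h; rewrite ltr_pdivlMr //; have := nm_ge0 (v n - 1); lra.
Qed.

End Limits.

(** * q-Pochhammer symbols and Euler's expansions *)

Section QPoch.
Context {R : realType} {C : normedC R}.
Implicit Types a p x y s : C.

(* 1 / (p; p)_k, extended by 0 to k < 0 so that every series runs over the whole of
   [int] and can be reindexed by unimodular maps. *)
Definition iq p (k : int) : C :=
  match k with Posz n => (qpoch p p n)^-1 | Negz _ => 0 end.

Lemma qpoch0 a p : qpoch a p 0 = 1.
Proof. by rewrite /qpoch big_ord0. Qed.

Lemma qpochS a p n : qpoch a p n.+1 = qpoch a p n * (1 - a * p ^+ n).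
Proof. by rewrite /qpoch big_ord_recr. Qed.

Lemma iq0 p : iq p 0 = 1.
Proof. by rewrite /= qpoch0 invr1. Qed.

Lemma iq_lt0 p k : k < 0 -> iq p k = 0.
Proof. by case: k. Qed.

Lemma iq_neq0 p k : iq p k != 0 -> 0 <= k.
Proof. by case: k => // n; rewrite eqxx. Qed.

Lemma one_sub_neq0 x : nm x < 1 -> 1 - x != 0.
Proof. by apply: contraTneq => /eqP; rewrite subr_eq0 => /eqP <-; rewrite nm1 ltxx. Qed.

Lemma nm_lt1X x n : nm x < 1 -> (0 < n)%N -> nm (x ^+ n) < 1.
Proof. by move=> h n0; rewrite nmX exprn_ilt1 ?nm_ge0 // -lt0n. Qed.

(** The extension by 0 makes the recursion hold at every integer; at k = 0 both sides vanish, the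
    left one through 1 - p^0. *)
Lemma iq_rec p k : nm p < 1 -> (1 - p ^ k) * iq p k = iq p (k - 1).
Proof.
move=> hp; case: k => [[|n]|n]; first by rewrite expr0z subrr mul0r.
  have -> : n.+1%:Z - 1 = n by lia.
  have h : 1 - p ^+ n.+1 != 0 by apply: one_sub_neq0; exact: nm_lt1X.
  by rewrite /iq -exprnP qpochS -exprS invfM mulrCA divff // mulr1.
by rewrite !iq_lt0 ?mulr0 //; lia.
Qed.

(** The factors are bounded below by 1 - r^(k+1), whose product stays away from 0. The resulting
    bound on 1 / (p;p)_n feeds the majorants below. *)
Lemma qpoch_lb p : nm p < 1 -> exists2 c, 0 < c & forall n, c <= nm (qpoch p p n).
Proof.
move=> p1; set r := nm p; have r0 : 0 <= r := nm_ge0 p.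
have d0 : 0 < 1 - r by rewrite subr_gt0.
pose D n : R := \prod_(k < n) (1 - r ^+ k.+1).
have rk k : 0 < 1 - r ^+ k.+1 by rewrite subr_gt0 exprn_ilt1.
have Dgt0 n : 0 < D n by apply: prodr_gt0.
have DS n : D n.+1 = D n * (1 - r ^+ n.+1) by rewrite /D big_ord_recr.
have leD n : D n <= nm (qpoch p p n).
  elim: n => [|n IH]; first by rewrite /D big_ord0 qpoch0 nm1.
  rewrite DS qpochS nmM -exprS; apply: ler_pM => //; rewrite ?(ltW (Dgt0 _)) ?(ltW (rk _)) // -nmX.
  by have := nmD (1 - p ^+ n.+1) (p ^+ n.+1); rewrite subrK nm1 lerBlDr.
have [||N hN] := @expr_small R r ((1 - r) / 2); [by rewrite r0|by rewrite divr_gt0|].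
(* Past [N] the product loses at most a geometric tail, which [N] makes smaller than 1/2: the
   bracket is 1/2 plus the part of the tail not yet subtracted. *)
have DN m : D (N + m)%N <= D N /\ D N * (1 / 2 + r ^+ (N + m)%N.+1 / (1 - r)) <= D (N + m)%N.
  elim: m => [|m [IH1 IH2]].
    rewrite addn0; split=> //.
    rewrite ler_piMr //; first exact: ltW.
    have : r ^+ N.+1 / (1 - r) < 1 / 2.
      by rewrite ltr_pdivrMr // mul1r mulrC; apply: hN.
    lra.
  rewrite addnS DS; split.
    by apply: le_trans IH1; apply: ler_piMr; rewrite ?(ltW (Dgt0 _)) // gerBl exprn_ge0.
  set t := r ^+ (N + m)%N.+1 in IH2 *; rewrite exprS -/t.
  have t0 : 0 <= t by rewrite exprn_ge0.
  have -> : r * t / (1 - r) = t / (1 - r) - t by field; rewrite gt_eqF.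
  have : D (N + m)%N * t <= D N * t by apply: ler_wpM2r.
  nra.
exists (D N / 2); first by rewrite divr_gt0.
move=> n; apply: le_trans (leD n).
have [h1 h2] := DN n.
have Dmono : D (n + N)%N <= D n.
  elim: N {hN DN h1 h2} => [|M IH]; first by rewrite addn0.
  apply: le_trans IH; rewrite addnS DS.
  by apply: ler_piMr; rewrite ?(ltW (Dgt0 _)) // gerBl exprn_ge0.
rewrite addnC in Dmono; apply: le_trans Dmono; apply: le_trans h2.
apply: ler_wpM2l; first exact: ltW.
by rewrite div1r lerDl divr_ge0 ?exprn_ge0 // ltW.
Qed.

Lemma iq_bd p : nm p < 1 -> exists2 K, 0 < K & forall k, nm (iq p k) <= K.
Proof.
move=> /qpoch_lb [c c0 hc]; exists c^-1; first by rewrite invr_gt0.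
case=> n; last by rewrite iq_lt0 // nm0 invr_ge0 ltW.
have h := hc n; rewrite /iq nmV lef_pV2 // posrE //; exact: lt_le_trans h.
Qed.

End QPoch.

Lemma exprXz (F : unitRingType) (x : F) (m : nat) (k : int) :
  (x ^+ m) ^ k = x ^ (m%:Z * k).
Proof. by rewrite exprnP exprz_exp. Qed.

(** * Euler's series for the infinite product *)

Section Euler.
Context {R : realType} {C : normedC R}.
Implicit Types x y z s : C.

Lemma nm_pow_bound (r : R) x : 0 < r < 1 -> exists L : nat, nm x <= r ^ (- L%:Z).
Proof.
move=> /andP[r0 r1]; have h : 0 < (nm x + 1)^-1.
  by rewrite invr_gt0 ltr_wpDl ?nm_ge0.
have [|N /(_ N (leqnn _)) hN] := @expr_small R r _ _ h; first by rewrite ltW.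
exists N; rewrite -exprnN; have rN : 0 < r ^+ N by rewrite exprn_gt0.
move: hN; rewrite -[r ^+ N]invrK ltf_pV2 ?posrE ?invr_gt0 //; last first.
  by rewrite ltr_wpDl ?nm_ge0.
by rewrite invrK => h'; apply: ltW; apply: lt_trans h'; rewrite ltrDl.
Qed.

(** Passing from x to x p^k multiplies the term of index n by p^(k n), so all terms but the constant
    one shrink at least by the factor [nm (p ^+ k)]. This is the limit used when a functional
    equation is iterated. *)
Lemma slim_pseries (c : int -> C) x p :
  (forall n, n < 0 -> c n = 0) -> c 0 = 1 -> x != 0 -> nm p < 1 ->
  smb (fun n => c n * x ^ n) ->
  slim (fun k => tsum (fun n => c n * (x * p ^+ k) ^ n)) 1.
Proof.
move=> cneg c0 x0 p1 [M hM] e e0.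
have M0 : 0 <= M by have := hM fset0; rewrite big_seq_fset0.
have k0 : 0 < M + 1 by lra.
have [|N hN] := @expr_small R (nm p) _ _ (divr_gt0 e0 k0); first by rewrite nm_ge0.
exists N => k /hN; rewrite ltr_pdivlMr // -nmX; set t := p ^+ k => ht.
have t1 : nm t <= 1 by rewrite nmX exprn_ile1 ?nm_ge0 // ltW.
suff h : nm (tsum (fun n : int => c n * (x * t) ^ n) - 1) <= nm t * M.
  apply: le_lt_trans h _; have := nm_ge0 t; lra.
have hd (A : {fset int}) : \sum_(n <- A) nm (if n == 0 then 0 else c n * (x * t) ^ n) <= nm t * M.
  apply: (le_trans _ (ler_wpM2l (nm_ge0 t) (hM A))); rewrite mulr_sumr.
  apply: ler_sum => -[[|n]|n] _.
  - by rewrite nm0 mulr_ge0 ?nm_ge0.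
  - have -> : (n.+1%:Z == 0) = false by [].
    rewrite -!exprnP exprMn mulrA [leLHS]nmM mulrC.
    apply: ler_wpM2r; first exact: nm_ge0.
    by rewrite exprS nmM ler_piMr ?nm_ge0 // nmX exprn_ile1 ?nm_ge0.
  - by rewrite !cneg // !mul0r nm0 mulr0.
have -> : tsum (fun n : int => c n * (x * t) ^ n) - 1 =
    tsum (fun n : int => if n == 0 then 0 else c n * (x * t) ^ n).
  apply/eqP; rewrite subr_eq addrC; apply/eqP.
  have hF (n : int) : n != 0 -> (if n == 0 then 1 else 0 : C) = 0 by move=> /negPf ->.
  have /= <- := tsum_single hF; rewrite -tsumD.
  - apply: eq_tsum => n; case: eqP => [->|_]; last by rewrite add0r.
    by rewrite addr0 c0 expr0z mul1r.
  - apply: (smb_fin (D := [fset 0 : int]%fset)) => n; rewrite inE => /negPf ->; done.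
  - by exists (nm t * M).
exact: nm_tsum_le.
Qed.

(* The base is s^2, so that the exponents n(n-1)/2 become integral. *)
Definition euler_term s x (n : int) : C := s ^ (n ^+ 2 - n) * x ^ n * iq (s ^+ 2) n.

Lemma smb_euler s x : s != 0 -> nm s < 1 -> smb (euler_term s x).
Proof.
move=> s0 s1; have r0 : 0 < nm s by rewrite nm_gt0.
have r01 : 0 < nm s < 1 by rewrite r0.
have [|K K0 hK] := @iq_bd _ C (s ^+ 2); first exact: nm_lt1X.
have [L hL] := nm_pow_bound x r01.
apply: (@smb_geo_dom _ _ _ (nm s) absz _ K ((L%:Z + 2) ^+ 2)
  (fun n => n ^+ 2 - n - L%:Z * n)) => //.
- by apply: rsmb_geo_int; rewrite ltW.
- exact: ltW.
move=> n; rewrite /euler_term mulf_eq0 negb_or => /andP[_ /iq_neq0 n0]; split; last nia.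
rewrite !nmM mulrC; apply: ler_pM => //; rewrite ?mulr_ge0 ?nm_ge0 //.
rewrite !nmXz [leRHS]expfzDr ?gt_eqF //; apply: ler_wpM2l; first by rewrite exprz_ge0 ?nm_ge0.
case: n n0 => // n _; rewrite -mulNr -exprz_exp -!exprnP.
by apply: lerXn2r; rewrite ?nnegrE ?exprz_ge0 ?nm_ge0.
Qed.

Definition euler s x : C := tsum (euler_term s x).

Lemma euler_eq s x : s != 0 -> nm s < 1 -> x != 0 ->
  euler s x = (1 + x) * euler s (x * s ^+ 2).
Proof.
move=> s0 s1 x0; have p1 : nm (s ^+ 2) < 1 by exact: nm_lt1X.
have sE y := smb_euler y s0 s1.
apply/eqP; rewrite mulrDl mul1r -subr_eq0 opprD addrA subr_eq0; apply/eqP.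
rewrite -tsumB // (@tsum_bij _ _ _ _ _ (fun n : int => n + 1) (fun n : int => n - 1)); first last.
- by move=> n; rewrite subrK.
- by move=> n; rewrite addrK.
rewrite -tsumZ //; apply: eq_tsum => n; rewrite /euler_term.
have -> : iq (s ^+ 2) n = (1 - (s ^+ 2) ^ (n + 1)) * iq (s ^+ 2) (n + 1).
  by rewrite iq_rec // addrK.
rewrite ![(x * _) ^ _]exprzMl ?unitfE ?expf_neq0 // !exprXz.
have -> : (n + 1) ^+ 2 - (n + 1) = (n ^+ 2 - n) + 2%:Z * n by ring.
have -> : 2%:Z * (n + 1) = 2%:Z * n + 2%:Z by ring.
rewrite !expfzDr // expr1z -[s ^ 2%:Z]exprnP; ring.
Qed.

Lemma qpoch_euler s x n : s != 0 -> nm s < 1 -> x != 0 ->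
  qpoch (- x) (s ^+ 2) n * euler s (x * (s ^+ 2) ^+ n) = euler s x.
Proof.
move=> s0 s1 x0; elim: n => [|n IH]; first by rewrite qpoch0 mul1r expr0 mulr1.
rewrite qpochS -IH [in RHS]euler_eq //; last by rewrite mulf_neq0 ?expf_neq0.
by rewrite mulNr opprK -[x * _ * s ^+ 2]mulrA -exprSr mulrA.
Qed.

Lemma slim_euler s x : s != 0 -> nm s < 1 -> x != 0 ->
  slim (fun n => euler s (x * (s ^+ 2) ^+ n)) 1.
Proof.
move=> s0 s1 x0.
have := @slim_pseries (fun n => s ^ (n ^+ 2 - n) * iq (s ^+ 2) n) x (s ^+ 2).
rewrite iq0 expr0z mulr1 nm_lt1X // => h.
rewrite (_ : (fun n => _) = fun k => tsum (fun n : int =>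
  s ^ (n ^+ 2 - n) * iq (s ^+ 2) n * (x * (s ^+ 2) ^+ k) ^ n)); last first.
  by apply/funext => k; apply: eq_tsum => n; rewrite /euler_term mulrAC.
apply: h => // [n n0|]; first by rewrite iq_lt0 // mulr0.
by apply: eq_smb (smb_euler x s0 s1) => n; rewrite /euler_term mulrAC.
Qed.

(** With p = s^2 and f the series, iterating [euler_eq] gives (-x;p)_n f(x p^n) = f(x), and f(x p^n)
    tends to 1. Convergence of the product is thus a consequence of that of the series. *)
Theorem euler_qpochoo s x : s != 0 -> nm s < 1 -> x != 0 ->
  euler s x = qpochoo (- x) (s ^+ 2).
Proof.
move=> s0 s1 x0; symmetry; apply: slim_qpochoo.
apply: (@slim_of_mul _ _ _ (fun n => euler s (x * (s ^+ 2) ^+ n))).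
  by move=> n; exact: qpoch_euler.
exact: slim_euler.
Qed.

End Euler.

Lemma exprNz_sign (F : fieldType) (x : F) (n : int) :
  x != 0 -> (- x) ^ n = (-1) ^ n * x ^ n.
Proof. by move=> x0; rewrite -[- x]mulN1r exprzMl // unitfE ?oppr_eq0 ?oner_eq0. Qed.

(** * Infinite products: splitting, dissection, non-vanishing *)

Section QPochInfinite.
Context {R : realType} {C : normedC R}.
Implicit Types a p x y z s : C.

Lemma slim_uniq (u : nat -> C) l1 l2 : slim u l1 -> slim u l2 -> l1 = l2.
Proof.
move=> h1 h2; apply/eqP; rewrite -subr_eq0 -nm_eq0; apply/negPn/negP => ne0.
have e0 : 0 < nm (l1 - l2) / 2 by rewrite divr_gt0 // lt_def ne0 nm_ge0.
have [N hN] := h1 _ e0; have [M hM] := h2 _ e0.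
have := hN _ (leq_maxl N M); have := hM _ (leq_maxr N M).
set s := u _ => u1 u2.
have : nm (l1 - l2) <= nm (s - l1) + nm (s - l2).
  by rewrite (nm_distC s l1) (le_trans _ (nmD _ _)) // addrA subrK.
lra.
Qed.

Lemma slim_bounded (u : nat -> C) l : slim u l ->
  exists2 K, 0 <= K & forall n, nm (u n) <= K.
Proof.
move=> /(_ 1 ltr01) [N hN].
have s0 : 0 <= \sum_(i < N) nm (u i) by apply: sumr_ge0 => i _; exact: nm_ge0.
exists (\sum_(i < N) nm (u i) + (nm l + 1)) => [|n].
  by rewrite !addr_ge0 ?nm_ge0.
have [le|lt] := leqP N n.
  have := hN _ le; have := nmD (u n - l) l; rewrite subrK; lra.
have l0 := nm_ge0 l.
rewrite (bigD1 (Ordinal lt)) //=.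
have : 0 <= \sum_(i < N | i != Ordinal lt) nm (u i).
  by apply: sumr_ge0 => i _; exact: nm_ge0.
lra.
Qed.

Lemma slimM (u v : nat -> C) a b :
  slim u a -> slim v b -> slim (fun n => u n * v n) (a * b).
Proof.
move=> hu hv e e0.
have [K K0 hK] := slim_bounded hu.
have k1 : 0 < 2 * (K + 1) by lra.
have k2 : 0 < 2 * (nm b + 1) by have := nm_ge0 b; lra.
have [N hN] := hu _ (divr_gt0 e0 k2); have [M hM] := hv _ (divr_gt0 e0 k1).
exists (maxn N M) => n; rewrite geq_max => /andP[/hN h /hM h'].
have -> : u n * v n - a * b = u n * (v n - b) + (u n - a) * b by ring.
apply: (le_lt_trans (nmD _ _)); rewrite !nmM.
move: h h'; rewrite !ltr_pdivlMr //.
have := hK n; have := nm_ge0 (u n); have := nm_ge0 b.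
have := nm_ge0 (v n - b); have := nm_ge0 (u n - a).
set A := nm (u n - a); set B := nm (v n - b); set U := nm (u n); set D := nm b.
move=> A0 B0 D0 U0 UK h1 h2.
have : U * B <= K * B by apply: ler_wpM2r.
nra.
Qed.

Lemma slim_prod m (u : nat -> nat -> C) (l : nat -> C) :
  (forall k, (k < m)%N -> slim (u k) (l k)) ->
  slim (fun n => \prod_(k < m) u k n) (\prod_(k < m) l k).
Proof.
elim: m => [|m IH] h.
  by move=> e e0; exists 0%N => n _; rewrite !big_ord0 subrr nm0.
rewrite big_ord_recr /= (_ : (fun n => _) = fun n => (\prod_(k < m) u k n) * u m n).
  exact: slimM (IH (fun k km => h k (ltnW km))) (h m (ltnSn m)).
by apply/funext => n; rewrite big_ord_recr.
Qed.

Lemma sqrt_lt1 p : p != 0 -> nm p < 1 ->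
  exists s : C, [/\ s != 0, nm s < 1 & s ^+ 2 = p].
Proof.
move=> p0 p1; have [s sE] := nc_sqrt p.
exists s; split=> //; first by apply: contraNneq p0 => h; rewrite -sE h expr0n.
by apply: contraTT p1; rewrite -sE nmX -!leNgt; exact: exprn_ege1.
Qed.

Lemma slim_qpoch a p : a != 0 -> p != 0 -> nm p < 1 ->
  slim (qpoch a p) (qpochoo a p).
Proof.
move=> a0 p0 p1.
have [s [s0 s1 sE]] := sqrt_lt1 p0 p1.
have na0 : - a != 0 by rewrite oppr_eq0.
rewrite -[a]opprK -sE -(euler_qpochoo s0 s1 na0).
apply: (@slim_of_mul _ _ _ (fun n => euler s (- a * (s ^+ 2) ^+ n))).
  by move=> n; exact: qpoch_euler.
exact: slim_euler.
Qed.

Lemma qpoch_split a p m n : qpoch a p (m + n) = qpoch a p m * qpoch (a * p ^+ m) p n.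
Proof.
rewrite /qpoch big_split_ord /=; congr (_ * _); apply: eq_bigr => i _.
by rewrite exprD mulrA.
Qed.

Lemma qpochoo_split a p n : a != 0 -> p != 0 -> nm p < 1 ->
  qpochoo a p = qpoch a p n * qpochoo (a * p ^+ n) p.
Proof.
move=> a0 p0 p1; have h := slim_qpoch a0 p0 p1.
have ap0 : a * p ^+ n != 0 by rewrite mulf_neq0 ?expf_neq0.
have hc : slim (fun=> qpoch a p n) (qpoch a p n).
  by move=> e e0; exists 0%N => *; rewrite subrr nm0.
apply: (slim_uniq (u := fun k => qpoch a p (n + k))).
  by move=> e /h [N hN]; exists N => k Nk; apply: hN; rewrite (leq_trans Nk) // leq_addl.
rewrite (_ : (fun k => _) = fun k => qpoch a p n * qpoch (a * p ^+ n) p k).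
  exact: slimM hc (slim_qpoch ap0 p0 p1).
by apply/funext => k; rewrite qpoch_split.
Qed.

Lemma qpochoo_rec a p : a != 0 -> p != 0 -> nm p < 1 ->
  qpochoo a p = (1 - a) * qpochoo (a * p) p.
Proof.
move=> a0 p0 p1; rewrite (qpochoo_split 1 a0 p0 p1) expr1.
by rewrite qpochS qpoch0 mul1r expr0 mulr1.
Qed.

(** For large N the tail of the product, an Euler series, is at distance less than 1 from 1 and so
    nonzero; the first N factors are nonzero by hypothesis. *)
Lemma qpochoo_neq0 a p : a != 0 -> p != 0 -> nm p < 1 ->
  (forall n, a * p ^+ n != 1) -> qpochoo a p != 0.
Proof.
move=> a0 p0 p1 h.
have [s [s0 s1 sE]] := sqrt_lt1 p0 p1.
have na0 : - a != 0 by rewrite oppr_eq0.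
rewrite -[a]opprK -sE -(euler_qpochoo s0 s1 na0).
have [N /(_ N (leqnn _)) hN] := slim_euler s0 s1 na0 ltr01.
rewrite -(qpoch_euler N s0 s1 na0) mulf_neq0 //.
  rewrite opprK sE /qpoch; apply/prodf_neq0 => i _.
  by rewrite subr_eq0 eq_sym h.
apply: contraTneq hN => ->; by rewrite sub0r nmN nm1 ltxx.
Qed.

Lemma qpochoo_neq0_lt1 a p : a != 0 -> p != 0 -> nm p < 1 -> nm a < 1 ->
  qpochoo a p != 0.
Proof.
move=> a0 p0 p1 a1; apply: qpochoo_neq0 => // n; apply/eqP => h.
have : nm (a * p ^+ n) < 1.
  rewrite nmM nmX; apply: le_lt_trans a1; rewrite ler_piMr ?nm_ge0 //.
  by rewrite exprn_ile1 ?nm_ge0 // ltW.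
by rewrite h nm1 ltxx.
Qed.

Lemma qpoch_mod a p m n : (0 < m)%N ->
  qpoch a p (n * m) = \prod_(k < m) qpoch (a * p ^+ k) (p ^+ m) n.
Proof.
move=> m0; elim: n => [|n IH].
  by rewrite mul0n qpoch0 big1 // => k _; rewrite qpoch0.
rewrite mulSn addnC qpoch_split IH.
under [RHS]eq_bigr do rewrite qpochS.
rewrite big_split /=; congr (_ * _).
rewrite /qpoch; apply: eq_bigr => k _.
by rewrite -!mulrA; congr (1 - _ * _); rewrite mulnC exprM mulrC.
Qed.

Lemma qpochoo_mod m a p : (0 < m)%N -> a != 0 -> p != 0 -> nm p < 1 ->
  qpochoo a p = \prod_(k < m) qpochoo (a * p ^+ k) (p ^+ m).
Proof.
move=> m0 a0 p0 p1.
apply: (slim_uniq (u := fun n => qpoch a p (n * m))).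
  move=> e /(slim_qpoch a0 p0 p1) [N hN]; exists N => n Nn; apply: hN.
  by rewrite (leq_trans Nn) // leq_pmulr.
rewrite (_ : (fun n => _) = fun n => \prod_(k < m) qpoch (a * p ^+ k) (p ^+ m) n).
  apply: (@slim_prod m (fun k => qpoch (a * p ^+ k) (p ^+ m))
    (fun k => qpochoo (a * p ^+ k) (p ^+ m))) => k _.
  by apply: slim_qpoch; rewrite ?mulf_neq0 ?expf_neq0 //; exact: nm_lt1X.
by apply/funext => n; rewrite qpoch_mod.
Qed.

Lemma qpochoo_sq a p : a != 0 -> p != 0 -> nm p < 1 ->
  qpochoo a p * qpochoo (- a) p = qpochoo (a ^+ 2) (p ^+ 2).
Proof.
move=> a0 p0 p1.
have na0 : - a != 0 by rewrite oppr_eq0.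
apply: (slim_uniq (u := fun n => qpoch a p n * qpoch (- a) p n)).
  by apply: slimM; exact: slim_qpoch.
rewrite (_ : (fun n => _) = qpoch (a ^+ 2) (p ^+ 2)).
  by apply: slim_qpoch; rewrite ?expf_neq0 //; exact: nm_lt1X.
apply/funext => n; rewrite /qpoch -big_split /=; apply: eq_bigr => i _.
by rewrite -exprM mulnC exprM; ring.
Qed.

(** For k < 0 the exponent k + 1 is some -n with n >= 0, and the factor 1 - p^(-n) p^n kills the
    product, in agreement with the value 0 of [iq]. *)
Lemma qpochoo_iq p (k : int) : p != 0 -> nm p < 1 ->
  qpochoo (p ^ (k + 1)) p = qpochoo p p * iq p k.
Proof.
move=> p0 p1; case: k => n.
  rewrite (qpochoo_split n p0 p0 p1) -exprS mulrAC.
  have [c c0 hc] := qpoch_lb p1.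
  have -> : n%:Z + 1 = n.+1 by lia.
  rewrite /iq mulfV ?mul1r //.
  by rewrite -nm_gt0 (lt_le_trans c0).
rewrite iq_lt0 // mulr0.
have -> : Negz n + 1 = - n%:Z by lia.
have pn0 : p ^ (- n%:Z) != 0 by rewrite expfz_neq0.
rewrite (qpochoo_split n.+1 pn0 p0 p1) qpochS.
by rewrite -exprnN mulVf ?expf_neq0 // subrr mulr0 mul0r.
Qed.

(** Euler's series at x = -p^(k+1), p = s^2. It vanishes for negative k, so 1 / (p;p)_k can be
    expanded inside sums over all of [int]. *)
Lemma tsum_iq s (k : int) : s != 0 -> nm s < 1 ->
  tsum (fun n : int => (-1) ^ n * s ^ (n ^+ 2 + n + 2 * k * n) * iq (s ^+ 2) n)
  = qpochoo (s ^+ 2) (s ^+ 2) * iq (s ^+ 2) k.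
Proof.
move=> s0 s1.
rewrite -qpochoo_iq ?expf_neq0 //; last exact: nm_lt1X.
have x0 : - (s ^+ 2) ^ (k + 1) != 0 by rewrite oppr_eq0 expfz_neq0 ?expf_neq0.
rewrite -[in RHS](opprK ((s ^+ 2) ^ (k + 1))) -(euler_qpochoo s0 s1 x0).
apply: eq_tsum => n; rewrite /euler_term.
rewrite [in RHS]exprNz_sign ?expfz_neq0 ?expf_neq0 // exprXz.
rewrite exprz_exp mulrCA -[in RHS]expfzDr //; congr (_ * _ ^ _ * _); ring.
Qed.

End QPochInfinite.

(** * Theta series: the triple and quintuple products *)

Opaque qpochoo tsum.

Section QuadraticSums.
Context {R : realType} {C : normedC R}.
Implicit Types q : C.

Lemma smb_quad (I : choiceType) q (sz : I -> nat) (c : I -> C) (E : I -> int) K d :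
  q != 0 -> nm q < 1 -> rsmb (fun x => nm q ^+ sz x) ->
  (forall x, nm (c x) <= K) -> (forall x, c x != 0 -> (sz x)%:Z <= E x + d) ->
  smb (fun x => c x * q ^ E x).
Proof.
move=> q0 q1 hsz hK hE; have r0 : 0 < nm q by rewrite nm_gt0.
apply: (@smb_geo_dom _ _ _ (nm q) sz _ (Num.max 0 K) d E) => //.
- by rewrite r0.
- by rewrite le_max lexx.
move=> x; rewrite mulf_eq0 negb_or => /andP[/hE h _]; split=> //.
rewrite nmM nmXz; apply: ler_wpM2r; first by rewrite exprz_ge0 ?nm_ge0.
by rewrite le_max hK orbT.
Qed.

Lemma rsmb_geo1 q : nm q < 1 -> rsmb (fun x : int => nm q ^+ `|x|).
Proof. by move=> q1; apply: rsmb_geo_int; rewrite nm_ge0. Qed.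

Lemma rsmb_geo_pair (I J : choiceType) q (s1 : I -> nat) (s2 : J -> nat) :
  rsmb (fun x => nm q ^+ s1 x) -> rsmb (fun x => nm q ^+ s2 x) ->
  rsmb (fun x : I * J => nm q ^+ (s1 x.1 + s2 x.2)%N).
Proof.
move=> h1 h2; under eq_fun do rewrite exprD.
by apply: (rsmb_prod _ _ h1 h2) => i; rewrite exprn_ge0 ?nm_ge0.
Qed.

Lemma smb_quad1 q (c : int -> C) E K d :
  q != 0 -> nm q < 1 -> (forall x, nm (c x) <= K) ->
  (forall x, c x != 0 -> `|x| <= E x + d) -> smb (fun x => c x * q ^ E x).
Proof.
move=> q0 q1 hK hE; apply: (smb_quad q0 q1 (rsmb_geo1 q1) hK (d := d)) => x /hE.
by rewrite abszE.
Qed.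

Lemma smb_quad2 q (c : int * int -> C) E K d :
  q != 0 -> nm q < 1 -> (forall x, nm (c x) <= K) ->
  (forall x, c x != 0 -> `|x.1| + `|x.2| <= E x + d) -> smb (fun x => c x * q ^ E x).
Proof.
move=> q0 q1 hK hE.
apply: (smb_quad q0 q1 (rsmb_geo_pair (rsmb_geo1 q1) (rsmb_geo1 q1)) hK (d := d)) => x /hE.
by rewrite PoszD !abszE.
Qed.

Lemma smb_quad3 q (c : (int * int) * int -> C) E K d :
  q != 0 -> nm q < 1 -> (forall x, nm (c x) <= K) ->
  (forall x, c x != 0 -> `|x.1.1| + `|x.1.2| + `|x.2| <= E x + d) ->
  smb (fun x => c x * q ^ E x).
Proof.
move=> q0 q1 hK hE; have h1 := rsmb_geo1 q1.
apply: (smb_quad q0 q1 (rsmb_geo_pair (rsmb_geo_pair h1 h1) h1) hK (d := d)) => x /hE.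
by rewrite !PoszD !abszE.
Qed.

Lemma quad_lin (x c : int) : 0 <= c -> c * `|x| <= x ^+ 2 + c ^+ 2.
Proof.
move=> c0; have : 0 <= (`|x| - c) ^+ 2 by apply: sqr_ge0.
have -> : x ^+ 2 = `|x| ^+ 2 by rewrite real_normK ?num_real.
have : 0 <= `|x| * c by rewrite mulr_ge0.
nia.
Qed.

Lemma nm_sg (n : int) : nm ((-1 : C) ^ n) = 1.
Proof. by rewrite nmXz nmN nm1 exp1rz. Qed.

Lemma tsum_sum m (I : choiceType) (F : nat -> I -> C) :
  (forall k, (k < m)%N -> smb (F k)) ->
  tsum (fun i => \sum_(k < m) F k i) = \sum_(k < m) tsum (F k).
Proof.
elim: m => [|m IH] h.
  by under eq_tsum do rewrite big_ord0; rewrite tsum0 big_ord0.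
have hm : smb (fun i => \sum_(k < m) F k i).
  elim: m {IH} h => [|m IH] h.
    by apply: (smb_fin (D := fset0)) => i _; rewrite big_ord0.
  apply: eq_smb (smbD (IH (fun k km => h k (ltnW km))) (h m _)) => // i.
  by rewrite big_ord_recr.
rewrite (@eq_tsum _ _ _ _ (fun i => \sum_(k < m) F k i + F m i)); last first.
  by move=> i; rewrite big_ord_recr.
rewrite tsumD //; last exact: h.
by rewrite [RHS]big_ord_recr IH // => k km; apply: h; exact: ltnW.
Qed.

Lemma tsum_mod m (F : int -> C) : (0 < m)%N -> smb F ->
  tsum F = \sum_(k < m) tsum (fun t : int => F (m%:Z * t + k%:Z)).
Proof.
move=> m0 sF.
have mm : 0 < m%:Z by rewrite ltz_nat.
pose G k (n : int) : C := if (n %% m)%Z == k%:Z then F n else 0.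
have sG k : smb (G k).
  apply: (@smb_le _ _ _ _ _ 1 _ _ sF) => // n.
  by rewrite mul1r /G; case: ifP; rewrite ?nm0 ?nm_ge0.
have -> : tsum F = tsum (fun n => \sum_(k < m) G k n).
  apply: eq_tsum => n.
  have h : (`|(n %% m)%Z| < m)%N by have := ltz_mod n (d := m); lia.
  rewrite (bigD1 (Ordinal h)) //= big1 ?addr0.
    rewrite /G gez0_abs ?modz_ge0 ?eqxx // gt_eqF //.
  move=> k /negPf nk; rewrite /G; case: eqP => // e.
  by move: nk; rewrite -val_eqE /= e absz_nat eqxx.
rewrite tsum_sum; last by move=> k _; exact: sG.
apply: eq_bigr => k _.
rewrite (@tsum_reindex _ _ _ _ (G k) (fun t : int => m%:Z * t + k%:Z)
   (fun n => (n %/ m)%Z)) //.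
- apply: eq_tsum => t; rewrite /G [_ * t]mulrC modzMDl modz_small ?eqxx //.
  by have := ltn_ord k; lia.
- move=> t; rewrite [_ * t]mulrC divzMDl ?gt_eqF // divz_small ?addr0 //.
  by have := ltn_ord k; lia.
move=> n; rewrite /G; case: ifP => [/eqP e _|_ /eqP //].
by rewrite -e mulrC -divz_eq.
Qed.

Lemma tsum_even_odd (F : int -> C) : smb F ->
  tsum F = tsum (fun t => F (2 * t)) + tsum (fun t => F (2 * t + 1)).
Proof.
move=> sF; rewrite (@tsum_mod 2) // big_ord_recr big_ord_recr big_ord0 /= add0r.
by congr (_ + _); apply: eq_tsum => t; rewrite ?addr0.
Qed.

Lemma tsum_mod3 (F : int -> C) : smb F ->
  tsum F = tsum (fun t => F (3 * t)) + tsum (fun t => F (3 * t + 1))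
    + tsum (fun t => F (3 * t + 2)).
Proof.
move=> sF; rewrite (@tsum_mod 3) // !big_ord_recr big_ord0 /= add0r.
by congr (_ + _ + _); apply: eq_tsum => t; rewrite ?addr0.
Qed.

End QuadraticSums.

Lemma ler_X2 (F : realDomainType) (a b : F) n : 0 <= a -> a <= b -> a ^+ n <= b ^+ n.
Proof. by move=> a0 ab; rewrite lerXn2r // nnegrE (le_trans a0). Qed.

(** * Euler's second expansion and Jacobi's triple product *)

Section Theta.
Context {R : realType} {C : normedC R}.
Implicit Types p q s x z : C.

(** In base p = s^2 the coefficients are the usual p^(n(n-1)/2). *)
Definition theta s z : C := tsum (fun n : int => s ^ (n ^+ 2 - n) * z ^ n).

Lemma smb_theta s z : s != 0 -> nm s < 1 -> z != 0 ->
  smb (fun n : int => s ^ (n ^+ 2 - n) * z ^ n).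
Proof.
move=> s0 s1 z0; have r0 : 0 < nm s by rewrite nm_gt0.
have r01 : 0 < nm s < 1 by rewrite r0.
have [L1 h1] := nm_pow_bound z r01; have [L2 h2] := nm_pow_bound z^-1 r01.
pose L := (L1 + L2)%N.
have hz (n : int) : nm (z ^ n) <= nm s ^ (- (L%:Z * `|n|)).
  case: n => n.
    rewrite -exprnP nmX -mulNr -exprz_exp -exprnP.
    apply: ler_X2; first exact: nm_ge0.
    by apply: le_trans h1 _; apply: exprz_le => //; lia.
  rewrite NegzE -exprnN -exprVn nmX normrN -mulNr -exprz_exp.
  have -> : `|n.+1%:Z| = n.+1%:Z by [].
  rewrite -exprnP; apply: ler_X2; first exact: nm_ge0.
  apply: le_trans h2 _.
  by apply: exprz_le => //; lia.
apply: (@smb_geo_dom _ _ _ (nm s) absz _ 1 ((L%:Z + 2) ^+ 2)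
  (fun n => n ^+ 2 - n - L%:Z * `|n|)) => //; first exact: rsmb_geo1.
move=> n _; split.
  rewrite mul1r nmM nmXz [leRHS]expfzDr ?gt_eqF //.
  by apply: ler_wpM2l => //; rewrite exprz_ge0 ?nm_ge0.
have L0 : 0 <= L%:Z + 2 by lia.
rewrite abszE; have := quad_lin n L0; have := ler_norm n; lia.
Qed.

Lemma smb_euler2 p x : nm p < 1 -> nm x < 1 -> x != 0 ->
  smb (fun n : int => iq p n * x ^ n).
Proof.
move=> p1 x1 x0; have [K K0 hK] := iq_bd p1.
apply: (smb_quad1 (E := id) (K := K) (d := 0) x0 x1) => // n /iq_neq0 n0; lia.
Qed.

(** Euler's second expansion, of 1 / (x;p)_oo. The series g satisfies g(y) - g(y p) = y g(y), whence
    (x;p)_k g(x) = g(x p^k), which tends to 1. *)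
Lemma tsum_euler2 p x : p != 0 -> nm p < 1 -> nm x < 1 -> x != 0 ->
  qpochoo x p * tsum (fun n : int => iq p n * x ^ n) = 1.
Proof.
move=> p0 p1 x1 x0.
pose g y : C := tsum (fun n : int => iq p n * y ^ n).
have sg k : smb (fun n : int => iq p n * (x * p ^+ k) ^ n).
  apply: smb_euler2; rewrite ?mulf_neq0 ?expf_neq0 //.
  rewrite nmM nmX; apply: le_lt_trans x1; rewrite ler_piMr ?nm_ge0 //.
  by rewrite exprn_ile1 ?nm_ge0 // ltW.
have gE k : g (x * p ^+ k.+1) = (1 - x * p ^+ k) * g (x * p ^+ k).
  have hy : x * p ^+ k != 0 by rewrite mulf_neq0 ?expf_neq0.
  have -> : x * p ^+ k.+1 = x * p ^+ k * p by rewrite exprSr mulrA.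
  set y := x * p ^+ k in hy *.
  have sy : smb (fun n : int => iq p n * y ^ n) by exact: sg.
  have syp : smb (fun n : int => iq p n * (y * p) ^ n).
    by rewrite /y -mulrA -exprSr; exact: sg.
  move: y hy sy syp => y hy sy syp.
  have e : g y - g (y * p) = y * g y.
    rewrite /g -tsumB // -tsumZ (@tsum_bij _ _ _ _ _ (fun n : int => n + 1) (fun n => n - 1)).
    - apply: eq_tsum => n; rewrite [(y * p) ^ _]exprzMl ?unitfE //.
      have -> : iq p n = (1 - p ^ (n + 1)) * iq p (n + 1) by rewrite iq_rec // addrK.
      by rewrite !expfzDr // expr1z; ring.
    - by move=> n; rewrite addrK.
    - by move=> n; rewrite subrK.
  by rewrite mulrBl mul1r -e; ring.
apply: (slim_uniq (u := fun k => qpoch x p k * g x)).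
  apply: slimM (slim_qpoch x0 p0 p1) _ => e e0.
  by exists 0%N => *; rewrite subrr nm0.
have -> : (fun k => qpoch x p k * g x) = (fun k => g (x * p ^+ k)).
  apply/funext; elim=> [|k IH]; first by rewrite qpoch0 mul1r expr0 mulr1.
  by rewrite qpochS gE -IH; ring.
apply: (slim_pseries (c := iq p)) => //; first by move=> n; exact: iq_lt0.
- exact: iq0.
- exact: smb_euler2.
Qed.

(** With p = s^2, theta is multiplied by the series [B] of 1 / (-p/z;p)_oo, which converges as |p/z|
    < 1. After n -> n + m the sum over m is [tsum_iq] and the sum over n is Euler's series for
    (-z;p)_oo. *)
Theorem jacobi_triple s z : s != 0 -> nm s < 1 -> z != 0 -> nm (s ^+ 2 / z) < 1 ->
  theta s z = qpochoo (- z) (s ^+ 2) * qpochoo (- (s ^+ 2 / z)) (s ^+ 2)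
    * qpochoo (s ^+ 2) (s ^+ 2).
Proof.
move=> s0 s1 z0 hz; set p := s ^+ 2.
have p0 : p != 0 by rewrite expf_neq0.
have p1 : nm p < 1 by exact: nm_lt1X.
have y0 : - (p / z) != 0 by rewrite oppr_eq0 mulf_neq0 ?invr_eq0.
have y1 : nm (- (p / z)) < 1 by rewrite nmN.
pose A (n : int) : C := s ^ (n ^+ 2 - n) * z ^ n.
pose B (m : int) : C := iq p m * (- (p / z)) ^ m.
have sA : smb A by exact: smb_theta.
have sB : smb B by exact: smb_euler2.
have sAB := smb_prod sA sB.
pose g (x : int * int) := (x.1 + x.2, x.2).
pose h (x : int * int) := (x.1 - x.2, x.2).
have gK : cancel g h by move=> [n m]; rewrite /g /h /= addrK.
have hK : cancel h g by move=> [n m]; rewrite /g /h /= subrK.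
have sg := smb_inj (can_inj gK) sAB.
have : qpochoo (- z) p * qpochoo p p = theta s z * tsum B.
  rewrite -(tsum_prod sA sB) (tsum_bij _ gK hK) (tsum_pair sg) /= mulrC.
  rewrite -(euler_qpochoo s0 s1 z0) -tsumZ; apply: eq_tsum => n.
  rewrite /euler_term mulrCA -/p -(tsum_iq n s0 s1) -tsumZ; apply: eq_tsum => m.
  rewrite /A /B [(- (p / z)) ^ m]exprNz_sign ?mulf_neq0 ?invr_eq0 //.
  rewrite [(p / z) ^ m]exprzMl ?unitfE ?invr_eq0 // -/p [p ^ m]exprXz.
  have -> : z ^ (n + m) = z ^ n * z ^ m by rewrite expfzDr.
  have -> : n ^+ 2 - n = (n + m) ^+ 2 - (n + m) + 2%:Z * m - (m ^+ 2 + m + 2 * n * m) by ring.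
  rewrite [s ^ (_ - (_ + 2 * n * m))]expfzDr // [s ^ (_ + 2%:Z * m)]expfzDr //.
  have -> : (z^-1) ^ m = (z ^ m)^-1 by rewrite exprz_inv -invr_expz.
  rewrite -[s ^ (- (_ + 2 * n * m))]invr_expz.
  by field; rewrite !expfz_neq0.
move=> e; rewrite mulrAC e -mulrA [_ * qpochoo _ _]mulrC tsum_euler2 //.
by rewrite mulr1.
Qed.

End Theta.

(** * The pentagonal number theorem and the quintuple product *)

Section Quintuple.
Context {R : realType} {C : normedC R}.
Implicit Types p q s x z : C.

Lemma sg_add (m n : int) : (-1 : C) ^ (m + n) = (-1) ^ m * (-1) ^ n.
Proof. by rewrite expfzDr // oppr_eq0 oner_eq0. Qed.

Lemma sg_double (m : int) : (-1 : C) ^ (2 * m) = 1.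
Proof. by rewrite -exprz_exp -exprnP sqrrN expr1n exp1rz. Qed.

Lemma sgN (m : int) : (-1 : C) ^ (- m) = (-1) ^ m.
Proof.
have := sg_add (2 * m) (- m); rewrite sg_double mul1r => <-.
by congr (_ ^ _); ring.
Qed.

Lemma sg_sub (m n : int) : (-1 : C) ^ (m - n) = (-1) ^ m * (-1) ^ n.
Proof. by rewrite sg_add sgN. Qed.

(** Euler's theorem in base s^4: the triple product in base s^12 at z = -s^8 supplies the three
    residue classes of exponents modulo 12. *)
Lemma pentagonal s : s != 0 -> nm s < 1 ->
  tsum (fun l : int => (-1) ^ l * s ^ (6 * l ^+ 2 + 2 * l)) = qpochoo (s ^+ 4) (s ^+ 4).
Proof.
move=> s0 s1; have h (n : nat) : s ^+ n != 0 by rewrite expf_neq0.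
have e12 : (s ^+ 6) ^+ 2 = s ^+ 12 by rewrite -exprM.
have w : s ^+ 12 / (- s ^+ 8) = - s ^+ 4.
  by rewrite invrN mulrN; congr (- _); field.
rewrite (@qpochoo_mod _ _ 3) //; last exact: nm_lt1X.
rewrite !big_ord_recr big_ord0 /= mul1r expr0 mulr1 -!exprM -!exprD.
have := @jacobi_triple _ C (s ^+ 6) (- s ^+ 8).
rewrite e12 w !opprK nmN oppr_eq0 => /(_ _ _ _ _) h3.
rewrite [qpochoo (s ^+ 4) _ * _]mulrC -h3 ?h ?nm_lt1X //.
apply: eq_tsum => l; rewrite [in RHS]exprNz_sign ?h // !exprXz [in RHS]mulrCA.
rewrite -(expfzDr _ _ s0); congr (_ * _ ^ _); ring.
Qed.

(* The two triple products are multiplied and the double series is summed along the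
   residues mod 3; the inner sums are pentagonal series. *)
Theorem quintuple s z : s != 0 -> nm s < 1 -> z != 0 -> nm (s ^+ 2 / z) < 1 ->
  nm (s ^+ 2 / z ^+ 2) < 1 ->
  qpochoo z (s ^+ 2) * qpochoo (s ^+ 2 / z) (s ^+ 2) * qpochoo (s ^+ 2) (s ^+ 2)
  * (qpochoo (s ^+ 2 * z ^+ 2) (s ^+ 4) * qpochoo (s ^+ 2 / z ^+ 2) (s ^+ 4))
  = tsum (fun t : int => s ^ (3 * t ^+ 2 - t) * z ^ (3 * t))
    - tsum (fun t : int => s ^ (3 * t ^+ 2 + t) * z ^ (3 * t + 1)).
Proof.
move=> s0 s1 z0 h1 h2.
have P0 : qpochoo (s ^+ 4) (s ^+ 4) != 0.
  by apply: qpochoo_neq0_lt1; rewrite ?expf_neq0 ?nm_lt1X.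
apply: (mulIf P0).
have w0 : - (s ^+ 2 * z ^+ 2) != 0 by rewrite oppr_eq0 mulf_neq0 ?expf_neq0.
have s20 : s ^+ 2 != 0 by rewrite expf_neq0.
have s21 : nm (s ^+ 2) < 1 by exact: nm_lt1X.
have nz0 : - z != 0 by rewrite oppr_eq0.
have e1 : s ^+ 2 / (- z) = - (s ^+ 2 / z) by rewrite invrN mulrN.
have e2 : (s ^+ 2) ^+ 2 / (- (s ^+ 2 * z ^+ 2)) = - (s ^+ 2 / z ^+ 2).
  by rewrite invrN mulrN; congr (- _); field; rewrite s0 z0.
have J1 : theta s (- z) = qpochoo z (s ^+ 2) * qpochoo (s ^+ 2 / z) (s ^+ 2)
    * qpochoo (s ^+ 2) (s ^+ 2).
  by rewrite jacobi_triple // e1 ?nmN // !opprK.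
have J2 : theta (s ^+ 2) (- (s ^+ 2 * z ^+ 2)) = qpochoo (s ^+ 2 * z ^+ 2) (s ^+ 4)
    * qpochoo (s ^+ 2 / z ^+ 2) (s ^+ 4) * qpochoo (s ^+ 4) (s ^+ 4).
  by rewrite jacobi_triple // e2 ?nmN // !opprK -!exprM.
rewrite -[LHS]mulrA -J2 -J1.
pose A (k : int) : C := s ^ (k ^+ 2 - k) * (- z) ^ k.
pose B (l : int) : C := (s ^+ 2) ^ (l ^+ 2 - l) * (- (s ^+ 2 * z ^+ 2)) ^ l.
have sAB : smb (fun x : int * int => A x.1 * B x.2) by apply: smb_prod; exact: smb_theta.
pose g (x : int * int) := (x.1 - 2 * x.2, x.2).
pose h (x : int * int) := (x.1 + 2 * x.2, x.2).
have gK : cancel g h by move=> [n m]; rewrite /g /h /= subrK.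
have hK : cancel h g by move=> [n m]; rewrite /g /h /= addrK.
have sg := smb_inj (can_inj gK) sAB.
(* Along k = n - 2 l the exponent of s is 6 l^2 - (4 n - 2) l + n^2 - n. Shifting l by t removes t
   from the linear term and leaves only the residue e of n modulo 3. *)
have AB (n l t e : int) : n = 3 * t + e ->
    A (n - 2 * (l + t)) * B (l + t) = s ^ (3 * t ^+ 2 - t + e * (e - 1 + 2 * t)) * z ^ n
      * ((-1) ^ e * ((-1) ^ l * s ^ (6 * l ^+ 2 + 2 * l - 4 * e * l))).
  move=> ->; rewrite /A /B.
  rewrite [(- z) ^ _]exprNz_sign // [(- (_ * _)) ^ _]exprNz_sign ?mulf_neq0 ?expf_neq0 //.
  rewrite [(s ^+ 2 * z ^+ 2) ^ _]exprzMl ?unitfE ?expf_neq0 // !exprXz.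
  have esg : (-1 : C) ^ (3 * t + e - 2 * (l + t)) * (-1) ^ (l + t) = (-1) ^ e * (-1) ^ l.
    rewrite -!sg_add (_ : _ + (l + t) = (e + l) + 2 * (t - l)); last by ring.
    by rewrite [in LHS]sg_add sg_double mulr1.
  have es : s ^ ((3 * t + e - 2 * (l + t)) ^+ 2 - (3 * t + e - 2 * (l + t)))
      * (s ^ (2%:Z * ((l + t) ^+ 2 - (l + t))) * s ^ (2%:Z * (l + t)))
      = s ^ (3 * t ^+ 2 - t + e * (e - 1 + 2 * t)) * s ^ (6 * l ^+ 2 + 2 * l - 4 * e * l).
    by rewrite -!(expfzDr _ _ s0); congr (_ ^ _); ring.
  have ez : z ^ (3 * t + e - 2 * (l + t)) * z ^ (2%:Z * (l + t)) = z ^ (3 * t + e).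
    by rewrite -(expfzDr _ _ z0); congr (_ ^ _); ring.
  have gen (a1 a2 a3 a4 b1 b2 b3 b4 b5 c1 c2 : C) : a1 * a2 = a3 * a4 ->
      b1 * (b2 * b3) = b4 * b5 ->
      b1 * (a1 * c1) * (b2 * (a2 * (b3 * c2))) = b4 * (c1 * c2) * (a3 * (a4 * b5)).
    move=> ea eb; transitivity ((a1 * a2) * (b1 * (b2 * b3)) * (c1 * c2)); first by ring.
    by rewrite ea eb; ring.
  by rewrite -ez; exact: gen esg es.
have fE (t e : int) : tsum (fun l => A (3 * t + e - 2 * l) * B l)
   = s ^ (3 * t ^+ 2 - t + e * (e - 1 + 2 * t)) * z ^ (3 * t + e)
      * ((-1) ^ e * tsum (fun l : int => (-1) ^ l * s ^ (6 * l ^+ 2 + 2 * l - 4 * e * l))).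
  rewrite (@tsum_bij _ _ _ _ _ (fun l : int => l + t) (fun l => l - t)).
  - by rewrite -!tsumZ; apply: eq_tsum => l; rewrite (AB _ l t e).
  - by move=> l; rewrite addrK.
  - by move=> l; rewrite subrK.
have tE : theta s (- z) * theta (s ^+ 2) (- (s ^+ 2 * z ^+ 2))
   = tsum (fun n => tsum (fun l => A (n - 2 * l) * B l)).
  rewrite -(tsum_prod (smb_theta _ _ _) (smb_theta _ _ _)) //.
  by rewrite (tsum_bij _ gK hK) (tsum_pair sg).
rewrite tE (tsum_mod3 (smb_tsum sg)) /=.
have f0 t : tsum (fun l => A (3 * t - 2 * l) * B l)
  = qpochoo (s ^+ 4) (s ^+ 4) * (s ^ (3 * t ^+ 2 - t) * z ^ (3 * t)).
  rewrite -[3 * t]addr0 fE mul0r !addr0 expr0z mul1r mulrC -(pentagonal s0 s1).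
  by congr (_ * _); apply: eq_tsum => l; rewrite mulr0 mul0r subr0.
have f1 t : tsum (fun l => A (3 * t + 1 - 2 * l) * B l)
  = - (qpochoo (s ^+ 4) (s ^+ 4) * (s ^ (3 * t ^+ 2 + t) * z ^ (3 * t + 1))).
  rewrite fE expr1z mulN1r mulrN [_ * tsum _]mulrC -(pentagonal s0 s1).
  congr (- (_ * (_ ^ _ * _))); last by ring.
  rewrite (@tsum_bij _ _ _ _ _ (fun l : int => - l) (fun l => - l)); try exact: opprK.
  by apply: eq_tsum => l; rewrite sgN; congr (_ * _ ^ _); ring.
(* For residue 2 the exponent is 6 l^2 - 6 l, invariant under l -> 1 - l, which reverses the sign
   (-1)^l. *)
have f2 t : tsum (fun l => A (3 * t + 2 - 2 * l) * B l) = 0.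
  rewrite fE; set X := tsum _; suff -> : X = 0 by rewrite !mulr0.
  have : X = - X.
    rewrite {1}/X (@tsum_bij _ _ _ _ _ (fun l : int => 1 - l) (fun l => 1 - l)).
    - transitivity (-1 * X); last by rewrite mulN1r.
      rewrite /X -tsumZ; apply: eq_tsum => l.
      by rewrite sg_sub expr1z -[LHS]mulrA; congr (_ * (_ * _ ^ _)); ring.
    - by move=> l; ring.
    - by move=> l; ring.
  by move/eqP; rewrite -addr_eq0 -mulr2n -mulr_natr mulf_eq0 pnatr_eq0 orbF => /eqP.
rewrite (eq_tsum f0) (eq_tsum f1) (eq_tsum f2) tsum0 addr0.
rewrite tsumZ (_ : tsum (fun _ => - _) =
  - qpochoo (s ^+ 4) (s ^+ 4) * tsum (fun t : int => s ^ (3 * t ^+ 2 + t) * z ^ (3 * t + 1))).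
  by rewrite mulNr -mulrBr mulrC.
by rewrite -tsumZ; apply: eq_tsum => t; rewrite mulNr.
Qed.

End Quintuple.

(** * Evaluation of the single sums *)

Opaque smb.

Section FiniteIdentities.
Context {R : realType} {C : normedC R}.
Context (p : C) (p0 : p != 0) (p1 : nm p < 1).

(* The combinations [bsum b c (n - d) (n + d')] are the sides of Bailey pairs: the lemmas
   [bsum_one_even] to [bsum_odd_lift] expand [1 / (p; p)_(2n)] and its variants as
   sum_r a_r / ((p; p)_(n-r) (p; p)_(n+r+e)). *)
Definition bsum (b c u v : int) : C :=
  tsum (fun r : int => iq p (u - 3 * r) * iq p (v + 3 * r) * p ^ (6 * r ^+ 2 + b * r + c)).

Lemma nm_iq2 : exists K, forall k l : int, nm (iq p k * iq p l) <= K.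
Proof.
have [K K0 hK] := iq_bd p1; exists (K * K) => k l.
by rewrite nmM; apply: ler_pM => //; exact: nm_ge0.
Qed.

Lemma smb_bsum b c u v :
  smb (fun r : int => iq p (u - 3 * r) * iq p (v + 3 * r) * p ^ (6 * r ^+ 2 + b * r + c)).
Proof.
have [K hK] := nm_iq2.
apply: (smb_quad1 (E := fun r : int => 6 * r ^+ 2 + b * r + c) (K := K)
  (d := (`|b| + 1) ^+ 2 + `|c|) p0 p1) => [r|r _]; first exact: hK.
have b0 : 0 <= `|b| + 1 by rewrite addr_ge0.
have := quad_lin r b0; have := ler_norm (- (b * r)); rewrite normrN normrM.
have := ler_norm (- c); rewrite normrN; have := sqr_ge0 r; nia.
Qed.

Lemma bsum_flip b c u v : bsum b c u v = bsum (- b) c v u.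
Proof.
rewrite /bsum (@tsum_bij _ _ _ _ _ (fun r : int => - r) (fun r => - r)); try exact: opprK.
by apply: eq_tsum => r; rewrite mulrN opprK [iq p _ * _]mulrC; congr (_ * _ ^ _); ring.
Qed.

Lemma bsum_shift b c u v : bsum b c u v = bsum (b + 12) (c + b + 6) (u - 3) (v + 3).
Proof.
rewrite /bsum (@tsum_bij _ _ _ _ _ (fun r : int => r + 1) (fun r => r - 1)).
- by apply: eq_tsum => r; congr (iq p _ * iq p _ * _ ^ _); ring.
- by move=> r; rewrite addrK.
- by move=> r; rewrite subrK.
Qed.

Lemma bsum_scale k b c u v : p ^ k * bsum b c u v = bsum b (c + k) u v.
Proof.
rewrite /bsum -tsumZ; apply: eq_tsum => r.
by rewrite addrA [in RHS]expfzDr //; ring.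
Qed.

(** From 1 - p^(u+v) = (1 - p^(u-3r)) + p^(u-3r) (1 - p^(v+3r)): each bracket lowers the index of
    one reciprocal, and p^(u-3r) changes b by -3 and c by u. *)
Lemma bsum_pascal1 b c u v : (1 - p ^ (u + v)) * bsum b c u v =
  bsum b c (u - 1) v + bsum (b - 3) (c + u) u (v - 1).
Proof.
rewrite /bsum -tsumZ -tsumD; try exact: smb_bsum.
apply: eq_tsum => r.
have -> : u - 1 - 3 * r = (u - 3 * r) - 1 by ring.
have -> : v - 1 + 3 * r = (v + 3 * r) - 1 by ring.
have -> : 6 * r ^+ 2 + (b - 3) * r + (c + u) = (6 * r ^+ 2 + b * r + c) + (u - 3 * r) by ring.
rewrite -!iq_rec // [p ^ (_ + (u - 3 * r))]expfzDr //.
have -> : u + v = (u - 3 * r) + (v + 3 * r) by ring.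
by rewrite [p ^ (u - 3 * r + _)]expfzDr //; ring.
Qed.

Lemma bsum_pascal2 b c u v : (1 - p ^ (u + v)) * bsum b c u v =
  bsum (b + 3) (c + v) (u - 1) v + bsum b c u (v - 1).
Proof.
rewrite bsum_flip [u + v]addrC bsum_pascal1 addrC; congr (_ + _); rewrite bsum_flip ?opprK //.
by rewrite opprD !opprK.
Qed.

Lemma bsum_base b c : bsum b c 0 0 = p ^ c.
Proof.
rewrite /bsum (@tsum_single _ _ _ _ 0).
  by rewrite expr0n !(mulr0, subr0, addr0, add0r, iq0, mul1r).
move=> r r0; have [h|h] := ltrP r 0.
  by rewrite [iq p (0 + 3 * r)]iq_lt0 ?mulr0 ?mul0r //; lia.
by rewrite [iq p (0 - 3 * r)]iq_lt0 ?mul0r //; move/eqP: r0; lia.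
Qed.

(** A nonzero term would need both -e - 3r and e + 3r nonnegative, that is 3 r = -e. *)
Lemma bsum_off b c (e : int) : 0 < e < 3 -> bsum b c (- e) e = 0.
Proof.
move=> e3; rewrite /bsum (@eq_tsum _ _ _ _ (fun=> 0)) ?tsum0 //.
move=> r; have [h|h] := ltrP r 0.
  by rewrite [iq p (e + 3 * r)]iq_lt0 ?mulr0 ?mul0r //; lia.
by rewrite [iq p (- e - 3 * r)]iq_lt0 ?mul0r //; lia.
Qed.

Lemma one_subX_neq0 (k : nat) : 1 - p ^ (k.+1%:Z) != 0.
Proof. by apply: one_sub_neq0; rewrite -exprnP; exact: nm_lt1X. Qed.

(* One q-Pascal rule carries the even case to the odd one, the other carries the odd case
   at n to the even case at n + 1; the extra terms cancel. *)
Lemma bsum_even_odd n :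
  bsum 1 0 n%:Z n%:Z - bsum 5 1 (n%:Z - 1) (n%:Z + 1) = iq p (2 * n%:Z)
  /\ bsum 1 0 n%:Z (n%:Z + 1) - bsum 5 1 (n%:Z - 1) (n%:Z + 2) = iq p (2 * n%:Z + 1).
Proof.
have odd (m : nat) :
    bsum 1 0 m%:Z m%:Z - bsum 5 1 (m%:Z - 1) (m%:Z + 1) = iq p (2 * m%:Z) ->
    bsum 1 0 m%:Z (m%:Z + 1) - bsum 5 1 (m%:Z - 1) (m%:Z + 2) = iq p (2 * m%:Z + 1).
  move=> h; apply: (mulfI (one_subX_neq0 (2 * m)%N)).
  have -> : (2 * m).+1%:Z = 2 * m%:Z + 1 by lia.
  rewrite iq_rec // addrK -h mulrBr.
  have {1}-> : 2 * m%:Z + 1 = m%:Z + (m%:Z + 1) by ring.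
  have -> : 2 * m%:Z + 1 = (m%:Z - 1) + (m%:Z + 2) by ring.
  (* Reflecting r and then shifting it by one identifies the two extra terms, both with linear
     coefficient 4. *)
  rewrite !bsum_pascal2 [bsum (5 + 3) _ _ _]bsum_flip [bsum (- _) _ _ _]bsum_shift.
  rewrite (_ : m%:Z + 1 - 1 = m%:Z); last by ring.
  rewrite (_ : m%:Z + 2 - 1 = m%:Z + 1); last by ring.
  rewrite (_ : bsum (- (5 + 3) + 12) (1 + (m%:Z + 2) - (5 + 3) + 6)
    (m%:Z + 2 - 3) (m%:Z - 1 - 1 + 3) = bsum (1 + 3) (0 + (m%:Z + 1)) (m%:Z - 1) (m%:Z + 1)).
    by ring.
  by congr bsum; ring.
suff h0 : bsum 1 0 n%:Z n%:Z - bsum 5 1 (n%:Z - 1) (n%:Z + 1) = iq p (2 * n%:Z).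
  by split=> //; exact: odd.
elim: n => [|n /odd IH].
  by rewrite bsum_base sub0r add0r bsum_off // mulr0 iq0 subr0.
apply: (mulfI (one_subX_neq0 (2 * n).+1)).
have -> : (2 * n).+2%:Z = 2 * n.+1%:Z by lia.
rewrite iq_rec // (_ : 2 * n.+1%:Z - 1 = 2 * n%:Z + 1); last by lia.
rewrite -IH (_ : n.+1%:Z = n%:Z + 1); last by lia.
rewrite mulrBr (_ : 2 * (n%:Z + 1) = (n%:Z + 1) + (n%:Z + 1)); last by ring.
rewrite bsum_pascal1 (_ : n%:Z + 1 - 1 = n%:Z); last by ring.
rewrite (_ : (n%:Z + 1) + (n%:Z + 1) = n%:Z + (n%:Z + 2)); last by ring.
rewrite (_ : n%:Z + 1 + 1 = n%:Z + 2); last by ring.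
rewrite [(1 - p ^ (n%:Z + _)) * _]bsum_pascal1.
rewrite (_ : n%:Z + 2 - 1 = n%:Z + 1); last by ring.
rewrite [bsum (1 - 3) _ _ _]bsum_flip.
rewrite (_ : bsum (- (1 - 3)) _ _ _ = bsum (5 - 3) (1 + n%:Z) n%:Z (n%:Z + 1)).
  by ring.
by congr bsum; ring.
Qed.

Lemma bsum_one_even (n : nat) :
  bsum 1 0 n%:Z n%:Z - bsum 5 1 (n%:Z - 1) (n%:Z + 1) = iq p (2 * n%:Z).
Proof. by have [] := bsum_even_odd n. Qed.

Lemma bsum_one_odd (n : nat) :
  bsum 1 0 n%:Z (n%:Z + 1) - bsum 5 1 (n%:Z - 1) (n%:Z + 2) = iq p (2 * n%:Z + 1).
Proof. by have [] := bsum_even_odd n. Qed.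

(** A different q-Pascal rule on each sum produces the same term [bsum 4 0 (n - 1) (n + 1)], which
    cancels; p^n times [bsum_one_even] remains. In the same way [bsum_pow_even] at n + 1 reduces to
    [bsum_one_odd] at n. *)
Lemma bsum_pow_odd (n : nat) :
  bsum 4 0 n%:Z (n%:Z + 1) - bsum 4 0 (n%:Z - 1) (n%:Z + 2) = p ^ n%:Z * iq p (2 * n%:Z + 1).
Proof.
apply: (mulfI (one_subX_neq0 (2 * n)%N)).
have -> : (2 * n).+1%:Z = 2 * n%:Z + 1 by lia.
rewrite mulrCA iq_rec // addrK -bsum_one_even mulrBr.
have {1}-> : 2 * n%:Z + 1 = n%:Z + (n%:Z + 1) by ring.
have -> : 2 * n%:Z + 1 = (n%:Z - 1) + (n%:Z + 2) by ring.
rewrite bsum_pascal1 bsum_pascal2 mulrBr !bsum_scale.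
rewrite (_ : n%:Z + 1 - 1 = n%:Z); last by ring.
rewrite (_ : n%:Z + 2 - 1 = n%:Z + 1); last by ring.
rewrite [bsum (4 + 3) _ _ _]bsum_flip [bsum (- (4 + 3)) _ _ _]bsum_shift.
rewrite (_ : bsum (- (4 + 3) + 12) (0 + (n%:Z + 2) - (4 + 3) + 6)
  (n%:Z + 2 - 3) (n%:Z - 1 - 1 + 3) = bsum 5 (1 + n%:Z) (n%:Z - 1) (n%:Z + 1)).
  by rewrite (_ : (4 - 3 : int) = 1) //; ring.
by congr bsum; ring.
Qed.

Lemma bsum_pow_even (n : nat) :
  bsum 2 0 n%:Z n%:Z - bsum 2 0 (n%:Z - 1) (n%:Z + 1) = p ^ n%:Z * iq p (2 * n%:Z).
Proof.
case: n => [|n].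
  by rewrite bsum_base sub0r add0r bsum_off // mulr0 iq0 subr0 mulr1.
apply: (mulfI (one_subX_neq0 (2 * n).+1)).
have -> : (2 * n).+2%:Z = 2 * n.+1%:Z by lia.
rewrite mulrCA iq_rec // (_ : 2 * n.+1%:Z - 1 = 2 * n%:Z + 1); last by lia.
rewrite -bsum_one_odd mulrBr (_ : n.+1%:Z = n%:Z + 1); last by lia.
rewrite (_ : 2 * (n%:Z + 1) = (n%:Z + 1) + (n%:Z + 1)); last by ring.
rewrite bsum_pascal1 (_ : n%:Z + 1 - 1 = n%:Z); last by ring.
rewrite (_ : (n%:Z + 1) + (n%:Z + 1) = n%:Z + (n%:Z + 2)); last by ring.
rewrite (_ : n%:Z + 1 + 1 = n%:Z + 2); last by ring.
rewrite [(1 - p ^ (n%:Z + _)) * _]bsum_pascal2.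
rewrite (_ : n%:Z + 2 - 1 = n%:Z + 1); last by ring.
rewrite [bsum (2 - 3) _ _ _]bsum_flip mulrBr !bsum_scale.
rewrite (_ : bsum (- (2 - 3)) (0 + (n%:Z + 1)) n%:Z (n%:Z + 1)
  = bsum 1 (0 + (n%:Z + 1)) n%:Z (n%:Z + 1)); last by congr bsum; ring.
rewrite (_ : bsum (2 + 3) (0 + (n%:Z + 2)) (n%:Z - 1) (n%:Z + 2)
  = bsum 5 (1 + (n%:Z + 1)) (n%:Z - 1) (n%:Z + 2)); last by congr bsum; ring.
by ring.
Qed.

(** The value of [bsum_one_even] relative to u + v = 2 n + 1, as the conjugate pair with e = 1
    requires. Multiplied by 1 - p^(2n+1), it becomes [bsum_one_even] minus p^(n+1) times
    [bsum_pow_even]. *)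
Lemma bsum_even_lift (n : nat) :
  bsum (-1) 0 n%:Z (n%:Z + 1) - bsum 5 1 n%:Z (n%:Z + 1) = iq p (2 * n%:Z).
Proof.
apply: (mulfI (one_subX_neq0 (2 * n)%N)).
have -> : (2 * n).+1%:Z = 2 * n%:Z + 1 by lia.
have e : 2 * n%:Z + 1 = n%:Z + (n%:Z + 1) by ring.
rewrite mulrBr {1 2}e bsum_pascal2 bsum_pascal1.
rewrite (_ : n%:Z + 1 - 1 = n%:Z); last by ring.
rewrite mulrBl mul1r -{1}bsum_one_even.
rewrite (_ : 2 * n%:Z + 1 = (n%:Z + 1) + n%:Z); last by ring.
rewrite expfzDr // -mulrA -bsum_pow_even mulrBr !bsum_scale.
rewrite [bsum (-1) 0 _ _]bsum_flip opprK.
rewrite (_ : (-1 + 3 : int) = 2) // (_ : (5 - 3 : int) = 2) //.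
rewrite (_ : bsum 2 (1 + n%:Z) n%:Z n%:Z = bsum 2 (0 + (n%:Z + 1)) n%:Z n%:Z).
  by ring.
by congr bsum; ring.
Qed.

(** An odd value relative to the even u + v = 2 n, for e = 0. At n + 1, multiplying by 1 - p^(2n+2)
    leaves [bsum_one_odd] minus p^(n+2) times [bsum_pow_odd]. *)
Lemma bsum_odd_lift (n : nat) :
  bsum 1 0 (n%:Z - 1) (n%:Z + 1) - bsum 5 1 (n%:Z - 2) (n%:Z + 2) = iq p (2 * n%:Z - 1).
Proof.
case: n => [|n].
  by rewrite !sub0r !add0r !bsum_off // subr0 iq_lt0.
apply: (mulfI (one_subX_neq0 (2 * n).+1)).
have -> : (2 * n).+2%:Z = 2 * n.+1%:Z by lia.
rewrite (_ : n.+1%:Z = n%:Z + 1); last by lia.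
rewrite (_ : 2 * (n%:Z + 1) - 1 = 2 * n%:Z + 1); last by ring.
rewrite mulrBr [in RHS]mulrBl mul1r (_ : n%:Z + 1 - 1 = n%:Z); last by ring.
rewrite (_ : n%:Z + 1 + 1 = n%:Z + 2); last by ring.
rewrite (_ : n%:Z + 1 - 2 = n%:Z - 1); last by ring.
rewrite (_ : n%:Z + 1 + 2 = n%:Z + 3); last by ring.
rewrite [in RHS](_ : 2 * (n%:Z + 1) = (n%:Z + 2) + n%:Z); last by ring.
rewrite [in RHS]expfzDr // -mulrA -bsum_pow_odd mulrBr !bsum_scale -bsum_one_odd.
rewrite {1}(_ : 2 * (n%:Z + 1) = n%:Z + (n%:Z + 2)); last by ring.
rewrite (_ : 2 * (n%:Z + 1) = (n%:Z - 1) + (n%:Z + 3)); last by ring.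
rewrite !bsum_pascal2.
rewrite (_ : n%:Z + 2 - 1 = n%:Z + 1); last by ring.
rewrite (_ : n%:Z + 3 - 1 = n%:Z + 2); last by ring.
rewrite [bsum (5 + 3) _ _ _]bsum_flip [bsum (- (5 + 3)) _ _ _]bsum_shift.
rewrite (_ : (1 + 3 : int) = 4) //.
rewrite (_ : bsum (- (5 + 3) + 12) (1 + (n%:Z + 3) - (5 + 3) + 6)
  (n%:Z + 3 - 3) (n%:Z - 1 - 1 + 3) = bsum 4 (0 + (n%:Z + 2)) n%:Z (n%:Z + 1)).
  by ring.
by congr bsum; ring.
Qed.

End FiniteIdentities.

(** * A finite q-binomial sum and the 1phi1 summation *)

Section OnePhiOne.
Context {R : realType} {C : normedC R}.
Implicit Types a p q s x : C.

(* At m < 0 the value 0 is junk, not the usual (a; p)_m; the other factors of the sums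
   below vanish there. *)
Definition qz a p (m : int) : C := if m is Posz n then qpoch a p n else 0.

Lemma qz0 a p : qz a p 0 = 1.
Proof. exact: qpoch0. Qed.

Lemma qz_rec a p (n : int) :
  qz a p (n + 1) * iq p n = (1 - a * p ^ n) * qz a p n * iq p n.
Proof.
case: n => n; last by rewrite iq_lt0 // !mulr0.
have -> : n%:Z + 1 = n.+1 by lia.
by rewrite /qz qpochS [qpoch _ _ _ * _]mulrC.
Qed.

Lemma smb_conv p (g : int -> C) (N : int) :
  smb (fun n => g n * (iq p n * iq p (N - n))).
Proof.
apply: (smb_fin (D := [fset Posz k | k in iota 0 `|N|.+1]%fset)) => n.
have [n0|n0 _] := lerP 0 n; last by rewrite iq_lt0 // mul0r mulr0.
have [nN|nN _] := lerP n N; last first.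
  by rewrite [iq p (N - n)]iq_lt0 ?mulr0 //; lia.
move=> /negP []; apply/imfsetP; exists `|n|%N => /=; last by lia.
suff: `|n|%N \in iota 0 `|N|.+1 by [].
by rewrite mem_iota; lia.
Qed.

Lemma tsum_shift (F : int -> C) (k : int) : tsum F = tsum (fun n => F (n + k)).
Proof.
by apply: (@tsum_bij _ _ _ _ _ (fun n => n + k) (fun n => n - k)) => n; rewrite ?addrK ?subrK.
Qed.

(** The coefficient of z^N in (az;p)_oo / (z;p)_oo * 1 / (az;p)_oo = 1 / (z;p)_oo. The induction
    uses 1 - p^N = p^n (1 - p^(N-n)) + (1 - p^n), after which the terms in a p^n cancel. *)
Lemma qbinom_sum a p (N : nat) : a != 0 -> p != 0 -> nm p < 1 ->
  tsum (fun n : int => qz a p n * a ^ (N%:Z - n) * (iq p n * iq p (N%:Z - n))) = iq p N.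
Proof.
move=> a0 p0 p1; elim: N => [|N IH].
  rewrite (@tsum_single _ _ _ _ 0).
    by rewrite subr0 iq0 expr0z qz0 !mul1r.
  move=> n n0; have [h|h] := ltrP n 0; first by rewrite [iq p n]iq_lt0 ?mul0r ?mulr0.
  by rewrite [iq p (0 - n)]iq_lt0 ?mulr0 //; move/eqP: n0; lia.
have h : 1 - p ^ N.+1%:Z != 0 by apply: one_sub_neq0; rewrite -exprnP; exact: nm_lt1X.
apply: (mulfI h); rewrite iq_rec // (_ : N.+1%:Z - 1 = N); last by lia.
rewrite -IH -tsumZ.
pose F1 (n : int) := qz a p n * a ^ (N.+1%:Z - n) * p ^ n * (iq p n * iq p (N%:Z - n)).
pose F2 (n : int) := qz a p n * a ^ (N.+1%:Z - n) * (iq p (n - 1) * iq p (N.+1%:Z - n)).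
have s1 : smb F1 by exact: smb_conv.
have s2 : smb (fun n => F2 (n + 1)).
  apply: (eq_smb _ (smb_conv p (fun n => qz a p (n + 1) * a ^ (N%:Z - n)) N)) => n.
  by rewrite /F2 addrK; congr (_ * a ^ _ * (_ * iq p _)); lia.
have s2' : smb F2.
  apply: (eq_smb _ (smb_inj (g := fun n : int => n - 1) _ s2)); last by move=> i j; lia.
  by move=> n; rewrite subrK.
transitivity (tsum F1 + tsum F2).
  rewrite -tsumD //; apply: eq_tsum => n; rewrite /F1 /F2.
  rewrite -(iq_rec n p1) (_ : N%:Z - n = N.+1%:Z - n - 1); last by lia.
  rewrite -(iq_rec (N.+1%:Z - n) p1).
  rewrite (_ : N.+1%:Z = n + (N.+1%:Z - n)); last by lia.
  rewrite [p ^ (n + _)]expfzDr // (_ : n + (N.+1%:Z - n) - n = N.+1%:Z - n); last by lia.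
  by ring.
rewrite (tsum_shift F2 1) -tsumD //; apply: eq_tsum => n; rewrite /F1 /F2 addrK.
rewrite (_ : N.+1%:Z - (n + 1) = N%:Z - n); last by lia.
rewrite (_ : N.+1%:Z - n = (N%:Z - n) + 1); last by lia.
rewrite [a ^ (_ + 1)]expfzDr // expr1z.
rewrite (_ : qz a p (n + 1) * a ^ (N%:Z - n) * (iq p n * iq p (N%:Z - n))
  = a ^ (N%:Z - n) * iq p (N%:Z - n) * (qz a p (n + 1) * iq p n)); last by ring.
by rewrite qz_rec; ring.
Qed.

Lemma qbinom_sum_int a p (N : int) : a != 0 -> p != 0 -> nm p < 1 ->
  tsum (fun n : int => qz a p n * a ^ (N - n) * (iq p n * iq p (N - n))) = iq p N.
Proof.
case: N => N a0 p0 p1; first exact: qbinom_sum.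
rewrite iq_lt0 // (@eq_tsum _ _ _ _ (fun=> 0)) ?tsum0 // => n.
have [h|h] := ltrP n 0; first by rewrite iq_lt0 ?mul0r ?mulr0.
by rewrite [iq p (_ - n)]iq_lt0 ?mulr0 //; lia.
Qed.

Lemma qz_bd a p : a != 0 -> p != 0 -> nm p < 1 -> exists K, forall n, nm (qz a p n) <= K.
Proof.
move=> a0 p0 p1; have [K K0 hK] := slim_bounded (slim_qpoch a0 p0 p1).
by exists K => -[n|n] /=; rewrite ?nm0 //; exact: hK.
Qed.

(* The terms are regrouped along [N = n + k], where [k] indexes the Euler expansion of
   [(a x p^n; p)_oo]. *)
Lemma one_phi_one s a x : s != 0 -> nm s < 1 -> a != 0 -> nm a <= 1 ->
  x != 0 -> nm x <= 1 ->
  tsum (fun n : int => qz a (s ^+ 2) n * qpochoo (a * x * (s ^+ 2) ^ n) (s ^+ 2)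
     * (s ^ (n ^+ 2 - n) * (- x) ^ n) * iq (s ^+ 2) n) = qpochoo x (s ^+ 2).
Proof.
move=> s0 s1 a0 a1 x0 x1; set p := s ^+ 2.
have p0 : p != 0 by rewrite expf_neq0.
have p1 : nm p < 1 by exact: nm_lt1X.
have nx0 : - x != 0 by rewrite oppr_eq0.
pose F (y : int * int) : C := qz a p y.2 * a ^ (y.1 - y.2) * (iq p y.2 * iq p (y.1 - y.2))
   * (- x) ^ y.1 * s ^ (y.1 ^+ 2 - y.1).
have sF : smb F.
  have [K1 hK1] := qz_bd a0 p0 p1; have [K2 K20 hK2] := iq_bd p1.
  have K10 : 0 <= K1 := le_trans (nm_ge0 _) (hK1 0).
  have nz (y : int * int) : qz a p y.2 * a ^ (y.1 - y.2) * (iq p y.2 * iq p (y.1 - y.2))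
     * (- x) ^ y.1 != 0 -> 0 <= y.2 /\ 0 <= y.1 - y.2.
    rewrite mulf_eq0 negb_or => /andP[+ _].
    rewrite mulf_eq0 negb_or => /andP[_].
    by rewrite mulf_eq0 negb_or => /andP[/iq_neq0 ? /iq_neq0 ?].
  apply: (smb_quad2 (E := fun y : int * int => y.1 ^+ 2 - y.1) (K := K1 * (K2 * K2))
    (d := 9) s0 s1).
    move=> y; have [->|/nz [n1 n2]] := eqVneq (qz a p y.2 * a ^ (y.1 - y.2)
       * (iq p y.2 * iq p (y.1 - y.2)) * (- x) ^ y.1) 0.
      by rewrite nm0 !mulr_ge0 // ltW.
    have pw (b : C) (k : int) : 0 <= k -> nm b <= 1 -> nm (b ^ k) <= 1.
      by case: k => // k _ hb; rewrite -exprnP nmX exprn_ile1 ?nm_ge0.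
    rewrite !nmM -[leRHS]mulr1; apply: ler_pM; rewrite ?mulr_ge0 ?nm_ge0 //.
      apply: ler_pM; rewrite ?mulr_ge0 ?nm_ge0 //.
        by rewrite -[leRHS]mulr1; apply: ler_pM; rewrite ?nm_ge0 ?hK1 ?pw.
      by apply: ler_pM; rewrite ?nm_ge0.
    by rewrite pw ?nmN //; lia.
  by move=> y /nz [n1 n2]; have := quad_lin y.1 (c := 3); lia.
transitivity (euler s (- x)); last by rewrite euler_qpochoo // opprK.
transitivity (tsum (fun N => tsum (fun n => F (N, n)))); last first.
  apply: eq_tsum => N; rewrite /euler_term -/p -(qbinom_sum_int N a0 p0 p1) /F /= mulrC.
  rewrite mulrC -tsumZ; apply: eq_tsum => n; ring.
rewrite -(tsum_pair sF) (tsum_pair2 sF); apply: eq_tsum => n.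
have axn0 : a * x * p ^ n != 0 by rewrite !mulf_neq0 ?expfz_neq0.
have naxn0 : - (a * x * p ^ n) != 0 by rewrite oppr_eq0.
rewrite -[a * x * p ^ n]opprK -(euler_qpochoo s0 s1 naxn0).
transitivity ((qz a p n * (s ^ (n ^+ 2 - n) * (- x) ^ n) * iq p n)
  * euler s (- (a * x * p ^ n))); first by ring.
rewrite [in RHS](tsum_shift _ n) -tsumZ; apply: eq_tsum => k; rewrite /F /= /euler_term -/p.
rewrite addrK [(- x) ^ (k + n)]expfzDr //.
rewrite (_ : - (a * x * p ^ n) = a * (- x) * p ^ n); last by ring.
rewrite [(a * _ * _) ^ k]exprzMl ?unitfE ?mulf_neq0 ?expfz_neq0 //.
rewrite [(a * _) ^ k]exprzMl ?unitfE // exprz_exp [p ^ (n * k)]exprXz.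
rewrite (_ : (k + n) ^+ 2 - (k + n) = (n ^+ 2 - n) + (k ^+ 2 - k) + 2%:Z * (n * k)); last by ring.
by rewrite !expfzDr //; ring.
Qed.

End OnePhiOne.

(** * The conjugate Bailey pair and Bailey's lemma *)

Section SingleSums.
Context {R : realType} {C : normedC R}.
Context (q : C) (q0 : q != 0) (q1 : nm q < 1).

Let p := q ^+ 2.
Let p0 : p != 0. Proof. exact: expf_neq0. Qed.
Let p1 : nm p < 1. Proof. exact: nm_lt1X. Qed.

Lemma qz_shift a (k : nat) (t : int) :
  qz a p (t + k%:Z) * iq p t = qpoch a p k * qz (a * p ^+ k) p t * iq p t.
Proof.
case: t => t; last by rewrite iq_lt0 // !mulr0.
by rewrite /qz [t%:Z + _](_ : _ = (k + t)%N%:Z) ?qpoch_split //; lia.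
Qed.

(** The 1phi1 sum with both parameters equal to -q^(2k+e+1), at m = t + k: their product times p^t
    is p^(t+2k+e+1), so the infinite product in the summand is (p;p)_oo / (p;p)_(t+2k+e). *)
Lemma conjugate_sum_nat (e k : nat) :
  qpochoo p p * tsum (fun m : int => qz (- q ^+ e.+1) p m * q ^ (m ^+ 2 + e%:Z * m)
    * (iq p (m - k%:Z) * iq p (m + k%:Z + e%:Z)))
  = q ^ (k%:Z ^+ 2 + e%:Z * k%:Z) * qpochoo (- q ^+ e.+1) p.
Proof.
set a := - q ^+ e.+1; have a0 : a != 0 by rewrite oppr_eq0 expf_neq0.
have ak0 : a * p ^+ k != 0 by rewrite mulf_neq0 ?expf_neq0.
have ak1 : nm (a * p ^+ k) <= 1.
  rewrite nmM nmN !nmX -exprM -exprD exprn_ile1 ?nm_ge0 //; exact: ltW.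
rewrite (qpochoo_split k a0 p0 p1) -(one_phi_one q0 q1 ak0 ak1 ak0 ak1) -/p.
rewrite (tsum_shift _ k%:Z) mulrA -!tsumZ; apply: eq_tsum => t.
rewrite addrK.
have ec : a * p ^+ k = - q ^ (2 * k%:Z + e%:Z + 1).
  by rewrite /a /p mulNr -exprM -exprD exprnP; congr (- _ ^ _); lia.
have -> : a * p ^+ k * (a * p ^+ k) * p ^ t = p ^ (t + k%:Z + k%:Z + e%:Z + 1).
  by rewrite ec mulrNN /p !exprXz -!expfzDr //; congr (_ ^ _); ring.
rewrite qpochoo_iq // {2}ec opprK exprz_exp.
transitivity (qpochoo p p * (qz a p (t + k%:Z) * iq p t)
  * q ^ ((t + k%:Z) ^+ 2 + e%:Z * (t + k%:Z)) * iq p (t + k%:Z + k%:Z + e%:Z)); first by ring.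
rewrite qz_shift (_ : (t + k%:Z) ^+ 2 + e%:Z * (t + k%:Z) =
  (k%:Z ^+ 2 + e%:Z * k%:Z) + (t ^+ 2 - t) + (2 * k%:Z + e%:Z + 1) * t); last by ring.
by rewrite !expfzDr //; ring.
Qed.

Lemma conjugate_sum (e : nat) (k : int) : (e <= 1)%N ->
  qpochoo p p * tsum (fun m : int => qz (- q ^+ e.+1) p m * q ^ (m ^+ 2 + e%:Z * m)
    * (iq p (m - k) * iq p (m + k + e%:Z)))
  = q ^ (k ^+ 2 + e%:Z * k) * qpochoo (- q ^+ e.+1) p.
Proof.
move=> e1; have [k0|k0] := lerP 0 k.
  by rewrite (_ : k = `|k|%N); [exact: conjugate_sum_nat|lia].
(* The reflection k -> -e - k swaps the two reciprocals and fixes k^2 + e k; it sends k < 0 to j >=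
   0 because e <= 1. *)
have [j jE] : exists j : nat, k = - e%:Z - j%:Z by exists `|- e%:Z - k|%N; lia.
have := conjugate_sum_nat e j; rewrite (_ : j%:Z ^+ 2 + e%:Z * j%:Z = k ^+ 2 + e%:Z * k).
  move=> <-; congr (_ * _); apply: eq_tsum => m; rewrite [iq p _ * _]mulrC jE.
  by congr (_ * (iq p _ * iq p _)); ring.
by rewrite jE; ring.
Qed.

Definition bailey_term (e : nat) (b c d : int) (y : int * int) : C :=
  qz (- q ^+ e.+1) p y.1 *
  (iq p (y.1 - d - 3 * y.2) * iq p (y.1 + d + e%:Z + 3 * y.2))
  * q ^ (y.1 ^+ 2 + e%:Z * y.1 + 2 * (6 * y.2 ^+ 2 + b * y.2 + c)).

Lemma smb_bailey_term (e : nat) (b c d : int) : (e <= 1)%N -> smb (bailey_term e b c d).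
Proof.
move=> e1; have a0 : - q ^+ e.+1 != 0 by rewrite oppr_eq0 expf_neq0.
have [K1 hK1] := qz_bd a0 p0 p1; have [K2 hK2] := nm_iq2 p1.
apply: (smb_quad2 (E := fun y : int * int =>
  y.1 ^+ 2 + e%:Z * y.1 + 2 * (6 * y.2 ^+ 2 + b * y.2 + c)) (K := K1 * K2)
  (d := 4 + (2 * `|b| + 1) ^+ 2 + 2 * `|c|) q0 q1) => [y|y _].
  by rewrite nmM; apply: ler_pM; rewrite ?nm_ge0.
have b0 : 0 <= 2 * `|b| + 1 by lia.
have := quad_lin y.2 b0; have := ler_norm (- (b * y.2)); rewrite normrN normrM.
have := ler_norm (- c); rewrite normrN; have := sqr_ge0 y.2.
have := @quad_lin y.1 2 isT; have : `|e%:Z * y.1| <= `|y.1|.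
  by rewrite normrM; nia.
have := ler_norm (- (e%:Z * y.1)); rewrite normrN; nia.
Qed.

Lemma tsum_bailey_term (e : nat) (b c d m : int) :
  tsum (fun r => bailey_term e b c d (m, r)) =
  qz (- q ^+ e.+1) p m * q ^ (m ^+ 2 + e%:Z * m) * bsum p b c (m - d) (m + d + e%:Z).
Proof.
rewrite /bsum -tsumZ; apply: eq_tsum => r.
by rewrite /bailey_term /= expfzDr // -(exprXz q 2); ring.
Qed.

Lemma smb_bailey (e : nat) (b c d : int) : (e <= 1)%N ->
  smb (fun m : int => qz (- q ^+ e.+1) p m * q ^ (m ^+ 2 + e%:Z * m)
    * bsum p b c (m - d) (m + d + e%:Z)).
Proof.
move=> e1; apply: eq_smb (smb_tsum (smb_bailey_term b c d e1)) => m.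
exact: tsum_bailey_term.
Qed.

(** Bailey's lemma: in the double sum over m and r, the sum over m is [conjugate_sum] at k = 3 r +
    d. *)
Lemma bailey_sum (e : nat) (b c d : int) : (e <= 1)%N ->
  qpochoo p p * tsum (fun m : int => qz (- q ^+ e.+1) p m * q ^ (m ^+ 2 + e%:Z * m)
    * bsum p b c (m - d) (m + d + e%:Z))
  = qpochoo (- q ^+ e.+1) p * tsum (fun r : int =>
      q ^ (2 * (6 * r ^+ 2 + b * r + c) + (3 * r + d) ^+ 2 + e%:Z * (3 * r + d))).
Proof.
move=> e1; have sF := smb_bailey_term b c d e1.
under eq_tsum do rewrite -tsum_bailey_term.
rewrite -(tsum_pair sF) (tsum_pair2 sF) -!tsumZ; apply: eq_tsum => r.
transitivity (q ^ (2 * (6 * r ^+ 2 + b * r + c)) * (qpochoo p p *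
    tsum (fun m : int => qz (- q ^+ e.+1) p m * q ^ (m ^+ 2 + e%:Z * m)
    * (iq p (m - (3 * r + d)) * iq p (m + (3 * r + d) + e%:Z))))); last first.
  by rewrite (conjugate_sum _ e1) -[in RHS]addrA [in RHS]expfzDr //; ring.
rewrite mulrCA; congr (_ * _); rewrite -tsumZ; apply: eq_tsum => m.
rewrite /bailey_term /= expfzDr //.
rewrite (_ : m - d - 3 * r = m - (3 * r + d)); last by ring.
rewrite (_ : m + d + e%:Z + 3 * r = m + (3 * r + d) + e%:Z); last by ring.
by ring.
Qed.

End SingleSums.

(** * The six single sums as differences of theta series *)

Section SingleSumEvaluations.
Context {R : realType} {C : normedC R}.
Context (q : C) (q0 : q != 0) (q1 : nm q < 1).

Let p := q ^+ 2.
Let p0 : p != 0. Proof. exact: expf_neq0. Qed.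
Let p1 : nm p < 1. Proof. exact: nm_lt1X. Qed.
Let nq0 : - q != 0. Proof. by rewrite oppr_eq0. Qed.
Let np0 : - p != 0. Proof. by rewrite oppr_eq0. Qed.

Definition Wsum (d l mu : int) : C :=
  tsum (fun m : int => q ^ (m ^+ 2 + l * m) * (iq q (2 * m + d)
    * qpochoo (- q ^ (2 * m + mu)) (q ^+ 2))).

(** The series side of [quintuple] at s = q^7, z = q^a. *)
Definition quint (a : int) : C :=
  tsum (fun t : int => q ^ (21 * t ^+ 2 - 7 * t + 3 * a * t))
  - tsum (fun t : int => q ^ (21 * t ^+ 2 + 7 * t + 3 * a * t + a)).

Lemma qpoch_qq_neq0 n : qpoch q q n != 0.
Proof.
have [c c0 hc] := qpoch_lb q1.
by rewrite -nm_gt0 (lt_le_trans c0).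
Qed.

Lemma iq_double n : iq q n%:Z = qpoch (- q) q n * iq p n%:Z.
Proof.
have -> : iq p n%:Z = (qpoch q q n * qpoch (- q) q n)^-1.
  congr (_ ^-1); rewrite /qpoch -big_split /=; apply: eq_bigr => i _.
  by rewrite mulNr -!exprS -exprM mulnC exprM; ring.
have := qpoch_qq_neq0 n => h; rewrite invfM mulrCA mulfV ?mulr1 //.
apply/prodf_neq0 => i _; apply: one_sub_neq0.
by rewrite mulNr nmN -exprS; exact: nm_lt1X.
Qed.

Lemma qpochN_double (n : nat) :
  qpoch (- q) q (2 * n)%N = qpoch (- q) p n * qpoch (- p) p n.
Proof.
rewrite mulnC (qpoch_mod _ _ _ (m := 2)) // !big_ord_recr big_ord0 /= mul1r expr0 mulr1.
by rewrite expr1 mulNr -expr2.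
Qed.

Lemma qpochoo_tail (a : C) (n : nat) : a != 0 ->
  qpochoo a p = qpoch a p n * qpochoo (a * q ^ (2 * n%:Z)) p.
Proof. by move=> a0; rewrite (qpochoo_split n a0 p0 p1) /p -exprM. Qed.

(** The four [weight] lemmas bring the summand of [Wsum] into Bailey form. Here (-q;q)_2m = (-q;p)_m
    (-p;p)_m, and the second factor completes the tail (-q^(2m+2);p)_oo to the constant
    (-p;p)_oo. *)
Lemma weight_even (m : int) : iq q (2 * m + 0) * qpochoo (- q ^ (2 * m + 2)) p
  = qpochoo (- p) p * (qz (- q) p m * iq p (2 * m)).
Proof.
case: m => n; last by rewrite !iq_lt0 ?mul0r ?mulr0 //; lia.
rewrite addr0 (qpochoo_tail n np0) -[2 * n%:Z]/((2 * n)%N%:Z) iq_double qpochN_double.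
rewrite (_ : - p * q ^ (2 * n)%N%:Z = - q ^ ((2 * n)%N%:Z + 2)); last first.
  by rewrite expfzDr // mulNr mulrC.
by rewrite /qz; ring.
Qed.

Lemma weight_odd (m : int) : iq q (2 * m + 1) * qpochoo (- q ^ (2 * m + 2)) p
  = qpochoo (- p) p * (qz (- q) p (m + 1) * iq p (2 * m + 1)).
Proof.
case: m => n; last by rewrite !iq_lt0 ?mul0r ?mulr0 //; lia.
rewrite (qpochoo_tail n np0) (_ : 2 * n%:Z + 1 = (2 * n).+1%:Z); last by lia.
rewrite iq_double qpochS qpochN_double.
rewrite (_ : - p * q ^ (2 * n%:Z) = - q ^ (2 * n%:Z + 2)); last first.
  by rewrite expfzDr // mulNr mulrC.
rewrite (_ : n%:Z + 1 = n.+1); last by lia.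
by rewrite /qz qpochS /p -exprM; ring.
Qed.

Lemma weight_even' (m : int) : iq q (2 * m + 0) * qpochoo (- q ^ (2 * m + 1)) p
  = qpochoo (- q) p * (qz (- p) p m * iq p (2 * m)).
Proof.
case: m => n; last by rewrite !iq_lt0 ?mul0r ?mulr0 //; lia.
rewrite addr0 (qpochoo_tail n nq0) -[2 * n%:Z]/((2 * n)%N%:Z) iq_double qpochN_double.
rewrite (_ : - q * q ^ (2 * n)%N%:Z = - q ^ ((2 * n)%N%:Z + 1)); last first.
  by rewrite expfzDr // expr1z mulNr mulrC.
by rewrite /qz; ring.
Qed.

Lemma weight_odd' (m : int) : iq q (2 * m + 1) * qpochoo (- q ^ (2 * m + 3)) p
  = qpochoo (- q) p * (qz (- p) p m * iq p (2 * m + 1)).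
Proof.
case: m => n; last by rewrite !iq_lt0 ?mul0r ?mulr0 //; lia.
rewrite (qpochoo_tail n.+1 nq0) (_ : 2 * n%:Z + 1 = (2 * n).+1%:Z); last by lia.
rewrite iq_double !qpochS qpochN_double.
rewrite (_ : - q * q ^ (2 * n.+1%:Z) = - q ^ (2 * n%:Z + 3)); last first.
  rewrite (_ : 2 * n%:Z + 3 = 1 + 2 * n.+1%:Z); last by lia.
  by rewrite [in RHS]expfzDr // expr1z mulNr.
by rewrite /qz /p -exprM; ring.
Qed.

Lemma qpochoo_qq_prod :
  qpochoo q q * (qpochoo (- q) p * qpochoo (- p) p) = qpochoo p p.
Proof.
rewrite -[RHS](qpochoo_sq q0 q0 q1); congr (_ * _).
rewrite (qpochoo_mod (m := 2) _ nq0 q0 q1) // !big_ord_recr big_ord0 /= mul1r expr0 mulr1.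
by rewrite expr1 mulNr -expr2.
Qed.

Let pp_neq0 : qpochoo p p != 0.
Proof. exact: qpochoo_neq0_lt1. Qed.

(** [K] is the constant split off by a [weight] lemma. Together with the product from [bailey_sum]
    and (q;q)_oo it makes (p;p)_oo, which cancels. *)
Lemma bailey_eval (e : nat) (b c d b' c' d' : int) (K W : C) : (e <= 1)%N ->
  qpochoo (- q ^+ e.+1) p * K = qpochoo (- q) p * qpochoo (- p) p ->
  W = K * tsum (fun m : int => qz (- q ^+ e.+1) p m * q ^ (m ^+ 2 + e%:Z * m)
    * (bsum p b c (m - d) (m + d + e%:Z) - bsum p b' c' (m - d') (m + d' + e%:Z))) ->
  qpochoo q q * W =
  tsum (fun r : int =>
      q ^ (2 * (6 * r ^+ 2 + b * r + c) + (3 * r + d) ^+ 2 + e%:Z * (3 * r + d)))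
  - tsum (fun r : int =>
      q ^ (2 * (6 * r ^+ 2 + b' * r + c') + (3 * r + d') ^+ 2 + e%:Z * (3 * r + d'))).
Proof.
move=> e1 hK ->; apply: (mulfI pp_neq0); rewrite -{2}qpochoo_qq_prod -hK.
under eq_tsum do rewrite mulrBr.
rewrite tsumB; try exact: smb_bailey.
have := bailey_sum q0 q1 b c d e1; have := bailey_sum q0 q1 b' c' d' e1; rewrite -/p.
set t1 := tsum _; set t2 := tsum _; set t3 := tsum _; set t4 := tsum _ => h1 h2.
transitivity (qpochoo q q * K * (qpochoo p p * t3 - qpochoo p p * t1)); first by ring.
by rewrite h1 h2; ring.
Qed.

Let e0p : qpochoo (- q ^+ 1) p * qpochoo (- p) p = qpochoo (- q) p * qpochoo (- p) p.
Proof. by []. Qed.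

Let e1p : qpochoo (- q ^+ 2) p * qpochoo (- q) p = qpochoo (- q) p * qpochoo (- p) p.
Proof. by rewrite mulrC. Qed.

Lemma tsum_flip (F : int -> C) : tsum F = tsum (fun n => F (- n)).
Proof. by apply: (@tsum_bij _ _ _ _ _ (fun n => - n) (fun n => - n)); exact: opprK. Qed.

(** Since [qz] vanishes at negative m, the finite identities, proved over [nat], suffice under a sum
    over [int]. *)
Lemma qz_mul_eq (a : C) (m : int) (x y : C) :
  (0 <= m -> x = y) -> qz a p m * x = qz a p m * y.
Proof. by case: m => n h; [rewrite h|rewrite !mul0r]. Qed.

(* For each evaluation, [a] is read off by comparing exponents with those of [quint]. *)
Lemma Wsum_002 : qpochoo q q * Wsum 0 0 2 = quint 3.
Proof.
rewrite (bailey_eval (e := 0) (b := 1) (c := 0) (d := 0) (b' := 5) (c' := 1) (d' := 1) isT e0p).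
  by congr (_ - _); apply: eq_tsum => r; congr (_ ^ _); ring.
rewrite /Wsum -tsumZ; apply: eq_tsum => m; rewrite weight_even mulrCA; congr (_ * _).
rewrite [LHS]mulrCA -[RHS]mulrA; apply: qz_mul_eq => m0.
by case: m m0 => // n _; rewrite -(bsum_one_even p0 p1) !(subr0, addr0).
Qed.

Lemma Wsum_022 : qpochoo q q * Wsum 0 2 2 = quint 1.
Proof.
rewrite (bailey_eval (e := 0) (b := 2) (c := 0) (d := 0) (b' := 2) (c' := 0) (d' := 1) isT e0p).
  rewrite tsum_flip.
  by congr (_ - _); apply: eq_tsum => r; congr (_ ^ _); ring.
rewrite /Wsum -tsumZ; apply: eq_tsum => m; rewrite weight_even mulrCA; congr (_ * _).
rewrite [LHS]mulrCA -[RHS]mulrA; apply: qz_mul_eq => m0.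
case: m m0 => // n _; rewrite !(subr0, addr0) (bsum_pow_even p0 p1) /p exprXz mulrA.
by rewrite -expfzDr //; congr (q ^ _ * _); ring.
Qed.

Lemma Wsum_122 : qpochoo q q * Wsum 1 2 2 = quint 5.
Proof.
(* The symbol (-q;p)_(m+1) in [weight_odd] calls for the shift m -> m - 1; the factor q then gives q
   q^((m-1)^2 + 2(m-1)) = q^(m^2). *)
pose W := q * Wsum 1 2 2.
apply: (mulfI q0); rewrite mulrCA -/W.
rewrite (bailey_eval (e := 0) (b := 1) (c := 0) (d := 1) (b' := 5) (c' := 1) (d' := 2) isT e0p).
  rewrite /quint mulrBr -!tsumZ; congr (_ - _); apply: eq_tsum => r.
    by rewrite -{2}(expr1z q) -expfzDr //; congr (_ ^ _); ring.
  by rewrite -{2}(expr1z q) -expfzDr //; congr (_ ^ _); ring.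
rewrite /W /Wsum -!tsumZ (tsum_shift _ (-1)); apply: eq_tsum => m; rewrite weight_odd subrK.
rewrite (_ : q * _ = qpochoo (- p) p * (qz (- q) p m *
  (q * q ^ ((m - 1) ^+ 2 + 2 * (m - 1)) * iq p (2 * (m - 1) + 1)))); last by ring.
congr (_ * _); rewrite -[RHS]mulrA; apply: qz_mul_eq => m0.
case: m m0 => // n _; rewrite ?addr0 (bsum_odd_lift p0 p1) -{1}(expr1z q).
by rewrite -expfzDr //; congr (q ^ _ * iq p _); ring.
Qed.

Lemma Wsum_011 : qpochoo q q * Wsum 0 1 1 = quint 2.
Proof.
rewrite (bailey_eval (e := 1) (b := -1) (c := 0) (d := 0) (b' := 5) (c' := 1) (d' := 0) isT e1p).
  rewrite tsum_flip.
  by congr (_ - _); apply: eq_tsum => r; congr (_ ^ _); ring.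
rewrite /Wsum -tsumZ; apply: eq_tsum => m; rewrite weight_even' mulrCA; congr (_ * _).
rewrite [LHS]mulrCA -[RHS]mulrA; apply: qz_mul_eq => m0.
by case: m m0 => // n _; rewrite -(bsum_even_lift p0 p1) !(subr0, addr0).
Qed.

Lemma Wsum_113 : qpochoo q q * Wsum 1 1 3 = quint 4.
Proof.
rewrite (bailey_eval (e := 1) (b := 1) (c := 0) (d := 0) (b' := 5) (c' := 1) (d' := 1) isT e1p).
  by congr (_ - _); apply: eq_tsum => r; congr (_ ^ _); ring.
rewrite /Wsum -tsumZ; apply: eq_tsum => m; rewrite weight_odd' mulrCA; congr (_ * _).
rewrite [LHS]mulrCA -[RHS]mulrA; apply: qz_mul_eq => m0.
case: m m0 => // n _; rewrite -(bsum_one_odd p0 p1) !(subr0, addr0).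
by rewrite (_ : n%:Z + 1 + 1%:Z = n%:Z + 2) //; ring.
Qed.

Lemma Wsum_133 : qpochoo q q * Wsum 1 3 3 = quint 6.
Proof.
rewrite (bailey_eval (e := 1) (b := 4) (c := 0) (d := 0) (b' := 4) (c' := 0) (d' := 1) isT e1p).
  congr (_ - _); first by apply: eq_tsum => r; congr (_ ^ _); ring.
  rewrite [LHS]tsum_flip [LHS](tsum_shift _ 1).
  by apply: eq_tsum => r; congr (_ ^ _); ring.
rewrite /Wsum -tsumZ; apply: eq_tsum => m; rewrite weight_odd' mulrCA; congr (_ * _).
rewrite [LHS]mulrCA -[RHS]mulrA; apply: qz_mul_eq => m0.
case: m m0 => // n _; rewrite !(subr0, addr0).
rewrite (_ : n%:Z + 1 + 1%:Z = n%:Z + 2); last by ring.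
rewrite (bsum_pow_odd p0 p1) /p exprXz mulrA.
by rewrite -expfzDr //; congr (q ^ _ * _); ring.
Qed.

End SingleSumEvaluations.

(** * The two reductions of the double sum *)

Lemma norm_mul_ge (a b c : int) : `|a| <= c -> - (c * `|b|) <= a * b.
Proof.
move=> h; have := ler_norm (- (a * b)); rewrite normrN normrM.
have : `|a| * `|b| <= c * `|b| by apply: ler_wpM2r.
lia.
Qed.

Section DoubleSum.
Context {R : realType} {C : normedC R}.
Context (q : C) (q0 : q != 0) (q1 : nm q < 1).

Definition dterm (al be : int) (x : int * int) : C :=
  iq q x.1 * iq (q ^+ 2) x.2
  * q ^ (x.1 ^+ 2 - 2 * x.1 * x.2 + 2 * x.2 ^+ 2 + al * x.1 + be * x.2).

Definition tht (x : C) (k : int) : C := tsum (fun m : int => x ^ (m ^+ 2 + k * m)).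

Let p0 : q ^+ 2 != 0. Proof. exact: expf_neq0. Qed.
Let p1 : nm (q ^+ 2) < 1. Proof. exact: nm_lt1X. Qed.

Lemma smb_dterm al be : `|al| <= 2 -> `|be| <= 2 -> smb (dterm al be).
Proof.
move=> hal hbe.
have [K1 K10 hK1] := iq_bd q1; have [K2 K20 hK2] := iq_bd p1.
apply: (smb_quad2 (E := fun x : int * int =>
  x.1 ^+ 2 - 2 * x.1 * x.2 + 2 * x.2 ^+ 2 + al * x.1 + be * x.2)
  (K := K1 * K2) (d := 100) q0 q1) => [x|[i j] _ /=].
  by rewrite nmM; apply: ler_pM; rewrite ?nm_ge0.
rewrite (_ : i ^+ 2 - 2 * i * j + 2 * j ^+ 2 = (i - j) ^+ 2 + j ^+ 2); last by ring.
have := norm_mul_ge i hal; have := norm_mul_ge j hbe.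
(* The linear part and |i| + |j| together are at most 3 |i| + 3 |j|, hence at most 3 |i - j| + 6
   |j|. *)
have := @quad_lin (i - j) 3 isT; have := @quad_lin j 6 isT; lia.
Qed.

Lemma smb_tht_gen k : smb (fun m : int => q ^ (m ^+ 2 + k * m)).
Proof.
apply: (eq_smb (F := fun m : int => 1 * q ^ (m ^+ 2 + k * m))); first by move=> m; rewrite mul1r.
apply: (smb_quad1 (E := fun m : int => m ^+ 2 + k * m) (K := 1)
  (d := (`|k| + 1) ^+ 2) q0 q1) => [m|m _]; first by rewrite nm1.
have k0 : 0 <= `|k| + 1 by lia.
have := quad_lin m k0; have := norm_mul_ge m (lexx `|k|); lia.
Qed.

(** The shift m -> m - j completes the square; only the parity of the linear coefficient
    survives. *)
Lemma tht_shift k j : tht q (k + 2 * j) = q ^ (- j ^+ 2 - k * j) * tht q k.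
Proof.
rewrite /tht (tsum_shift _ (- j)) -tsumZ; apply: eq_tsum => m.
by rewrite -expfzDr //; congr (_ ^ _); ring.
Qed.

Context (s : C) (s0 : s != 0) (s1 : nm s < 1) (sE : s ^+ 2 = q).

Let fterm (al be : int) (y : (int * int) * int) : C :=
  (-1) ^ y.2 * iq q y.2 * iq (q ^+ 2) y.1.2 * s ^ (y.2 ^+ 2 + y.2 + 2 * y.1.1 * y.2
    + 2 * (y.1.1 ^+ 2 - 2 * y.1.1 * y.1.2 + 2 * y.1.2 ^+ 2 + al * y.1.1 + be * y.1.2)).

(** The quadratic part in (i, j, n) is (n + i)^2 + (i - 2j)^2, which vanishes along (2, 1, -2). The
    reciprocals force n, j >= 0, and the decomposition used here has the then nonnegative cross term
    2 n j. *)
Let smb_fterm al be : `|al| <= 2 -> `|be| <= 2 -> smb (fterm al be).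
Proof.
move=> hal hbe.
have [K1 K10 hK1] := iq_bd q1; have [K2 K20 hK2] := iq_bd p1.
apply: (smb_quad3 (K := K1 * K2) (d := 200) s0 s1) => [x|[[i j] n] /=].
  rewrite !nmM nm_sg mul1r; apply: ler_pM; rewrite ?nm_ge0 //.
rewrite mulf_eq0 negb_or => /andP[+ /iq_neq0 j0].
rewrite mulf_eq0 negb_or => /andP[_ /iq_neq0 n0].
rewrite (_ : n ^+ 2 + n + 2 * i * n + _ = (n + (i - j)) ^+ 2 + (i - j) ^+ 2 + n
  + 2 * (n * j) + 2 * j ^+ 2 + 2 * (al * i) + 2 * (be * j)); last by ring.
have := norm_mul_ge i hal; have := norm_mul_ge j hbe.
have := @quad_lin (i - j) 5 isT; have := @quad_lin j 10 isT.
have := sqr_ge0 (n + (i - j)); have : 0 <= n * j by exact: mulr_ge0.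
have := sqr_ge0 j; lia.
Qed.

Let fser (al be n : int) : C := (-1) ^ n * s ^ (n ^+ 2 + n) * iq q n * tht q (n + al)
  * qpochoo (- q ^ (1 + n + al + be)) (q ^+ 2).

(** The substitution i = k + j separates the variables: k carries a theta series and j an Euler
    series in base q^2. *)
Let tsum_fterm al be n : tsum (fun x => fterm al be (x, n)) = fser al be n.
Proof.
pose x0 := q ^ (1 + n + al + be).
have hx : x0 != 0 by rewrite expfz_neq0.
rewrite (@tsum_bij _ _ _ _ _ (fun x : int * int => (x.1 + x.2, x.2)) (fun x => (x.1 - x.2, x.2)));
  try by case=> ? ? /=; rewrite ?addrK ?subrK.
rewrite /fser -(euler_qpochoo q0 q1 hx) -[RHS]mulrA /tht /euler.
rewrite -(tsum_prod (smb_tht_gen _) (smb_euler x0 q0 q1)) -tsumZ; apply: eq_tsum => -[k j] /=.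
rewrite /fterm /euler_term /= /x0 exprz_exp -sE !exprXz.
rewrite (_ : n ^+ 2 + n + 2 * (k + j) * n + _ = (n ^+ 2 + n) + 2%:Z * (k ^+ 2 + (n + al) * k)
  + 2%:Z * (j ^+ 2 - j) + 2%:Z * ((1 + n + al + be) * j)); last by ring.
by rewrite !(expfzDr _ _ s0); ring.
Qed.

Let first_series al be : `|al| <= 2 -> `|be| <= 2 ->
  qpochoo q q * tsum (dterm al be) = tsum (fser al be) /\ smb (fser al be).
Proof.
move=> hal hbe; have sF := smb_fterm hal hbe; split; last first.
  by apply: eq_smb (smb_tsum (smb_swap sF)) => n /=; exact: tsum_fterm.
rewrite -(eq_tsum (tsum_fterm al be)) -(tsum_pair2 sF) (tsum_pair sF) -tsumZ.
apply: eq_tsum => -[i j]; rewrite /dterm /=.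
transitivity (iq (q ^+ 2) j * q ^ (i ^+ 2 - 2 * i * j + 2 * j ^+ 2 + al * i + be * j)
  * (qpochoo q q * iq q i)); first by ring.
have := tsum_iq i s0 s1; rewrite sE => <-; rewrite -tsumZ; apply: eq_tsum => n.
rewrite /fterm /= [in RHS]expfzDr // -[in RHS]exprXz sE.
by ring.
Qed.

Let qs k : q ^ k = s ^ (2%:Z * k).
Proof. by rewrite -sE exprXz. Qed.

Lemma first_form al be : `|al| <= 2 -> `|be| <= 2 ->
  qpochoo q q * tsum (dterm al be) =
  tsum (fun m : int => q ^ (2 * m ^+ 2 + m) * tht q (al + 2 * m)
    * (iq q (2 * m + 0) * qpochoo (- q ^ (2 * m + (1 + al + be))) (q ^+ 2)))
  - q * tsum (fun m : int => q ^ (2 * m ^+ 2 + 3 * m) * tht q (1 + al + 2 * m)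
    * (iq q (2 * m + 1) * qpochoo (- q ^ (2 * m + (2 + al + be))) (q ^+ 2))).
Proof.
move=> hal hbe; have [-> sf] := first_series hal hbe.
rewrite (tsum_even_odd sf) -mulNr -tsumZ; congr (_ + _); apply: eq_tsum => m; rewrite /fser.
  rewrite sg_double mul1r [q ^ (2 * m ^+ 2 + m)]qs.
  rewrite (_ : (2 * m) ^+ 2 + 2 * m = 2%:Z * (2 * m ^+ 2 + m)); last by ring.
  rewrite addr0 (_ : 2 * m + al = al + 2 * m); last by ring.
  rewrite (_ : 1 + 2 * m + al + be = 2 * m + (1 + al + be)); last by ring.
  by ring.
rewrite sg_add sg_double expr1z mul1r [q ^ (2 * m ^+ 2 + 3 * m)]qs.
rewrite (_ : (2 * m + 1) ^+ 2 + (2 * m + 1) = 2%:Z * (2 * m ^+ 2 + 3 * m) + 2%:Z); last by ring.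
rewrite [s ^ (_ + 2%:Z)]expfzDr // -[s ^ 2%:Z]exprnP sE.
rewrite (_ : 2 * m + 1 + al = 1 + al + 2 * m); last by ring.
rewrite (_ : 1 + (2 * m + 1) + al + be = 2 * m + (2 + al + be)); last by ring.
by ring.
Qed.

Lemma first_form_term (A B D T X : C) : A * B = D -> A * (B * T) * X = T * (D * X).
Proof. by move=> <-; ring. Qed.

Lemma first_form_00 : qpochoo q q * tsum (dterm 0 0) =
  tht q 0 * Wsum q 0 1 1 - q * (tht q 1 * Wsum q 1 2 2).
Proof.
rewrite first_form //; congr (_ - q * _); rewrite -tsumZ; apply: eq_tsum => m.
  rewrite tht_shift; apply: first_form_term.
  by rewrite -expfzDr //; congr (_ ^ _); ring.
rewrite (_ : 1 + 0 + 2 * m = 1 + 2 * m) // tht_shift; apply: first_form_term.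
by rewrite -expfzDr //; congr (_ ^ _); ring.
Qed.

Lemma tht_opp1 : tht q (-1) = tht q 1.
Proof.
rewrite -[LHS]/(tht q (1 + 2 * (-1))) tht_shift.
by rewrite -[q ^ _]/(q ^ 0) expr0z mul1r.
Qed.

Lemma first_form_m12 : qpochoo q q * tsum (dterm (-1) 2) =
  tht q 1 * Wsum q 0 2 2 - q * (tht q 0 * Wsum q 1 3 3).
Proof.
rewrite first_form //; congr (_ - q * _); rewrite -tsumZ; apply: eq_tsum => m.
  rewrite tht_shift tht_opp1; apply: first_form_term.
  by rewrite -expfzDr //; congr (_ ^ _); ring.
rewrite (_ : 1 + -1 + 2 * m = 0 + 2 * m) // tht_shift; apply: first_form_term.
by rewrite -expfzDr //; congr (_ ^ _); ring.
Qed.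

Lemma first_form_10 : qpochoo q q * tsum (dterm 1 0) =
  tht q 1 * Wsum q 0 0 2 - tht q 0 * Wsum q 1 1 3.
Proof.
rewrite first_form // -!tsumZ; congr (_ - _); apply: eq_tsum => m.
  rewrite tht_shift; apply: first_form_term.
  by rewrite -expfzDr //; congr (_ ^ _); ring.
(* The theta index is even here, so the shift is by m + 1 and absorbs the factor q in front: 1 + 2
   m^2 + 3 m - (m + 1)^2 = m^2 + m. *)
rewrite (_ : 1 + 1 + 2 * m = 0 + 2 * (m + 1)); last by ring.
rewrite tht_shift [LHS]mulrA [q * (_ * _)]mulrA; apply: first_form_term.
by rewrite -{1}[q]expr1z -!expfzDr //; congr (_ ^ _); ring.
Qed.

End DoubleSum.

(** * Reduction to single sums in base q^2 *)

Section SecondForm.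
Context {R : realType} {C : normedC R}.
Context (q : C) (q0 : q != 0) (q1 : nm q < 1).

Let p := q ^+ 2.
Let p0 : p != 0. Proof. exact: expf_neq0. Qed.
Let p1 : nm p < 1. Proof. exact: nm_lt1X. Qed.
Let pp1 : nm (p ^+ 2) < 1. Proof. exact: nm_lt1X. Qed.

Lemma smb_conv2 (x y : C) (g : int -> C) (N : int) (k : nat) : (0 < k)%N ->
  smb (fun n => g n * (iq x (N - k%:Z * n) * iq y n)).
Proof.
move=> k0; apply: (smb_fin (D := [fset Posz j | j in iota 0 `|N|.+1]%fset)) => n.
have [n0|n0 _] := lerP 0 n; last by rewrite [iq y n]iq_lt0 // !mulr0.
have [nN|nN _] := lerP (k%:Z * n) N; last first.
  by rewrite [iq x _]iq_lt0 ?mul0r ?mulr0 //; lia.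
move=> /negP []; apply/imfsetP; exists `|n|%N => /=; last by lia.
suff: `|n|%N \in iota 0 `|N|.+1 by [].
by rewrite mem_iota; nia.
Qed.

(* [cc e] and [dd e] are the Taylor coefficients of [1 / ((z; q)_oo (- q^e z; q^2)_oo)] and
   of [1 / ((q^(1-e) z; q^2)_oo (q^(2e) z^2; q^4)_oo)], two expressions of one function when
   [e] is 0 or 1. *)
Definition cc (e N : int) : C :=
  tsum (fun m : int => (-1) ^ m * q ^ (e * m) * (iq q (N - m) * iq p m)).

Definition dd (e N : int) : C :=
  tsum (fun b : int => q ^ ((1 - e) * (N - 2 * b) + 2 * e * b)
    * (iq p (N - 2 * b) * iq (p ^+ 2) b)).

Lemma smb_cc e N : smb (fun m : int => (-1) ^ m * q ^ (e * m) * (iq q (N - m) * iq p m)).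
Proof.
have := @smb_conv2 q p (fun m => (-1) ^ m * q ^ (e * m)) N 1 isT.
by apply: eq_smb => m; rewrite mul1r.
Qed.

Lemma smb_dd e N : smb (fun b : int => q ^ ((1 - e) * (N - 2 * b) + 2 * e * b)
    * (iq p (N - 2 * b) * iq (p ^+ 2) b)).
Proof. exact: (@smb_conv2 p (p ^+ 2) _ N 2). Qed.

(** For f(z) = 1 / (z;q)_oo this is f(q^2 z) = (1 - z)(1 - q z) f(z), read on coefficients. *)
Lemma iq_rec2 (k : int) : (1 - p ^ k) * iq q k = (1 + q) * iq q (k - 1) - q * iq q (k - 2).
Proof.
have -> : k - 2 = k - 1 - 1 by ring.
rewrite -(iq_rec (k - 1)) // -iq_rec // /p exprXz.
have -> : q ^ (2%:Z * k) = q ^ (k - 1) * q ^ (k - 1) * q ^ 2.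
  by rewrite -!expfzDr //; congr (_ ^ _); ring.
have -> : q ^ k = q ^ (k - 1) * q by rewrite -{3}[q]expr1z -expfzDr // subrK.
by rewrite -[q ^ 2]exprnP; ring.
Qed.

Lemma lin3 (a b c : int -> C) (x y z : C) : smb a -> smb b -> smb c ->
  smb (fun m => x * a m + y * b m + z * c m) /\
  tsum (fun m => x * a m + y * b m + z * c m) = x * tsum a + y * tsum b + z * tsum c.
Proof.
move=> sa sb sc; have h := smbD (smbZ x sa) (smbZ y sb).
split; first by apply: smbD => //; exact: smbZ.
by rewrite tsumD ?tsumD ?tsumZ //; exact: smbZ.
Qed.

Lemma smb_unshift (g : int -> C) (k : int) : smb (fun m => g (m + k)) -> smb g.
Proof.
move=> h; apply: (eq_smb _ (smb_inj (g := fun m : int => m - k) _ h)) => [m|i j].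
  by rewrite subrK.
by move=> e; lia.
Qed.

(** The coefficient form of F(q^2 z) = (1 - z)(1 - q z)(1 + q^e z) F(z). *)
Lemma cc_rec e N : (1 - p ^ N) * cc e N =
  (1 + q - q ^ e) * cc e (N - 1) + (q ^ e * (1 + q) - q) * cc e (N - 2)
  - q ^ e * q * cc e (N - 3).
Proof.
pose V (m : int) : C := (-1) ^ m * q ^ (e * m).
pose a (k m : int) := V m * (iq q (N - k - m) * iq p m).
have sa k : smb (a k) by exact: smb_cc.
have aE k : cc e (N - k) = tsum (a k) by [].
pose g (m : int) := V m * iq p (m - 1) * (iq q (N - m) - ((1 + q) * iq q (N - m - 1)
   - q * iq q (N - m - 2))).
have gE m : g (m + 1) = - q ^ e * a 1 m + q ^ e * (1 + q) * a 2 m + - (q ^ e * q) * a 3 m.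
  rewrite /g /a addrK (_ : N - (m + 1) = N - 1 - m); last by ring.
  rewrite (_ : N - 1 - m - 1 = N - 2 - m); last by ring.
  rewrite (_ : N - 1 - m - 2 = N - 3 - m); last by ring.
  have -> : V (m + 1) = - q ^ e * V m.
    by rewrite /V sg_add expr1z mulrDr mulr1 expfzDr //; ring.
  by ring.
have [sg1 tg1] := lin3 (- q ^ e) (q ^ e * (1 + q)) (- (q ^ e * q)) (sa 1) (sa 2) (sa 3).
have sg : smb g by apply: (@smb_unshift _ 1); apply: eq_smb sg1 => m; rewrite gE.
have [s1 t1] := lin3 (1 + q) (- q) 0 (sa 1) (sa 2) (sa 3).
transitivity (tsum (fun m => (1 + q) * a 1 m + - q * a 2 m + 0 * a 3 m) + tsum g).
  rewrite -tsumD // /cc -tsumZ; apply: eq_tsum => m.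
  have h : p ^ (N - m) * iq q (N - m) = iq q (N - m) - ((1 + q) * iq q (N - m - 1)
     - q * iq q (N - m - 2)) by rewrite -iq_rec2; ring.
  rewrite /g -h /a -(iq_rec m p1).
  rewrite (_ : N - 1 - m = N - m - 1); last by ring.
  rewrite (_ : N - 2 - m = N - m - 2); last by ring.
  have e1 : p ^ N = p ^ (N - m) * p ^ m by rewrite -expfzDr // subrK.
  transitivity (V m * iq p m * ((1 - p ^ (N - m)) * iq q (N - m))
    + V m * ((1 - p ^ m) * iq p m) * (p ^ (N - m) * iq q (N - m))).
    by rewrite e1 /V; ring.
  by rewrite iq_rec2; ring.
rewrite (tsum_shift g 1) (eq_tsum gE) t1 tg1 -!aE; ring.
Qed.

(** The coefficient form of F(q^2 z) = (1 - q^(1-e) z)(1 - q^(2e) z^2) F(z). *)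
Lemma dd_rec e N : (1 - p ^ N) * dd e N =
  q ^ (1 - e) * dd e (N - 1) + q ^ (2 * e) * dd e (N - 2)
  - q ^ (2 * e) * q ^ (1 - e) * dd e (N - 3).
Proof.
pose U (k : int) : C := q ^ ((1 - e) * k) * iq p k.
pose W (b : int) : C := q ^ (2 * e * b) * iq (p ^+ 2) b.
pose a (k b : int) := U (N - k - 2 * b) * W b.
have aE k : dd e (N - k) = tsum (a k).
  by apply: eq_tsum => b; rewrite expfzDr // /a /U /W; ring.
have sa k : smb (a k).
  apply: eq_smb (smb_dd e (N - k)) => b.
  by rewrite expfzDr // /a /U /W; ring.
have UE k : (1 - p ^ k) * U k = q ^ (1 - e) * U (k - 1).
  by rewrite /U mulrCA iq_rec // [RHS]mulrA -expfzDr //; congr (q ^ _ * _); ring.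
have WE b : (1 - (p ^+ 2) ^ b) * W b = q ^ (2 * e) * W (b - 1).
  by rewrite /W mulrCA iq_rec // [RHS]mulrA -expfzDr //; congr (q ^ _ * _); ring.
pose g (b : int) := q ^ (2 * e) * W (b - 1) *
  (U (N - 2 * b) - q ^ (1 - e) * U (N - 2 * b - 1)).
have gE b : g (b + 1) = 0 * a 1 b + q ^ (2 * e) * a 2 b
    + - (q ^ (2 * e) * q ^ (1 - e)) * a 3 b.
  rewrite /g /a addrK (_ : N - 2 * (b + 1) = N - 2 - 2 * b); last by ring.
  rewrite (_ : N - 2 - 2 * b - 1 = N - 3 - 2 * b); last by ring.
  by ring.
have [sg1 tg1] := lin3 0 (q ^ (2 * e)) (- (q ^ (2 * e) * q ^ (1 - e))) (sa 1) (sa 2) (sa 3).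
have sg : smb g by apply: (@smb_unshift _ 1); apply: eq_smb sg1 => m; rewrite gE.
transitivity (q ^ (1 - e) * tsum (a 1) + tsum g).
  rewrite -[N in dd e N]subr0 aE -!tsumZ -tsumD //; last exact: smbZ.
  apply: eq_tsum => b; rewrite /g -WE -UE /a subr0.
  rewrite (_ : N - 1 - 2 * b = N - 2 * b - 1); last by ring.
  have e1 : p ^ N = p ^ (N - 2 * b) * (p ^+ 2) ^ b.
    by rewrite [(p ^+ 2) ^ b]exprXz -expfzDr //; congr (_ ^ _); ring.
  transitivity ((1 - p ^ (N - 2 * b)) * U (N - 2 * b) * W b
    + p ^ (N - 2 * b) * U (N - 2 * b) * ((1 - (p ^+ 2) ^ b) * W b)).
    by rewrite e1; ring.
  by rewrite [q ^ (1 - e) * (_ * W b)]mulrA -UE; ring.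
by rewrite (tsum_shift g 1) (eq_tsum gE) tg1 -!aE; ring.
Qed.

Lemma cc_lt0 e N : N < 0 -> cc e N = 0.
Proof.
move=> N0; rewrite /cc (@eq_tsum _ _ _ _ (fun=> 0)) ?tsum0 // => m.
have [h|h] := ltrP m 0; first by rewrite [iq p m]iq_lt0 ?mulr0.
by rewrite iq_lt0 ?mul0r ?mulr0 //; lia.
Qed.

Lemma dd_lt0 e N : N < 0 -> dd e N = 0.
Proof.
move=> N0; rewrite /dd (@eq_tsum _ _ _ _ (fun=> 0)) ?tsum0 // => m.
have [h|h] := ltrP m 0; first by rewrite [iq (p ^+ 2) m]iq_lt0 ?mulr0.
by rewrite iq_lt0 ?mul0r ?mulr0 //; lia.
Qed.

Lemma cc0 e : cc e 0 = 1.
Proof.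
rewrite /cc (@tsum_single _ _ _ _ 0); first by rewrite subr0 mulr0 !expr0z !iq0 !mulr1.
move=> m m0; have [h|h] := ltrP m 0; first by rewrite [iq p m]iq_lt0 ?mulr0.
by rewrite iq_lt0 ?mul0r ?mulr0 //; move/eqP: m0; lia.
Qed.

Lemma dd0 e : dd e 0 = 1.
Proof.
rewrite /dd (@tsum_single _ _ _ _ 0); first by rewrite mulr0 subr0 !mulr0 addr0 expr0z !iq0 !mulr1.
move=> m m0; have [h|h] := ltrP m 0; first by rewrite [iq (p ^+ 2) m]iq_lt0 ?mulr0.
by rewrite iq_lt0 ?mul0r ?mulr0 //; move/eqP: m0; lia.
Qed.

(** For e = 0 and e = 1 the cubics behind [cc_rec] and [dd_rec] coincide, and 1 - p^N is nonzero for
    N > 0, so the recursion and the value 1 at N = 0 determine the coefficients. *)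
Lemma cc_dd e N : e = 0 \/ e = 1 -> cc e N = dd e N.
Proof.
move=> he; have [N0|N0] := ltrP N 0; first by rewrite cc_lt0 ?dd_lt0.
rewrite -[N]gez0_abs //; move: `|N|%N => n {N N0}.
elim/ltn_ind: n => -[|n] IH; first by rewrite cc0 dd0.
have h (k : int) : 0 < k -> cc e (n.+1%:Z - k) = dd e (n.+1%:Z - k).
  move=> k0; have [lt0|ge0] := ltrP (n.+1%:Z - k) 0; first by rewrite cc_lt0 ?dd_lt0.
  by rewrite -[n.+1%:Z - k]gez0_abs //; apply: IH; lia.
apply: (mulfI (one_subX_neq0 p1 n)); rewrite cc_rec dd_rec !h //.
by case: he => ->; rewrite ?subr0 ?subrr ?mulr0 ?mulr1 ?expr0z ?expr1z -?exprnP; ring.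
Qed.

Let sterm (al be : int) (y : (int * int) * int) : C :=
  (-1) ^ y.2 * (iq q (y.1.1 - y.2) * iq p y.2)
  * q ^ (y.2 + y.1.2 ^+ 2 + (y.1.1 - y.1.2) ^+ 2 + al * (y.1.1 - y.2) + be * (y.1.2 - y.2)).

(** The quadratic part t^2 + (N - t)^2 does not see m; nonvanishing reciprocals confine m to 0 <= m
    <= N. *)
Let smb_sterm al be : `|al| <= 2 -> `|be| <= 2 -> smb (sterm al be).
Proof.
move=> hal hbe.
have [K1 K10 hK1] := iq_bd q1; have [K2 K20 hK2] := iq_bd p1.
apply: (smb_quad3 (K := K1 * K2) (d := 500) q0 q1) => [x|[[N t] m] /=].
  by rewrite nmM nm_sg mul1r nmM; apply: ler_pM; rewrite ?nm_ge0.
rewrite mulf_eq0 negb_or => /andP[_].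
rewrite mulf_eq0 negb_or => /andP[/iq_neq0 h1 /iq_neq0 m0].
have := norm_mul_ge (N - m) hal; have := norm_mul_ge (t - m) hbe.
have := @quad_lin t 15 isT; have := @quad_lin (N - t) 15 isT; lia.
Qed.

Let tht2 (be N : int) : C := tsum (fun t : int => q ^ (t ^+ 2 + (N - t) ^+ 2 + be * t)).

(** With N = i + m and t = j + m the exponent (i - j)^2 + (j + m)^2 + m becomes (N - t)^2 + t^2 + m.
    Only linear terms in m remain, so its sum is a coefficient [cc] with e = 1 - al - be. *)
Let second_series al be : `|al| <= 2 -> `|be| <= 2 ->
  qpochoo p p * tsum (dterm q al be)
    = tsum (fun N => q ^ (al * N) * tht2 be N * cc (1 - al - be) N)
  /\ smb (fun N => q ^ (al * N) * tht2 be N * cc (1 - al - be) N).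
Proof.
move=> hal hbe; have sS := smb_sterm hal hbe.
pose g (x : (int * int) * int) := ((x.1.1 + x.2, x.1.2 + x.2), x.2).
pose h (x : (int * int) * int) := ((x.1.1 - x.2, x.1.2 - x.2), x.2).
have gK : cancel g h by move=> [[i j] m]; rewrite /g /h /= !addrK.
have hK : cancel h g by move=> [[i j] m]; rewrite /g /h /= !subrK.
have sO := smb_inj (can_inj gK) sS.
have rowE N : tsum (fun t => tsum (fun m => sterm al be (N, t, m)))
    = q ^ (al * N) * tht2 be N * cc (1 - al - be) N.
  rewrite (_ : q ^ (al * N) * tht2 be N * cc (1 - al - be) N =
    (q ^ (al * N) * cc (1 - al - be) N) * tht2 be N); last by ring.
  rewrite /tht2 -tsumZ; apply: eq_tsum => t.
  rewrite mulrAC /cc -tsumZ; apply: eq_tsum => m; rewrite /sterm /=.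
  rewrite (_ : m + t ^+ 2 + _ + _ + _ = (t ^+ 2 + (N - t) ^+ 2 + be * t) + al * N
    + (1 - al - be) * m); last by ring.
  by rewrite [q ^ (_ + (1 - al - be) * m)]expfzDr // [q ^ (_ + al * N)]expfzDr //; ring.
split; last first.
  by apply: eq_smb (smb_tsum (smb_tsum sS)) => N /=; exact: rowE.
rewrite -(eq_tsum rowE) -(tsum_pair (smb_tsum sS)) -(tsum_pair sS) (tsum_bij _ gK hK).
rewrite (tsum_pair sO) -tsumZ; apply: eq_tsum => -[i j]; rewrite /dterm /=.
transitivity (iq q i * q ^ (i ^+ 2 - 2 * i * j + 2 * j ^+ 2 + al * i + be * j)
  * (qpochoo p p * iq p j)); first by rewrite /p; ring.
rewrite -(tsum_iq j q0 q1) -tsumZ; apply: eq_tsum => m; rewrite /sterm /= !addrK -/p.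
rewrite (_ : m + (j + m) ^+ 2 + _ + _ + _ = (i ^+ 2 - 2 * i * j + 2 * j ^+ 2 + al * i + be * j)
   + (m ^+ 2 + m + 2 * j * m)); last by ring.
by rewrite [in RHS]expfzDr //; ring.
Qed.

(** Setting n = c + b frees one reciprocal from b, and the sum over b becomes Euler's series at
    p^(2c+1+k+e). *)
Lemma Wsum_double (d k e : int) : `|d| <= 1 -> `|k| <= 4 -> `|e| <= 4 ->
  tsum (fun n : int => p ^ (n ^+ 2 + k * n) * tsum (fun b : int =>
    p ^ (e * b) * (iq p (2 * n + d - 2 * b) * iq (p ^+ 2) b))) = Wsum p d k (1 + k + e).
Proof.
move=> hd hk he.
pose F (y : int * int) : C := iq p (2 * y.1 + d - 2 * y.2) * iq (p ^+ 2) y.2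
  * p ^ (y.1 ^+ 2 + k * y.1 + e * y.2).
have sF : smb F.
  have [K1 K10 hK1] := iq_bd p1; have [K2 K20 hK2] := iq_bd pp1.
  apply: (smb_quad2 (E := fun y : int * int => y.1 ^+ 2 + k * y.1 + e * y.2)
    (K := K1 * K2) (d := 200) p0 p1) => [y|[n b] /=].
    by rewrite nmM; apply: ler_pM; rewrite ?nm_ge0.
  rewrite mulf_eq0 negb_or => /andP[/iq_neq0 h1 /iq_neq0 h2].
  have := norm_mul_ge n hk; have := norm_mul_ge b he.
  have := @quad_lin n 10 isT; lia.
have e1 : tsum (fun n => tsum (fun b => F (n, b))) = tsum (fun n : int => p ^ (n ^+ 2 + k * n)
    * tsum (fun b : int => p ^ (e * b) * (iq p (2 * n + d - 2 * b) * iq (p ^+ 2) b))).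
  apply: eq_tsum => n; rewrite -tsumZ; apply: eq_tsum => b.
  by rewrite /F /= expfzDr //; ring.
pose g (y : int * int) := (y.1 + y.2, y.2).
pose h (y : int * int) := (y.1 - y.2, y.2).
have gK : cancel g h by move=> [i j]; rewrite /g /h /= addrK.
have hK : cancel h g by move=> [i j]; rewrite /g /h /= subrK.
rewrite -e1 -(tsum_pair sF) (tsum_bij _ gK hK) (tsum_pair (smb_inj (can_inj gK) sF)) /=.
apply: eq_tsum => c; set x := p ^ (2 * c + (1 + k + e)).
have x0 : x != 0 by rewrite expfz_neq0.
rewrite -(euler_qpochoo p0 p1 x0) mulrA -tsumZ; apply: eq_tsum => b.
rewrite /F /g /euler_term /= /x exprz_exp.
rewrite (_ : 2 * (c + b) + d - 2 * b = 2 * c + d); last by ring.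
rewrite (_ : (c + b) ^+ 2 + k * (c + b) + e * b = (c ^+ 2 + k * c) + (b ^+ 2 - b)
  + (2 * c + (1 + k + e)) * b); last by ring.
by rewrite [in LHS]expfzDr // [in LHS]expfzDr //; ring.
Qed.

Let ps (k : int) : p ^ k = q ^ (2%:Z * k).
Proof. by rewrite /p exprXz. Qed.

Let inner (d e n : int) : C := tsum (fun b : int =>
    p ^ (e * b) * (iq p (2 * n + d - 2 * b) * iq (p ^+ 2) b)).

Let dd_even e n : dd e (2 * n) = p ^ ((1 - e) * n) * inner 0 (2 * e - 1) n.
Proof.
rewrite /dd /inner -tsumZ; apply: eq_tsum => b; rewrite addr0 [RHS]mulrA; congr (_ * _).
by rewrite !ps -expfzDr //; congr (_ ^ _); ring.
Qed.

Let dd_odd e n : dd e (2 * n + 1) = q ^ (1 - e) * p ^ ((1 - e) * n) * inner 1 (2 * e - 1) n.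
Proof.
rewrite /dd /inner -tsumZ; apply: eq_tsum => b; rewrite [RHS]mulrA; congr (_ * _).
by rewrite !ps -!expfzDr //; congr (_ ^ _); ring.
Qed.

(** Centring t at n turns t^2 + (2n - t)^2 into 2 t^2 + 2 n^2, a theta exponent in base p. The
    parity of N and the value of be decide which theta occurs in the four variants. *)
Let tht2_even0 n : tht2 0 (2 * n) = p ^ (n ^+ 2) * tht p 0.
Proof.
rewrite /tht2 /tht (tsum_shift _ n) -tsumZ; apply: eq_tsum => t.
by rewrite !ps -expfzDr //; congr (_ ^ _); ring.
Qed.

Let tht2_odd0 n : tht2 0 (2 * n + 1) = q * p ^ (n ^+ 2 + n) * tht p 1.
Proof.
rewrite /tht2 /tht [tsum (fun m => p ^ _)]tsum_flip (tsum_shift _ n) -tsumZ.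
apply: eq_tsum => t.
by rewrite !ps -{2}[q]expr1z -!expfzDr //; congr (_ ^ _); ring.
Qed.

Let tht2_even2 n : tht2 2 (2 * n) = p ^ (n ^+ 2 + n) * tht p 1.
Proof.
rewrite /tht2 /tht (tsum_shift _ n) -tsumZ; apply: eq_tsum => t.
by rewrite !ps -expfzDr //; congr (_ ^ _); ring.
Qed.

Let tht2_odd2 n : tht2 2 (2 * n + 1) = q * p ^ (n ^+ 2 + 2 * n) * tht p 0.
Proof.
rewrite /tht2 /tht (tsum_shift _ n) -tsumZ; apply: eq_tsum => t.
by rewrite !ps -{2}[q]expr1z -!expfzDr //; congr (_ ^ _); ring.
Qed.

Let second_split al be e : `|al| <= 2 -> `|be| <= 2 -> e = 1 - al - be ->
    e = 0 \/ e = 1 ->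
  qpochoo p p * tsum (dterm q al be) =
  tsum (fun n : int => q ^ (al * (2 * n)) * tht2 be (2 * n)
    * (p ^ ((1 - e) * n) * inner 0 (2 * e - 1) n))
  + tsum (fun n : int => q ^ (al * (2 * n + 1)) * tht2 be (2 * n + 1)
    * (q ^ (1 - e) * p ^ ((1 - e) * n) * inner 1 (2 * e - 1) n)).
Proof.
move=> hal hbe eE he; have [-> sf] := second_series hal hbe; rewrite -eE in sf *.
rewrite (tsum_even_odd sf); congr (_ + _); apply: eq_tsum => n.
  by rewrite (cc_dd _ he) dd_even.
by rewrite (cc_dd _ he) dd_odd.
Qed.

Let Wsum_inner d k e mu : `|d| <= 1 -> `|k| <= 4 -> `|e| <= 4 -> mu = 1 + k + e ->
  Wsum p d k mu = tsum (fun n : int => p ^ (n ^+ 2 + k * n) * inner d e n).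
Proof. by move=> hd hk he ->; rewrite -Wsum_double. Qed.

Let regroup_even (a b c d : int) (T X : C) : a + 2 * b + 2 * c = 2 * d ->
  q ^ a * (p ^ b * T) * (p ^ c * X) = T * (p ^ d * X).
Proof.
move=> h; have e : q ^ a * p ^ b * p ^ c = p ^ d.
  by rewrite !ps -!expfzDr //; congr (_ ^ _).
by rewrite -e; ring.
Qed.

Let regroup_odd (a b c k d j : int) (T X : C) : a + 2 * b + c + 2 * k = 2 * d + j ->
  q ^ a * (q * p ^ b * T) * (q ^ c * p ^ k * X) = q ^ (1 + j) * T * (p ^ d * X).
Proof.
move=> h; have e : q ^ a * p ^ b * q ^ c * p ^ k = p ^ d * q ^ j.
  by rewrite !ps -!expfzDr //; congr (_ ^ _).
transitivity (q * (q ^ a * p ^ b * q ^ c * p ^ k) * (T * X)); first by ring.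
by rewrite e expfzDr // expr1z; ring.
Qed.

Lemma second_form_00 : qpochoo p p * tsum (dterm q 0 0) =
  tht p 0 * Wsum p 0 0 2 + q * (tht p 1 * Wsum p 1 1 3).
Proof.
rewrite (@second_split 0 0 1) //; last by right.
rewrite (@Wsum_inner 0 0 1) // (@Wsum_inner 1 1 1) // mulrA.
rewrite -(tsumZ _ (tht p 0)) -(tsumZ _ (q * tht p 1)).
congr (_ + _); apply: eq_tsum => n.
  by rewrite tht2_even0; apply: regroup_even; ring.
by rewrite tht2_odd0 (@regroup_odd _ _ _ _ (n ^+ 2 + 1 * n) 0) ?addr0 ?expr1z //; ring.
Qed.

Lemma second_form_m12 : qpochoo p p * tsum (dterm q (-1) 2) =
  tht p 1 * Wsum p 0 1 1 + q * (tht p 0 * Wsum p 1 2 2).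
Proof.
rewrite (@second_split (-1) 2 0) //; last by left.
rewrite (@Wsum_inner 0 1 (-1)) // (@Wsum_inner 1 2 (-1)) // mulrA.
rewrite -(tsumZ _ (tht p 1)) -(tsumZ _ (q * tht p 0)).
congr (_ + _); apply: eq_tsum => n.
  by rewrite tht2_even2; apply: regroup_even; ring.
by rewrite tht2_odd2 (@regroup_odd _ _ _ _ (n ^+ 2 + 2 * n) 0) ?addr0 ?expr1z //; ring.
Qed.

Lemma second_form_10 : qpochoo p p * tsum (dterm q 1 0) =
  tht p 0 * Wsum p 0 2 2 + q ^+ 3 * (tht p 1 * Wsum p 1 3 3).
Proof.
rewrite (@second_split 1 0 0) //; last by left.
rewrite (@Wsum_inner 0 2 (-1)) // (@Wsum_inner 1 3 (-1)) // mulrA -(tsumZ _ (tht p 0)).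
rewrite -(tsumZ _ (q ^+ 3 * tht p 1)).
congr (_ + _); apply: eq_tsum => n.
  by rewrite tht2_even0; apply: regroup_even; ring.
(* The cube of q collects one factor each from q^(2n+1), from the odd theta and from q^(1-e) with e
   = 0. *)
by rewrite tht2_odd0 (@regroup_odd _ _ _ _ (n ^+ 2 + 3 * n) 2) //; ring.
Qed.

End SecondForm.

(** * Product forms *)

Section Products.
Context {R : realType} {C : normedC R}.
Context (x : C) (x0 : x != 0) (x1 : nm x < 1).

Definition qq (a m : nat) : C := qpochoo (x ^+ a) (x ^+ m).

Lemma qq_neq0 a m : (0 < a)%N -> (0 < m)%N -> qq a m != 0.
Proof.
by move=> a0 m0; apply: qpochoo_neq0_lt1; rewrite ?expf_neq0 ?nm_lt1X.
Qed.

Lemma qq_mod n a m : (0 < n)%N -> (0 < a)%N -> (0 < m)%N ->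
  qq a m = \prod_(k < n) qq (a + m * k) (m * n).
Proof.
move=> n0 a0 m0; rewrite /qq (qpochoo_mod n0) ?expf_neq0 ?nm_lt1X //.
by apply: eq_bigr => k _; rewrite -!exprM -exprD.
Qed.

Lemma JE m : J x m = qq m m.
Proof. by []. Qed.

Lemma JtE a m : (a <= m)%N -> Jt x a m = qq a m * qq (m - a) m * qq m m.
Proof. by move=> am; rewrite /Jt /qq subzn. Qed.

Lemma J_neq0 m : (0 < m)%N -> J x m != 0.
Proof. by move=> m0; rewrite JE qq_neq0. Qed.

Lemma Jt_neq0 a m : (0 < a < m)%N -> Jt x a m != 0.
Proof.
move=> /andP[a0 am]; rewrite JtE ?(ltnW am) //.
by rewrite !mulf_neq0 ?qq_neq0 ?subn_gt0 // (leq_trans _ am).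
Qed.

Lemma Jt_split a m : (0 < a < m)%N ->
  Jt x a m * J x (2 * m) ^+ 2 = J x m * Jt x a (2 * m) * Jt x (m - a) (2 * m).
Proof.
move=> /andP[a0 am]; rewrite !JtE ?JE; try lia.
rewrite (qq_mod (n := 2) (a := a) (m := m)) ?(qq_mod (n := 2) (a := m - a) (m := m)); try lia.
rewrite !big_ord_recr !big_ord0 /= !mul1r !muln0 !addn0 !muln1.
rewrite (_ : 2 * m - a = m - a + m)%N; last by lia.
rewrite (_ : 2 * m - (m - a) = a + m)%N; last by lia.
by rewrite [(m * 2)%N]mulnC; ring.
Qed.

(** Every product in [J_prod1] to [J_prod6] factors into these residue-class products, and the
    identities become equalities of monomials. *)
Let e (k : nat) := qq k 14.

Let J1E : J x 1 = e 1 * e 2 * e 3 * e 4 * e 5 * e 6 * e 7 * e 8 * e 9 * e 10 * e 11 * e 12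
  * e 13 * e 14.
Proof. by rewrite JE (qq_mod (n := 14)) // !big_ord_recr big_ord0 /= mul1r. Qed.

Let J2E : J x 2 = e 2 * e 4 * e 6 * e 8 * e 10 * e 12 * e 14.
Proof. by rewrite JE (qq_mod (n := 7)) // !big_ord_recr big_ord0 /= mul1r. Qed.

Let J7E : J x 7 = e 7 * e 14.
Proof. by rewrite JE (qq_mod (n := 2)) // !big_ord_recr big_ord0 /= mul1r. Qed.

Let J14E : J x 14 = e 14.
Proof. by []. Qed.

Let Jt14E a : (a <= 14)%N -> Jt x a 14 = e a * e (14 - a) * e 14.
Proof. exact: JtE. Qed.

Let Jt7E a : (0 < a < 7)%N ->
  Jt x a 7 = e a * e (7 + a) * (e (7 - a) * e (14 - a)) * (e 7 * e 14).
Proof.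
move=> /andP[a0 a7]; rewrite JtE ?(ltnW a7) // -J7E JE; congr (_ * _ * _).
  rewrite (qq_mod (n := 2)) // !big_ord_recr big_ord0 /= mul1r muln0 muln1 addn0.
  by rewrite addnC.
rewrite (qq_mod (n := 2)) ?subn_gt0 // !big_ord_recr big_ord0 /= mul1r muln0 muln1 addn0.
by congr (_ * qq _ _); lia.
Qed.

Lemma J_prod1 : J x 1 * J x 14 ^+ 4
  = Jt x 1 7 * Jt x 5 14 * (Jt x 2 14 * Jt x 3 14 * Jt x 4 14).
Proof. by rewrite J1E J14E !Jt7E // !Jt14E //=; ring. Qed.

Lemma J_prod2 : J x 1 * J x 14 ^+ 4
  = Jt x 3 7 * Jt x 1 14 * (Jt x 2 14 * Jt x 5 14 * Jt x 6 14).
Proof. by rewrite J1E J14E !Jt7E // !Jt14E //=; ring. Qed.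

Lemma J_prod3 : J x 1 * J x 14 ^+ 4
  = Jt x 2 7 * Jt x 3 14 * (Jt x 1 14 * Jt x 4 14 * Jt x 6 14).
Proof. by rewrite J1E J14E !Jt7E // !Jt14E //=; ring. Qed.

Lemma J_prod4 : J x 2 * (Jt x 1 7 * Jt x 5 14 * Jt x 3 14)
  = J x 1 * J x 14 ^+ 2 * Jt x 6 14.
Proof. by rewrite J1E J2E J14E !Jt7E // !Jt14E //=; ring. Qed.

Lemma J_prod5 : J x 2 * (Jt x 3 7 * Jt x 1 14 * Jt x 5 14)
  = J x 1 * J x 14 ^+ 2 * Jt x 4 14.
Proof. by rewrite J1E J2E J14E !Jt7E // !Jt14E //=; ring. Qed.

Lemma J_prod6 : J x 1 * J x 7 ^+ 2 = Jt x 1 7 * Jt x 2 7 * Jt x 3 7.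
Proof. by rewrite J1E J7E !Jt7E //=; ring. Qed.

(** The triple product at s = z = x contains (-x;x^2)_oo squared, which (x;x^2)_oo (-x;x^2)_oo =
    (x^2;x^4)_oo expresses through [J]. *)
Lemma tht0_prod : tht x 0 = J x 2 ^+ 5 / (J x 1 ^+ 2 * J x 4 ^+ 2).
Proof.
have p0 : x ^+ 2 != 0 by rewrite expf_neq0.
have p1 : nm (x ^+ 2) < 1 by exact: nm_lt1X.
have e0 : x ^+ 2 / x = x by field.
have -> : tht x 0 = theta x x.
  by apply: eq_tsum => m; rewrite -expfzDr //; congr (_ ^ _); ring.
rewrite jacobi_triple // e0 //.
have h : qpochoo x (x ^+ 2) * qpochoo (- x) (x ^+ 2) = qpochoo (x ^+ 2) (x ^+ 4).
  by rewrite (qpochoo_sq x0 p0 p1) -exprM.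
have h1 : J x 1 = qpochoo x (x ^+ 2) * J x 2.
  by rewrite JE (qq_mod (n := 2)) // !big_ord_recr big_ord0 /= mul1r.
have h2 : J x 2 = qpochoo (x ^+ 2) (x ^+ 4) * J x 4.
  by rewrite JE (qq_mod (n := 2)) // !big_ord_recr big_ord0 /= mul1r.
have n1 := @J_neq0 1 isT; have n2 := @J_neq0 2 isT; have n4 := @J_neq0 4 isT.
have -> : qpochoo (- x) (x ^+ 2) = J x 2 ^+ 2 / (J x 1 * J x 4).
  apply: (mulIf n1); rewrite {1}h1 mulrA [_ * qpochoo x _]mulrC h.
  by rewrite h2; field; rewrite n1 n4.
by rewrite -/(qq 2 2) -JE; field; rewrite n1 n4.
Qed.

Lemma tht1_prod : tht x 1 = 2 * J x 4 ^+ 2 / J x 2.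
Proof.
have p0 : x ^+ 2 != 0 by rewrite expf_neq0.
have p1 : nm (x ^+ 2) < 1 by exact: nm_lt1X.
have -> : tht x 1 = theta x 1.
  rewrite /tht tsum_flip; apply: eq_tsum => m.
  by rewrite exp1rz mulr1; congr (_ ^ _); ring.
have n2 := @J_neq0 2 isT.
rewrite jacobi_triple ?oner_eq0 ?divr1 //.
have m1 : (-1 : C) != 0 by rewrite oppr_eq0 oner_eq0.
(* The first factor of (-1;x^2)_oo is 2, the source of the coefficients 2 in the theorem. *)
rewrite (qpochoo_rec m1 p0 p1) mulN1r.
have h : J x 2 * qpochoo (- x ^+ 2) (x ^+ 2) = J x 4.
  by rewrite {1}/J (qpochoo_sq p0 p0 p1) -!exprM.
by rewrite -[qpochoo (x ^+ 2) (x ^+ 2)]/(J x 2) -h; field.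
Qed.

(** [quintuple] at s = x^7, z = x^a; a < 7 keeps |s^2/z^2| below 1. Its two factors in base x^28 are
    those of J_{14-2a,28} without J_28, hence the quotient. *)
Lemma quint_prod (a : nat) : (0 < a < 7)%N ->
  quint x a%:Z = Jt x a 14 * Jt x (14 - 2 * a) 28 / J x 28.
Proof.
move=> /andP[a0 a7]; have n28 := @J_neq0 28 isT.
have s0 : x ^+ 7 != 0 by rewrite expf_neq0.
have z0 : x ^+ a != 0 by rewrite expf_neq0.
have d (m n : nat) : (n <= m)%N -> x ^+ m / x ^+ n = x ^+ (m - n).
  by move=> nm; rewrite expfB_cond // (negPf x0).
have e1 : x ^+ 7 ^+ 2 / x ^+ a = x ^+ (14 - a) by rewrite -exprM d //; lia.
have e2 : x ^+ 7 ^+ 2 / (x ^+ a) ^+ 2 = x ^+ (14 - 2 * a).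
  by rewrite -!exprM d; [congr (_ ^+ _)|]; lia.
have e3 : x ^+ 7 ^+ 2 * (x ^+ a) ^+ 2 = x ^+ (14 + 2 * a).
  by rewrite -!exprM -exprD; congr (_ ^+ _); lia.
have -> : quint x a%:Z = qq a 14 * qq (14 - a) 14 * qq 14 14
    * (qq (14 + 2 * a) 28 * qq (14 - 2 * a) 28).
  have := @quintuple _ _ (x ^+ 7) (x ^+ a) s0 _ z0; rewrite e1 e2 e3 -!exprM => ->.
  - rewrite /quint; congr (_ - _); apply: eq_tsum => t.
      by rewrite !exprXz -expfzDr //; congr (_ ^ _); ring.
    by rewrite !exprXz -expfzDr //; congr (_ ^ _); ring.
  - exact: nm_lt1X.
  - by apply: nm_lt1X => //; lia.
  - by apply: nm_lt1X => //; lia.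
rewrite !JtE; try lia.
rewrite (_ : 28 - (14 - 2 * a) = 14 + 2 * a)%N; last by lia.
by move: n28; rewrite JE => n28; field.
Qed.

End Products.

(** * The closed forms of the three double sums *)

Section ClosedForms.
Context {R : realType} {C : normedC R}.

Lemma J_pow (x : C) k m : J (x ^+ k) m = J x (k * m).
Proof. by rewrite /J -!exprM. Qed.

Lemma Jt_pow (x : C) k a m : (a <= m)%N -> Jt (x ^+ k) a m = Jt x (k * a) (k * m).
Proof.
by move=> am; rewrite !JtE ?leq_mul2l ?am ?orbT // /qq -!exprM mulnBr.
Qed.

Context (q : C) (q0 : q != 0) (q1 : nm q < 1).

Let x2 : q ^+ 2 != 0. Proof. exact: expf_neq0. Qed.
Let y2 : nm (q ^+ 2) < 1. Proof. exact: nm_lt1X. Qed.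
Let x4 : q ^+ 4 != 0. Proof. exact: expf_neq0. Qed.
Let y4 : nm (q ^+ 4) < 1. Proof. exact: nm_lt1X. Qed.

Let N1 : J q 1 != 0. Proof. exact: J_neq0. Qed.
Let N2 : J q 2 != 0. Proof. exact: J_neq0. Qed.
Let N4 : J q 4 != 0. Proof. exact: J_neq0. Qed.
Let N8 : J q 8 != 0. Proof. exact: J_neq0. Qed.
Let N28 : J q 28 != 0. Proof. exact: J_neq0. Qed.
Let N56 : J q 56 != 0. Proof. exact: J_neq0. Qed.

Let NJt a m : (0 < a < m)%N -> Jt q a m != 0. Proof. exact: Jt_neq0. Qed.

(** The single sums are evaluated as products of two [Jt]; the [P] identities turn these into the
    quotients of the theorem, and the [S] identities double a modulus. *)
Let P1 : J q 2 * J q 28 ^+ 4 = Jt q 2 14 * Jt q 10 28 * (Jt q 4 28 * Jt q 6 28 * Jt q 8 28).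
Proof. by have := J_prod1 x2 y2; rewrite !J_pow !Jt_pow. Qed.

Let P2 : J q 2 * J q 28 ^+ 4 = Jt q 6 14 * Jt q 2 28 * (Jt q 4 28 * Jt q 10 28 * Jt q 12 28).
Proof. by have := J_prod2 x2 y2; rewrite !J_pow !Jt_pow. Qed.

Let P3 : J q 2 * J q 28 ^+ 4 = Jt q 4 14 * Jt q 6 28 * (Jt q 2 28 * Jt q 8 28 * Jt q 12 28).
Proof. by have := J_prod3 x2 y2; rewrite !J_pow !Jt_pow. Qed.

Let P3' : J q 4 * J q 56 ^+ 4 = Jt q 8 28 * Jt q 12 56 * (Jt q 4 56 * Jt q 16 56 * Jt q 24 56).
Proof. by have := J_prod3 x4 y4; rewrite !J_pow !Jt_pow. Qed.

Let P4 : J q 8 * (Jt q 4 28 * Jt q 20 56 * Jt q 12 56) = J q 4 * J q 56 ^+ 2 * Jt q 24 56.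
Proof. by have := J_prod4 x4 y4; rewrite !J_pow !Jt_pow. Qed.

Let P5 : J q 8 * (Jt q 12 28 * Jt q 4 56 * Jt q 20 56) = J q 4 * J q 56 ^+ 2 * Jt q 16 56.
Proof. by have := J_prod5 x4 y4; rewrite !J_pow !Jt_pow. Qed.

Let P6 : J q 4 * J q 28 ^+ 2 = Jt q 4 28 * Jt q 8 28 * Jt q 12 28.
Proof. by have := J_prod6 x4 y4; rewrite !J_pow !Jt_pow. Qed.

Let S6 : Jt q 6 28 * J q 56 ^+ 2 = J q 28 * Jt q 6 56 * Jt q 22 56.
Proof. exact: (@Jt_split _ _ q q0 q1 6 28). Qed.

Let S10 : Jt q 10 28 * J q 56 ^+ 2 = J q 28 * Jt q 10 56 * Jt q 18 56.
Proof. exact: (@Jt_split _ _ q q0 q1 10 28). Qed.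

Let S2 : Jt q 2 28 * J q 56 ^+ 2 = J q 28 * Jt q 2 56 * Jt q 26 56.
Proof. exact: (@Jt_split _ _ q q0 q1 2 28). Qed.

Let S3 : Jt q 3 14 * J q 28 ^+ 2 = J q 14 * Jt q 3 28 * Jt q 11 28.
Proof. exact: (@Jt_split _ _ q q0 q1 3 14). Qed.

Let Jqq : qpochoo q q = J q 1. Proof. by []. Qed.
Let Jpp : qpochoo (q ^+ 2) (q ^+ 2) = J q 2. Proof. by []. Qed.

Let T0 : tht q 0 = J q 2 ^+ 5 / (J q 1 ^+ 2 * J q 4 ^+ 2).
Proof. exact: tht0_prod. Qed.
Let T1 : tht q 1 = 2 * J q 4 ^+ 2 / J q 2.
Proof. exact: tht1_prod. Qed.
Let T0' : tht (q ^+ 2) 0 = J q 4 ^+ 5 / (J q 2 ^+ 2 * J q 8 ^+ 2).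
Proof. by rewrite tht0_prod // !J_pow. Qed.
Let T1' : tht (q ^+ 2) 1 = 2 * J q 8 ^+ 2 / J q 4.
Proof. by rewrite tht1_prod // !J_pow. Qed.

Let solve_W (x W : C) a : x != 0 -> nm x < 1 -> (0 < a < 7)%N ->
  qpochoo x x * W = quint x a%:Z -> W = Jt x a 14 * Jt x (14 - 2 * a) 28 / (J x 28 * J x 1).
Proof.
move=> z0 z1 ha h; have n := J_neq0 z0 z1 (m := 1) isT.
have n28 := J_neq0 z0 z1 (m := 28) isT.
by apply: (mulfI n); rewrite [LHS]h quint_prod //; field; rewrite n n28.
Qed.

Let U3 : Wsum q 0 0 2 = Jt q 3 14 * Jt q 8 28 / (J q 28 * J q 1).
Proof. exact: (solve_W (a := 3) q0 q1 isT (Wsum_002 q0 q1)). Qed.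
Let U2 : Wsum q 0 2 2 = Jt q 1 14 * Jt q 12 28 / (J q 28 * J q 1).
Proof. exact: (solve_W (a := 1) q0 q1 isT (Wsum_022 q0 q1)). Qed.
Let U1 : Wsum q 1 2 2 = Jt q 5 14 * Jt q 4 28 / (J q 28 * J q 1).
Proof. exact: (solve_W (a := 5) q0 q1 isT (Wsum_122 q0 q1)). Qed.
Let V1 : Wsum q 0 1 1 = Jt q 2 14 * Jt q 10 28 / (J q 28 * J q 1).
Proof. exact: (solve_W (a := 2) q0 q1 isT (Wsum_011 q0 q1)). Qed.
Let V3 : Wsum q 1 1 3 = Jt q 4 14 * Jt q 6 28 / (J q 28 * J q 1).
Proof. exact: (solve_W (a := 4) q0 q1 isT (Wsum_113 q0 q1)). Qed.
Let V2 : Wsum q 1 3 3 = Jt q 6 14 * Jt q 2 28 / (J q 28 * J q 1).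
Proof. exact: (solve_W (a := 6) q0 q1 isT (Wsum_133 q0 q1)). Qed.

Let U3' : Wsum (q ^+ 2) 0 0 2 = Jt q 6 28 * Jt q 16 56 / (J q 56 * J q 2).
Proof. by have := solve_W (a := 3) x2 y2 isT (Wsum_002 x2 y2); rewrite !J_pow !Jt_pow. Qed.
Let U2' : Wsum (q ^+ 2) 0 2 2 = Jt q 2 28 * Jt q 24 56 / (J q 56 * J q 2).
Proof. by have := solve_W (a := 1) x2 y2 isT (Wsum_022 x2 y2); rewrite !J_pow !Jt_pow. Qed.
Let U1' : Wsum (q ^+ 2) 1 2 2 = Jt q 10 28 * Jt q 8 56 / (J q 56 * J q 2).
Proof. by have := solve_W (a := 5) x2 y2 isT (Wsum_122 x2 y2); rewrite !J_pow !Jt_pow. Qed.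
Let V1' : Wsum (q ^+ 2) 0 1 1 = Jt q 4 28 * Jt q 20 56 / (J q 56 * J q 2).
Proof. by have := solve_W (a := 2) x2 y2 isT (Wsum_011 x2 y2); rewrite !J_pow !Jt_pow. Qed.
Let V3' : Wsum (q ^+ 2) 1 1 3 = Jt q 8 28 * Jt q 12 56 / (J q 56 * J q 2).
Proof. by have := solve_W (a := 4) x2 y2 isT (Wsum_113 x2 y2); rewrite !J_pow !Jt_pow. Qed.
Let V2' : Wsum (q ^+ 2) 1 3 3 = Jt q 12 28 * Jt q 4 56 / (J q 56 * J q 2).
Proof. by have := solve_W (a := 6) x2 y2 isT (Wsum_133 x2 y2); rewrite !J_pow !Jt_pow. Qed.

Let solve_mul (a b d : C) : d != 0 -> b = a * d -> a = b / d.
Proof. by move=> d0 ->; rewrite mulfK. Qed.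

Let Jt24 : Jt q 2 4 = J q 2 ^+ 2 / J q 4.
Proof.
have e : J q 2 = qq q 2 4 * J q 4.
  by rewrite JE (qq_mod q0 q1 (n := 2)) // !big_ord_recr big_ord0 /= mul1r.
by rewrite JtE // e -/(J q 4) JE; move: N4; rewrite JE => n4; field.
Qed.

Let Jt48 : Jt q 4 8 = J q 4 ^+ 2 / J q 8.
Proof.
have e : J q 4 = qq q 4 8 * J q 8.
  by rewrite JE (qq_mod q0 q1 (n := 2)) // !big_ord_recr big_ord0 /= mul1r.
by rewrite JtE // e JE; move: N8; rewrite JE => n8; field.
Qed.

Lemma first_closed_00 : tsum (dterm q 0 0) =
  J q 2 ^+ 6 * J q 28 ^+ 3
    / (J q 1 ^+ 4 * J q 4 ^+ 2 * Jt q 4 28 * Jt q 6 28 * Jt q 8 28)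
  - 2 * q * (J q 4 ^+ 2 * Jt q 4 28 * Jt q 5 14 / (J q 1 ^+ 2 * J q 2 * J q 28)).
Proof.
have [s [s0 s1 sE]] := sqrt_lt1 q0 q1.
apply: (mulfI N1); rewrite -{1}Jqq (first_form_00 q0 q1 s0 s1 sE) T0 T1 V1 U1.
have n4 := @NJt 4 28 isT; have n6 := @NJt 6 28 isT; have n8 := @NJt 8 28 isT.
rewrite (solve_mul (mulf_neq0 (mulf_neq0 n4 n6) n8) P1).
field; by rewrite N1 N2 N4 N28 n4 n6 n8.
Qed.

Lemma first_closed_m12 : tsum (dterm q (-1) 2) =
  2 * (J q 4 ^+ 2 * Jt q 1 14 * Jt q 12 28 / (J q 1 ^+ 2 * J q 2 * J q 28))
  - q * (J q 2 ^+ 6 * J q 28 ^+ 3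
    / (J q 1 ^+ 4 * J q 4 ^+ 2 * Jt q 4 28 * Jt q 10 28 * Jt q 12 28)).
Proof.
have [s [s0 s1 sE]] := sqrt_lt1 q0 q1.
apply: (mulfI N1); rewrite -{1}Jqq (first_form_m12 q0 q1 s0 s1 sE) T0 T1 U2 V2.
have n4 := @NJt 4 28 isT; have n6 := @NJt 10 28 isT; have n8 := @NJt 12 28 isT.
rewrite (solve_mul (mulf_neq0 (mulf_neq0 n4 n6) n8) P2).
field; by rewrite N1 N2 N4 N28 n4 n6 n8.
Qed.

Lemma first_closed_10 : tsum (dterm q 1 0) =
  2 * (J q 4 ^+ 3 * J q 14 * Jt q 3 28 * Jt q 11 28
    / (J q 1 ^+ 2 * J q 2 * J q 28 * Jt q 4 28 * Jt q 12 28))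
  - J q 2 ^+ 6 * J q 28 ^+ 3
    / (J q 1 ^+ 4 * J q 4 ^+ 2 * Jt q 2 28 * Jt q 8 28 * Jt q 12 28).
Proof.
have [s [s0 s1 sE]] := sqrt_lt1 q0 q1.
apply: (mulfI N1); rewrite -{1}Jqq (first_form_10 q0 q1 s0 s1 sE) T0 T1 U3 V3.
have n2 := @NJt 2 28 isT; have n4 := @NJt 4 28 isT.
have n8 := @NJt 8 28 isT; have n12 := @NJt 12 28 isT.
rewrite (solve_mul (mulf_neq0 (mulf_neq0 n2 n8) n12) P3).
(* Meant for the numerator of the first term only; the occurrence produced by [P3] stays in its
   denominator. *)
have e8 : Jt q 8 28 = J q 4 * J q 28 ^+ 2 / (Jt q 4 28 * Jt q 12 28).
  by apply: solve_mul (mulf_neq0 n4 n12) _; rewrite P6; ring.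
have e3 : Jt q 3 14 = J q 14 * Jt q 3 28 * Jt q 11 28 / J q 28 ^+ 2.
  by apply: solve_mul (expf_neq0 2 N28) _; rewrite S3.
rewrite e3 {1}e8; field; by rewrite N1 N2 N4 N28 n2 n4 n8 n12.
Qed.

Lemma second_closed_00 : tsum (dterm q 0 0) =
  J q 4 ^+ 5 * J q 28 * Jt q 6 56 * Jt q 16 56 * Jt q 22 56
    / (J q 2 ^+ 4 * J q 8 ^+ 2 * J q 56 ^+ 3)
  + 2 * q * (J q 4 * J q 8 * J q 56 ^+ 3
    / (Jt q 2 4 * Jt q 4 8 * Jt q 4 56 * Jt q 16 56 * Jt q 24 56)).
Proof.
apply: (mulfI N2); rewrite -{1}Jpp (second_form_00 q0 q1) T0' T1' U3' V3' Jt24 Jt48.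
have n4 := @NJt 4 56 isT; have n16 := @NJt 16 56 isT; have n24 := @NJt 24 56 isT.
rewrite (solve_mul (mulf_neq0 (mulf_neq0 n4 n16) n24) P3').
rewrite (solve_mul (expf_neq0 2 N56) (esym S6)).
field; by rewrite N2 N4 N8 N56 n4 n16 n24.
Qed.

Lemma second_closed_m12 : tsum (dterm q (-1) 2) =
  2 * (J q 8 * J q 56 * Jt q 24 56 / (J q 2 ^+ 2 * Jt q 12 56))
  + q * (J q 4 ^+ 5 * J q 28 * Jt q 8 56 * Jt q 10 56 * Jt q 18 56
    / (J q 2 ^+ 4 * J q 8 ^+ 2 * J q 56 ^+ 3)).
Proof.
apply: (mulfI N2); rewrite -{1}Jpp (second_form_m12 q0 q1) T0' T1' V1' U1'.
have n12 := @NJt 12 56 isT.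
have e : Jt q 4 28 * Jt q 20 56 = J q 4 * J q 56 ^+ 2 * Jt q 24 56 / (J q 8 * Jt q 12 56).
  by apply: solve_mul (mulf_neq0 N8 n12) _; rewrite -P4; ring.
rewrite e (solve_mul (expf_neq0 2 N56) (esym S10)).
field; by rewrite N2 N4 N8 N56 n12.
Qed.

Lemma second_closed_10 : tsum (dterm q 1 0) =
  J q 4 ^+ 5 * J q 28 * Jt q 2 56 * Jt q 24 56 * Jt q 26 56
    / (J q 2 ^+ 4 * J q 8 ^+ 2 * J q 56 ^+ 3)
  + 2 * q ^+ 3 * (J q 8 * J q 56 * Jt q 16 56 / (J q 2 ^+ 2 * Jt q 20 56)).
Proof.
apply: (mulfI N2); rewrite -{1}Jpp (second_form_10 q0 q1) T0' T1' U2' V2'.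
have n20 := @NJt 20 56 isT.
have e : Jt q 12 28 * Jt q 4 56 = J q 4 * J q 56 ^+ 2 * Jt q 16 56 / (J q 8 * Jt q 20 56).
  by apply: solve_mul (mulf_neq0 N8 n20) _; rewrite -P5; ring.
rewrite e (solve_mul (expf_neq0 2 N56) (esym S2)).
field; by rewrite N2 N4 N8 N56 n20.
Qed.

End ClosedForms.

(** * The complex numbers *)

Section ComplexModulus.
Context {R : realType}.
Implicit Types x y : R[i].

Arguments normc : simpl never.

Lemma normc_ge0 x : 0 <= normc x.
Proof. by case: x => a b; apply: sqrtr_ge0. Qed.

Lemma normc_eq0 x : (normc x == 0) = (x == 0).
Proof. by apply/eqP/eqP => [/eq0_normc|->]; rewrite ?normc0. Qed.

Lemma normc_real (a : R) : normc (a%:C)%C = `|a|.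
Proof. by rewrite /normc /= expr0n addr0 sqrtr_sqr. Qed.

Lemma normc_le_ReIm x : normc x <= `|complex.Re x| + `|complex.Im x|.
Proof.
rewrite {1}[x]complexE.
apply: (le_trans (le_normcD _ _)); rewrite normcM !normc_real.
by rewrite /normc /= expr0n expr1n add0r sqrtr1 mul1r.
Qed.

Lemma ReIm_le_normc x : `|complex.Re x| <= normc x /\ `|complex.Im x| <= normc x.
Proof.
case: x => a b /=; rewrite /normc /=; split; rewrite -sqrtr_sqr ler_sqrt.
- by rewrite lerDl sqr_ge0.
- by rewrite addr_ge0 ?sqr_ge0.
- by rewrite lerDr sqr_ge0.
- by rewrite addr_ge0 ?sqr_ge0.
Qed.

Lemma real_sum_cvg (I : choiceType) (f : I -> R) (M : R) :
  (forall i, 0 <= f i) -> (forall A : {fset I}, \sum_(i <- A) f i <= M) ->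
  exists l, forall e, 0 < e -> exists A : {fset I}, forall B : {fset I},
    (A `<=` B)%fset -> `|\sum_(i <- B) f i - l| < e.
Proof.
move=> f0 fM.
pose E := [set x | exists A : {fset I}, x = \sum_(i <- A) f i]%classic.
have hE : has_sup E.
  split; first by exists (\sum_(i <- fset0) f i); exists fset0.
  by exists M => x [A ->].
exists (sup E) => e e0.
have [x [A ->] hA] := sup_adherent e0 hE.
exists A => B AB.
have le1 : \sum_(i <- B) f i <= sup E by apply: sup_upper_bound => //; exists B.
have le2 : \sum_(i <- A) f i <= \sum_(i <- B) f i.
  by apply: fsum_subset.
rewrite ler0_norm ?subr_le0 //; lra.
Qed.

(** The family is the difference of the nonnegative families |f| + f and |f|. *)
Lemma real_abs_sum_cvg (I : choiceType) (f : I -> R) (M : R) :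
  (forall A : {fset I}, \sum_(i <- A) `|f i| <= M) ->
  exists l, forall e, 0 < e -> exists A : {fset I}, forall B : {fset I},
    (A `<=` B)%fset -> `|\sum_(i <- B) f i - l| < e.
Proof.
move=> fM.
have [l1 h1] := real_sum_cvg (fun i => normr_ge0 (f i)) fM.
have [||l2 h2] := @real_sum_cvg I (fun i => `|f i| + f i) (M + M).
- by move=> i; have := ler_norm (- f i); rewrite normrN; lra.
- move=> A; rewrite big_split lerD //=; apply: le_trans (fM A).
  by apply: ler_sum => i _; exact: ler_norm.
exists (l2 - l1) => e e0.
have [A1 hA1] := h1 _ (divr_gt0 e0 (ltr0Sn _ 1)).
have [A2 hA2] := h2 _ (divr_gt0 e0 (ltr0Sn _ 1)).
exists (A1 `|` A2)%fset => B; rewrite fsubUset => /andP[s1 s2].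
have := hA1 _ s1; have := hA2 _ s2; rewrite big_split /=.
set a := \sum_(i <- B) `|f i|; set b := \sum_(i <- B) f i => u v.
have -> : b - (l2 - l1) = (a + b - l2) - (a - l1) by ring.
by rewrite (le_lt_trans (ler_normB _ _)) //; lra.
Qed.

Lemma complex_complete (I : choiceType) (F : I -> R[i]) :
  smb_wrt (@normc R) F -> exists l, hsum_wrt (@normc R) F l.
Proof.
move=> [M hM].
have [|l1 h1] := @real_abs_sum_cvg I (fun i => complex.Re (F i)) M.
  move=> A; apply: le_trans (hM A); apply: ler_sum => i _.
  by have [] := ReIm_le_normc (F i).
have [|l2 h2] := @real_abs_sum_cvg I (fun i => complex.Im (F i)) M.
  move=> A; apply: le_trans (hM A); apply: ler_sum => i _.
  by have [] := ReIm_le_normc (F i).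
exists (l1 +i* l2)%C => e e0.
have [A1 hA1] := h1 _ (divr_gt0 e0 (ltr0Sn _ 1)).
have [A2 hA2] := h2 _ (divr_gt0 e0 (ltr0Sn _ 1)).
exists (A1 `|` A2)%fset => B; rewrite fsubUset => /andP[s1 s2].
apply: (le_lt_trans (normc_le_ReIm _)).
have -> : complex.Re (\sum_(i <- B) F i - (l1 +i* l2)%C)
   = \sum_(i <- B) complex.Re (F i) - l1.
  rewrite (raddfB (@complex.Re R : Rcomplex R -> R)) /=.
  by rewrite (raddf_sum (@complex.Re R : Rcomplex R -> R)).
have -> : complex.Im (\sum_(i <- B) F i - (l1 +i* l2)%C)
   = \sum_(i <- B) complex.Im (F i) - l2.
  rewrite (raddfB (@complex.Im R : Rcomplex R -> R)) /=.
  by rewrite (raddf_sum (@complex.Im R : Rcomplex R -> R)).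
by have := hA1 _ s1; have := hA2 _ s2; lra.
Qed.

(** In the partial order of [R[i]], 0 < e forces e to be real, so its real part serves as radius. *)
Lemma normc_norm (e : R[i]) : 0 < e ->
  exists2 d : R, 0 < d & forall x, normc x < d -> `|x| < e.
Proof.
move=> e0; have re : e = ((complex.Re e)%:C)%C by rewrite RRe_real // gtr0_real.
rewrite re (ltcR 0) in e0; exists (complex.Re e) => // x h.
by rewrite re (_ : `|x| = ((normc x)%:C)%C) ?ltcR //; case: x h.
Qed.

Definition complexC : normedC R :=
  @NormedC R R[i] (@normc R) normc_ge0 (@normcM R) (@le_normcD R) (@normcN R) (@normc1 R)
    normc_eq0 normc_norm (fun x => ex_intro _ (sqrtC x) (sqrtCK x)) complex_complete.

End ComplexModulus.

Arguments complexC : clear implicits.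

(** * From sums in the modulus to convergence along finite subsets *)

Section DoubleSumLimit.
Context {R : realType} {C : normedC R}.

Lemma dsum_to_hsum (F : nat -> nat -> C) (l : C) :
  hsum (fun ij : nat * nat => F ij.1 ij.2) l -> dsum_to F l.
Proof.
have FF : Filter (@totally (nat * nat)%type) := totally_filter.
move=> h; apply/(@cvgrPdist_lt _ _ _ _ FF) => e e0.
have [d d0 hd] := nm_norm e0; have [A hA] := h _ d0.
exists A => // B AB /=; apply: hd; rewrite nm_distC /partial_sum.
by have := hA B AB; rewrite big_seq_fsetE.
Qed.

(** A nonzero [dterm] has nonnegative indices, so the sum over pairs of integers is the sum over
    pairs of naturals. *)
Lemma dsum_to_dterm (q : C) (al be : int) (F : nat -> nat -> C) :
  q != 0 -> nm q < 1 -> `|al| <= 2 -> `|be| <= 2 ->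
  (forall i j, F i j = dterm q al be (i%:Z, j%:Z)) ->
  dsum_to F (tsum (dterm q al be)).
Proof.
move=> q0 q1 hal hbe FE; apply: dsum_to_hsum.
have h := smbP (smb_dterm q0 q1 hal hbe).
rewrite (_ : (fun _ => _) = fun ij : nat * nat => dterm q al be (ij.1%:Z, ij.2%:Z)); last first.
  by apply/funext => -[i j]; exact: FE.
apply: (hsum_reindex (g := fun ij : nat * nat => (ij.1%:Z, ij.2%:Z))
  (h := fun x : int * int => (`|x.1|%N, `|x.2|%N)) _ _ h) => [[i j] //|[i j]].
rewrite /dterm mulf_eq0 negb_or => /andP[+ _].
by rewrite mulf_eq0 negb_or => /andP[/iq_neq0 /= i0 /iq_neq0 /= j0]; congr pair; lia.
Qed.

End DoubleSumLimit.

Theorem theorem3p4 (R : realType) (q : R[i]) (hq : 0 < `|q| < 1) :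
  [/\ dsum_to
        (fun i j : nat =>
           q ^ (i%:Z ^+ 2 - 2 * i%:Z * j%:Z + 2 * j%:Z ^+ 2)
           / (qpoch q q i * qpoch (q ^+ 2) (q ^+ 2) j))
        (J q 2 ^+ 6 * J q 28 ^+ 3
           / (J q 1 ^+ 4 * J q 4 ^+ 2 * Jt q 4 28 * Jt q 6 28 * Jt q 8 28)
         - 2 * q * (J q 4 ^+ 2 * Jt q 4 28 * Jt q 5 14
           / (J q 1 ^+ 2 * J q 2 * J q 28)))
      /\
      J q 2 ^+ 6 * J q 28 ^+ 3
        / (J q 1 ^+ 4 * J q 4 ^+ 2 * Jt q 4 28 * Jt q 6 28 * Jt q 8 28)
      - 2 * q * (J q 4 ^+ 2 * Jt q 4 28 * Jt q 5 14
        / (J q 1 ^+ 2 * J q 2 * J q 28))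
      = J q 4 ^+ 5 * J q 28 * Jt q 6 56 * Jt q 16 56 * Jt q 22 56
          / (J q 2 ^+ 4 * J q 8 ^+ 2 * J q 56 ^+ 3)
        + 2 * q * (J q 4 * J q 8 * J q 56 ^+ 3
          / (Jt q 2 4 * Jt q 4 8 * Jt q 4 56 * Jt q 16 56 * Jt q 24 56)),
      dsum_to
        (fun i j : nat =>
           q ^ (i%:Z ^+ 2 - 2 * i%:Z * j%:Z + 2 * j%:Z ^+ 2
                - i%:Z + 2 * j%:Z)
           / (qpoch q q i * qpoch (q ^+ 2) (q ^+ 2) j))
        (2 * (J q 4 ^+ 2 * Jt q 1 14 * Jt q 12 28
           / (J q 1 ^+ 2 * J q 2 * J q 28))
         - q * (J q 2 ^+ 6 * J q 28 ^+ 3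
           / (J q 1 ^+ 4 * J q 4 ^+ 2 * Jt q 4 28 * Jt q 10 28 * Jt q 12 28)))
      /\
      2 * (J q 4 ^+ 2 * Jt q 1 14 * Jt q 12 28
        / (J q 1 ^+ 2 * J q 2 * J q 28))
      - q * (J q 2 ^+ 6 * J q 28 ^+ 3
        / (J q 1 ^+ 4 * J q 4 ^+ 2 * Jt q 4 28 * Jt q 10 28 * Jt q 12 28))
      = 2 * (J q 8 * J q 56 * Jt q 24 56 / (J q 2 ^+ 2 * Jt q 12 56))
        + q * (J q 4 ^+ 5 * J q 28 * Jt q 8 56 * Jt q 10 56 * Jt q 18 56
          / (J q 2 ^+ 4 * J q 8 ^+ 2 * J q 56 ^+ 3))
    & dsum_to
        (fun i j : nat =>
           q ^ (i%:Z ^+ 2 - 2 * i%:Z * j%:Z + 2 * j%:Z ^+ 2 + i%:Z)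
           / (qpoch q q i * qpoch (q ^+ 2) (q ^+ 2) j))
        (2 * (J q 4 ^+ 3 * J q 14 * Jt q 3 28 * Jt q 11 28
           / (J q 1 ^+ 2 * J q 2 * J q 28 * Jt q 4 28 * Jt q 12 28))
         - J q 2 ^+ 6 * J q 28 ^+ 3
           / (J q 1 ^+ 4 * J q 4 ^+ 2 * Jt q 2 28 * Jt q 8 28 * Jt q 12 28))
      /\
      2 * (J q 4 ^+ 3 * J q 14 * Jt q 3 28 * Jt q 11 28
        / (J q 1 ^+ 2 * J q 2 * J q 28 * Jt q 4 28 * Jt q 12 28))
      - J q 2 ^+ 6 * J q 28 ^+ 3
        / (J q 1 ^+ 4 * J q 4 ^+ 2 * Jt q 2 28 * Jt q 8 28 * Jt q 12 28)
      = J q 4 ^+ 5 * J q 28 * Jt q 2 56 * Jt q 24 56 * Jt q 26 56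
          / (J q 2 ^+ 4 * J q 8 ^+ 2 * J q 56 ^+ 3)
        + 2 * q ^+ 3 * (J q 8 * J q 56 * Jt q 16 56
          / (J q 2 ^+ 2 * Jt q 20 56))].
Proof.
have [q0 q1] : q != 0 /\ nm (q : complexC R) < 1.
  move: hq => /andP[+ h]; rewrite normr_gt0 => -> ; split=> //.
  by move: h; rewrite -ltcR; case: (q).
have dsum (F : nat -> nat -> R[i]) (al be : int) (l : R[i]) : `|al| <= 2 -> `|be| <= 2 ->
    (forall i j, F i j = dterm (q : complexC R) al be (i%:Z, j%:Z)) ->
    tsum (dterm (q : complexC R) al be) = l -> dsum_to F l.
  by move=> hal hbe FE <-; exact: (@dsum_to_dterm R (complexC R)).
split; split.
- apply: (dsum _ 0 0 _ isT isT) => [i j|]; last exact: first_closed_00.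
  by rewrite /dterm /= !mul0r !addr0 invfM mulrC.
- rewrite -(@first_closed_00 R (complexC R) q q0 q1).
  by rewrite -(@second_closed_00 R (complexC R) q q0 q1).
- apply: (dsum _ (-1) 2 _ isT isT) => [i j|]; last exact: first_closed_m12.
  by rewrite /dterm /= mulN1r invfM mulrC.
- rewrite -(@first_closed_m12 R (complexC R) q q0 q1).
  by rewrite -(@second_closed_m12 R (complexC R) q q0 q1).
- apply: (dsum _ 1 0 _ isT isT) => [i j|]; last exact: first_closed_10.
  by rewrite /dterm /= mul1r mul0r addr0 invfM mulrC.
- rewrite -(@first_closed_10 R (complexC R) q q0 q1).
  by rewrite -(@second_closed_10 R (complexC R) q q0 q1).
Qed.
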